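(* Let $T$ be a finite plane tree with an integer weight assigned to each vertex, and let $L(T)\subset\mathbb{R}^3$ be the associated arborescent link. Then the bridge number of $L(T)$ is bounded above by the maximal component number of the underlying plane tree $T$: $$\beta(L(T))\leq m(T).$$
   Context: **Plane trees and arborescent links.** A plane tree is a finite (non-empty) tree embedded in the plane; what matters is the tree together with the induced cyclic order of the edges at each vertex. A weighted plane tree is a plane tree with an integer $w_v$ attached to each vertex $v$. It determines an arborescent link $L(T)\subset\mathbb{R}^3$ as follows. To each vertex $v$ associate an unknotted band $A_v$ (annulus or Möbius band) with $w_v$ half twists. For each edge incident to $v$ choose a square patch in $A_v$ (a piece of the band running across its full width), these squares being disjoint, lying in an untwisted flat part of $A_v$, and occurring along the core of $A_v$ in the cyclic order prescribed by the plane embedding; all half twists of $A_v$ are placed between two cyclically consecutive squares (a fixed choice of this location at each vertex is part of the convention). For every edge $\{u,v\}$ the bands $A_u$ and $A_v$ are plumbed together: the corresponding squares are identified so that the core direction of $A_u$ matches the transverse direction of $A_v$ and vice versa, and, away from the common square, the part of the surface coming from the component of $T\setminus\{u,v\}$ (edge removed) containing $u$ lies in a ball on one side of the square, disjoint from the part coming from the component containing $v$. The link $L(T)$ is the boundary of the resulting surface. (Equivalently, each vertex is a twist region, and edges indicate how the twisted bands are glued; a tree that is a path gives a two-bridge link, the closure of a rational tangle.) **Maximal component number.** For a plane tree $T$ (without weights), $m(T)$ is the maximal number of components of $L(T)$ over all assignments of integer weights to the vertices of $T$. **Bridge number.** $\beta(L)$ is the minimal number of local maxima of $L$ with respect to a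 fixed direction in $\mathbb{R}^3$, minimised over all isotopic representatives of $L$. *)

(* Defs.v *)
From HB Require Import structures.
From mathcomp Require Import all_boot all_order all_algebra.
From mathcomp Require Import all_classical all_reals all_analysis.

Set Implicit Arguments.
Unset Strict Implicit.
Unset Printing Implicit Defensive.

Import Order.TTheory GRing.Theory Num.Theory.
Import numFieldNormedType.Exports.
Local Open Scope classical_set_scope.
Local Open Scope ring_scope.

(* A finite plane tree, rooted in order to be described inductively, with a
   label at each vertex.  For the vertex [Node a l r], going around the vertex
   one meets: the edge to the parent (if any), the edges to the children in
   [l], the corner where the half twists of the band are placed, and the edges
   to the children in [r].  Both the plane structure and the location of the
   twists at each vertex are thus arbitrary. *)
Inductive plane_tree (A : Type) : Type :=
  Node of A & seq (plane_tree A) & seq (plane_tree A).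

Fixpoint relabel (A B : Type) (f : A -> B) (T : plane_tree A) : plane_tree B :=
  let: Node a l r := T in
  Node (f a) [seq relabel f c | c <- l] [seq relabel f c | c <- r].

Definition underlying (T : plane_tree int) : plane_tree unit :=
  relabel (fun=> tt) T.

Section Geometry.
Variable R : realType.

Definition space3 : Type := (R * R * R)%type.

(* Every piece of a band is parametrized by a coordinate along the core and a
   coordinate y in [0, 1] across the band.  All definitions below depend on a
   set E of values for y: E = [0, 1] gives the surface, and E = {0, 1} gives
   the sides of the bands, i.e. the boundary of the surface. *)

(* A flat strip with core [0, 1] x {1/2} in the plane z = 0. *)
Definition flat (E : set R) : set space3 :=
  [set (x, y, 0) | x in `[0, 1] & y in E].

(* A strip turning around its core by w half turns. *)
Definition twisted (E : set R) (w : int) : set space3 :=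
  [set (x, 2^-1 + (y - 2^-1) * cos (pi * w%:~R * x),
           2^-1 * (y - 2^-1) * sin (pi * w%:~R * x)) | x in `[0, 1] & y in E].

(* The k-th of m consecutive cells along the top of an arch. *)
Definition place (m k : nat) (p : space3) : space3 :=
  let: (x, y, z) := p in ((k%:R + x) / m%:R, y, 2^-1 + z).

(* The pieces of the list ps, in this order, separated by flat strips. *)
Definition arch_top (E : set R) (ps : seq (set space3)) : set space3 :=
  let qs := flat E :: flatten [seq [:: p; flat E] | p <- ps] in
  \bigcup_k (place (size qs) k @` nth set0 qs k).

(* Plumbing a band: the square [0, 1]^2 x {0} of the child band is identified
   with a square of the parent band by exchanging the core and transverse
   directions.  The z axis is reversed so that the map preserves the
   orientation of space; the rest of the child band lies in a box on one side
   of the square.  In the square only corners belong to the boundary of the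
   plumbed surface, whence E for both coordinates. *)
Definition plumb (E : set R) (B : set space3) : set space3 :=
  (fun p : space3 => let: (x, y, z) := p in (y, x, - (z / 4))) @`
    ([set (x, y, 0) | x in E & y in E] `|` B).

(* The vertical walls of an arch over the square [0, 1]^2 x {0}. *)
Definition walls (E : set R) : set space3 :=
  [set (a, yz.1, yz.2) | a in [set 0; 1] & yz in E `*` `[0, 2^-1]].

(* The band of a vertex is an arch over the square [0, 1]^2 x {0} along which
   it is plumbed to its parent.  The top of the arch carries the squares of the
   children and the half twists. *)
Fixpoint branch (E : set R) (T : plane_tree int) : set space3 :=
  let: Node w l r := T in
  walls E `|`
  arch_top E ([seq plumb E (branch E c) | c <- l]
         ++ twisted E w :: [seq plumb E (branch E c) | c <- r]).

(* The band of the root is closed by a flat strip. *)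
Definition plumbing (E : set R) (T : plane_tree int) : set space3 :=
  flat E `|` branch E T.

Definition arborescent_surface (T : plane_tree int) : set space3 :=
  plumbing `[0, 1] T.

Definition arborescent_link (T : plane_tree int) : set space3 :=
  plumbing [set 0; 1] T.

Definition component_number (L : set space3) : \bar R :=
  counting [set connected_component L p | p in L].

Definition max_component_number (T : plane_tree unit) : \bar R :=
  ereal_sup [set component_number (arborescent_link W)
            | W in [set W | underlying W = T]].

Definition homeomorphism (f : space3 -> space3) : Prop :=
  exists g : space3 -> space3,
    [/\ continuous f, continuous g, cancel f g & cancel g f].

Definition isotopic (L L' : set space3) : Prop :=
  exists F : R * space3 -> space3,
    [/\ {within `[0, 1] `*` setT, continuous F},
        forall p, F (0, p) = p,
        forall t : R, t \in `[0, 1] -> homeomorphism (fun p => F (t, p)) &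
        (fun p => F (1, p)) @` L = L'].

Definition local_maxima (L : set space3) : set space3 :=
  [set p | L p /\ \forall q \near p, L q -> q.2 <= p.2].

(* The infimum ignores representatives with infinitely many local maxima, for
   which the count is +oo. *)
Definition bridge_number (L : set space3) : \bar R :=
  ereal_inf [set counting (local_maxima L') | L' in [set L' | isotopic L L']].

End Geometry.

Arguments arborescent_link R T : clear implicits.
Arguments arborescent_surface R T : clear implicits.
Arguments max_component_number R T : clear implicits.

(* Main.v *)
(* Let P be the smallest number of disjoint paths that cover the vertices of
   the tree.  Then the bridge number is at most P + 1 and P + 1 is at most the
   maximal component number.

   Both bounds follow the greedy computation of P: a branch is open if some
   smallest path cover of it has a path ending at its root.  A vertex with no
   open child starts a new path, one with a single open child continues a path,
   and one with at least two open children joins two paths.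

   Upper bound.  Homeomorphisms with bounded displacement are isotopic to the
   identity by Alexander's trick, and so are maps increasing on all vertical
   lines.  A continuous function on a compact set which increases steeply along
   vertical lines extends to the whole space, so that after a deformation of the
   link it suffices to find such a function on the link, with few local maxima.
   It is built band by band, after flypes that move the half twists of each band
   to a place where its two sides can descend together, so that twists cost
   nothing.  What is known of a branch is a strategy in a game: the heights of
   some of its four ends are given, those of the others are chosen afterwards.

   Lower bound.  With weights 0 and 1, chosen again greedily, the sides of the
   band of an open branch run along the band, straight or crossed at will, while
   those of a closed branch turn back; components are counted by means of
   continuous functions with integer values. *)

Require Import Defs.
From mathcomp Require Import all_boot all_order all_algebra.
From mathcomp Require Import all_classical all_reals all_analysis.
From mathcomp Require Import finmap ring lra zify.

Set Implicit Arguments.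
Unset Strict Implicit.
Unset Printing Implicit Defensive.

Import Order.TTheory GRing.Theory Num.Theory.
Import numFieldNormedType.Exports.
Local Open Scope classical_set_scope.
Local Open Scope ring_scope.

(** * Homeomorphisms of space *)

(** The bounds meet because they obey one recursion. Let S be the sum of the numbers of the children
    and m the number of open ones. For heights, a band needs a hub, where one strand comes in and
    three leave, or the reverse. On a flat piece the first kind costs one maximum and the second
    none; an open child serves as the first kind for its own number and as the second for one less.
    Hence S + 1, S and S - 1 for m = 0, m = 1 and m >= 2. For components, m >= 2 open children that
    cut the band enclose m - 1 closed curves, and (S - m) + (m - 1) = S - 1. Heights cannot be fixed
    on each branch beforehand, since those at its ends must fit neighbours that depend on other
    neighbours in turn. This is what the game handles: gluing is a composition of strategies. The
    vertical order of the strands encodes crossings. Plumbing and flypes may reverse it, so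
    strategies are built for both values of [sg]. Plumbing also exchanges the direction of the core
    with the side of the band, so a schedule of a branch is read differently by its parent. *)

Section Continuity.
Context {R : realType}.
Implicit Types T U : topologicalType.

Lemma cont_comp T U (V : topologicalType) (f : T -> U) (g : U -> V) :
  continuous f -> continuous g -> continuous (fun p => g (f p)).
Proof. by move=> cf cg p; apply: continuous_comp; [exact: cf|exact: cg]. Qed.

Lemma cont_fst T U : continuous (@fst T U).
Proof. by move=> p; exact: cvg_fst. Qed.

Lemma cont_snd T U : continuous (@snd T U).
Proof. by move=> p; exact: cvg_snd. Qed.

Lemma cont_pair T U (V : topologicalType) (f : T -> U) (g : T -> V) :
  continuous f -> continuous g -> continuous (fun p => (f p, g p)).
Proof. by move=> cf cg p; apply: cvg_pair; [exact: cf|exact: cg]. Qed.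

Lemma cont_pair_at T U (V : topologicalType) (f : T -> U) (g : T -> V) (x : T) :
  {for x, continuous f} -> {for x, continuous g} ->
  {for x, continuous (fun p => (f p, g p))}.
Proof. exact: cvg_pair. Qed.

Lemma cont_cst T U (a : U) : continuous (fun _ : T => a).
Proof. by move=> p; exact: cvg_cst. Qed.

Lemma cont_id T : continuous (fun p : T => p).
Proof. by move=> p; exact: cvg_id. Qed.

Lemma cont_fstf T U (V : topologicalType) (f : T -> (U * V)%type) :
  continuous f -> continuous (fun p => (f p).1).
Proof. by move=> cf; apply: cont_comp cf (@cont_fst _ _). Qed.

Lemma cont_sndf T U (V : topologicalType) (f : T -> (U * V)%type) :
  continuous f -> continuous (fun p => (f p).2).
Proof. by move=> cf; apply: cont_comp cf (@cont_snd _ _). Qed.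

Variable T : topologicalType.
Implicit Types f g : T -> R.

Lemma cont_add f g : continuous f -> continuous g -> continuous (fun p => f p + g p).
Proof. by move=> cf cg p; apply: cvgD; [exact: cf|exact: cg]. Qed.

Lemma cont_opp f : continuous f -> continuous (fun p => - f p).
Proof. by move=> cf p; apply: cvgN; exact: cf. Qed.

Lemma cont_mul_at f g (x : T) : {for x, continuous f} -> {for x, continuous g} ->
  {for x, continuous (fun p => f p * g p)}.
Proof. exact: cvgM. Qed.

Lemma cont_mul f g : continuous f -> continuous g -> continuous (fun p => f p * g p).
Proof. by move=> cf cg p; apply: cvgM; [exact: cf|exact: cg]. Qed.

Lemma cont_min f g : continuous f -> continuous g ->
  continuous (fun p => Num.min (f p) (g p)).
Proof. by move=> cf cg p; apply: continuous_min; [exact: cf|exact: cg]. Qed.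

Lemma cont_max f g : continuous f -> continuous g ->
  continuous (fun p => Num.max (f p) (g p)).
Proof. by move=> cf cg p; apply: continuous_max; [exact: cf|exact: cg]. Qed.

Lemma cont_norm f : continuous f -> continuous (fun p => `|f p|).
Proof. by move=> cf p; apply: cvg_norm; exact: cf. Qed.

Lemma cont_cos f : continuous f -> continuous (fun p => cos (f p)).
Proof. by move=> cf; apply: cont_comp cf (@continuous_cos R). Qed.

Lemma cont_sin f : continuous f -> continuous (fun p => sin (f p)).
Proof. by move=> cf; apply: cont_comp cf (@continuous_sin R). Qed.

End Continuity.

(* Syntax-directed: unification-based search is very slow on product spaces. *)
Ltac cont :=
  cbv beta;
  lazymatch goal with
  | |- continuous ?f =>
    lazymatch f with
    | (fun _ => ?a) => apply: (@cont_cst _ _ a)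
    | (fun p => p) => apply: cont_id
    | (fun p => (@?a p, @?b p)) => apply (@cont_pair _ _ _ a b); cont
    | (fun p => @?a p + @?b p) => apply (@cont_add _ _ a b); cont
    | (fun p => - (@?a p)) => apply (@cont_opp _ _ a); cont
    | (fun p => @?a p * @?b p) => apply (@cont_mul _ _ a b); cont
    | (fun p => Num.min (@?a p) (@?b p)) => apply (@cont_min _ _ a b); cont
    | (fun p => Num.max (@?a p) (@?b p)) => apply (@cont_max _ _ a b); cont
    | (fun p => `| @?a p |) => apply (@cont_norm _ _ a); cont
    | (fun p => cos (@?a p)) => apply (@cont_cos _ _ a); cont
    | (fun p => sin (@?a p)) => apply (@cont_sin _ _ a); cont
    | (fun p => (@?a p).1) => apply (@cont_fstf _ _ _ a); cont
    | (fun p => (@?a p).2) => apply (@cont_sndf _ _ _ a); cont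
    | @fst _ _ => apply: cont_fst
    | @snd _ _ => apply: cont_snd
    | _ => try assumption
    end
  | |- _ => idtac
  end.

Section Homeomorphisms.
Context {R : realType}.
Implicit Types (f g h : space3 R -> space3 R) (U V X Y Z : set (space3 R)).

Lemma homeomorphism_comp f g :
  homeomorphism f -> homeomorphism g -> homeomorphism (g \o f).
Proof.
move=> [f' [cf cf' ff' f'f]] [g' [cg cg' gg' g'g]]; exists (f' \o g'); split.
- exact: cont_comp.
- exact: cont_comp.
- by move=> p /=; rewrite gg' ff'.
- by move=> p /=; rewrite f'f g'g.
Qed.

Lemma homeomorphism_id : homeomorphism (@idfun (space3 R)).
Proof. by exists idfun; split=> //; exact: cont_id. Qed.

Lemma homeomorphism_cont f : homeomorphism f -> continuous f.
Proof. by case=> ? []. Qed.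

Lemma homeomorphism_closed f X : homeomorphism f -> closed X -> closed (f @` X).
Proof.
case=> g [cf cg fg gf] cX.
have -> : f @` X = g @^-1` X.
  apply/seteqP; split=> [_ [p Xp <-]|p Xp]; first by rewrite /= fg.
  by exists (g p).
by apply: closed_comp cX => p _; apply: cg.
Qed.

Lemma homeomorphism_ext f g : f =1 g -> homeomorphism f -> homeomorphism g.
Proof. by move=> /funext->. Qed.

(** The set [V] confines the motion: what lies outside stays fixed, so children can be moved one at
    a time ([displaces_setU]), and a bounded [V] gives the bounded displacement that
    [bounded_isotopy] asks for. *)
Definition displaces V X Y := exists h,
  [/\ homeomorphism h, forall p, ~ V p -> h p = p & h @` X = Y].

Lemma displaces_refl V X : displaces V X X.
Proof.
by exists idfun; split=> //; [exact: homeomorphism_id|rewrite image_id].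
Qed.

Lemma displaces_trans V X Y Z :
  displaces V X Y -> displaces V Y Z -> displaces V X Z.
Proof.
move=> [f [hf fV fX]] [g [hg gV gY]]; exists (g \o f); split.
- exact: homeomorphism_comp.
- by move=> p Vp /=; rewrite fV// gV.
- by rewrite -image_comp fX gY.
Qed.

Lemma displaces_sub U V X Y : U `<=` V -> displaces U X Y -> displaces V X Y.
Proof.
move=> UV [f [hf fU fX]]; exists f; split=> // p Vp.
by apply: fU => /UV.
Qed.

Lemma displaces_setU V X Y Z : Z `&` V = set0 ->
  displaces V X Y -> displaces V (X `|` Z) (Y `|` Z).
Proof.
move=> ZV [f [hf fV fX]]; exists f; split=> //.
rewrite image_setU fX; congr (_ `|` _).
have fZ p : Z p -> f p = p.
  by move=> Zp; apply: fV => Vp; have : (Z `&` V) p by []; rewrite ZV.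
apply/seteqP; split=> [_ [p Zp <-]|p Zp]; first by rewrite fZ.
by exists p => //; exact: fZ.
Qed.

Lemma displaces_image f V X Y : homeomorphism f ->
  displaces V X Y -> displaces (f @` V) (f @` X) (f @` Y).
Proof.
move=> hf [k [hk kV kX]]; have [g [cf cg fg gf]] := hf.
have hg : homeomorphism g by exists f.
exists (f \o k \o g); split.
- exact: (homeomorphism_comp hg (homeomorphism_comp hk hf)).
- move=> p Vp /=; rewrite kV ?gf// => Vg; apply: Vp; exists (g p) => //.
- rewrite -kX; apply/seteqP; split=> [_ [_ [p Xp <-] <-]|_ [_ [p Xp <-] <-]] /=.
    by exists (k p); [exists p|rewrite fg].
  by exists (f p); [exists p|rewrite /= fg].
Qed.

(** These permutations make another axis vertical, so that [steep_homeomorphism] also applies to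
    [squeeze] and [push]. *)
Lemma homeomorphism_permute :
  homeomorphism (fun p : space3 R => (p.2, p.1.2, p.1.1)) /\
  homeomorphism (fun p : space3 R => (p.1.1, p.2, p.1.2)).
Proof.
split; [exists (fun p => (p.2, p.1.2, p.1.1))|exists (fun p => (p.1.1, p.2, p.1.2))];
  by split=> [||[[x y] z]|[[x y] z]]//; cont.
Qed.

Lemma near_coord (p : space3 R) (e : R) : 0 < e ->
  \forall q \near p,
    [/\ `|q.1.1 - p.1.1| < e, `|q.1.2 - p.1.2| < e & `|q.2 - p.2| < e].
Proof.
move=> e0.
have H (f : space3 R -> R) : continuous f -> \forall q \near p, `|f q - f p| < e.
  by move=> /(_ p) /cvgrPdist_lt /(_ _ e0); apply: filterS => q; rewrite distrC.
have H1 : \forall q \near p, `|q.1.1 - p.1.1| < e by apply: (H (fun q => q.1.1)); cont.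
have H2 : \forall q \near p, `|q.1.2 - p.1.2| < e by apply: (H (fun q => q.1.2)); cont.
have H3 : \forall q \near p, `|q.2 - p.2| < e by apply: (H (fun q => q.2)); cont.
by near=> q; split; near: q.
Unshelve. all: end_near. Qed.

(* A continuous map whose restriction to every vertical line increases at a
   rate bounded below. *)
Definition steep (eta : R) (g : space3 R -> R) :=
  continuous g /\ forall u z z', z <= z' -> eta * (z' - z) <= g (u, z') - g (u, z).

(** The rate [eta] makes each vertical line map onto a whole line, by the intermediate value
    theorem, and it bounds the variation of the inverse, which is therefore continuous. *)
Lemma steep_homeomorphism (eta : R) (g : space3 R -> R) : 0 < eta -> steep eta g ->
  homeomorphism (fun p => (p.1, g p)).
Proof.
move=> eta0 [cg gi].
have surj (w : space3 R) : exists z, g (w.1, z) = w.2.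
  case: w => u v /=.
  (* Within [M] of 0, growth at rate [eta] makes up for both [g (u, 0)] and the target [v]. *)
  set M := (`|g (u, 0)| + `|v|) / eta.
  have M0 : 0 <= M by rewrite divr_ge0// ?ltW// addr_ge0.
  have etaM : eta * M = `|g (u, 0)| + `|v| by rewrite mulrC divfK// gt_eqF.
  have := gi u 0 M M0; have := gi u (- M) 0; rewrite oppr_le0 subr0 sub0r opprK.
  move=> /(_ M0); rewrite etaM => h1 h2.
  have := ler_norm (g (u, 0)); have := ler_norm (- g (u, 0)).
  have := ler_norm v; have := ler_norm (- v); rewrite !normrN => a1 a2 a3 a4.
  have [||| z _ <-] := @IVT _ (fun z => g (u, z)) (- M) M v.
  - lra.
  - apply: continuous_subspaceT; apply: (@cont_comp _ _ _ (fun z => (u, z))) => //.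
    by cont.
  - by rewrite ge_min le_max; apply/andP; split; apply/orP; [left|right]; lra.
  - by exists z.
have [k kP] := choice surj.
have bound u z z' : eta * `|z' - z| <= `|g (u, z') - g (u, z)|.
  have [zz'|/ltW zz'] := leP z z'.
    by rewrite ger0_norm ?subr_ge0//; apply: le_trans (ler_norm _); exact: gi.
  rewrite distrC (distrC (g _)) ger0_norm ?subr_ge0//.
  by apply: le_trans (ler_norm _); exact: gi.
have kg p : k (p.1, g p) = p.2.
  have := kP (p.1, g p); case: p => u z /= kgE.
  apply/eqP; rewrite -subr_eq0 -normr_eq0; apply/eqP.
  have := bound u z (k (u, g (u, z))); rewrite kgE subrr normr0.
  rewrite pmulr_rle0// => ?; apply/eqP; rewrite eq_le normr_ge0 andbT//.
exists (fun w => (w.1, k w)); split.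
- by cont.
- apply: cont_pair; first by cont.
  move=> w; apply/cvgrPdist_lt => e e0.
  have : continuous (fun w' : space3 R => w'.2 - g (w'.1, k w)).
    by cont; apply: (@cont_comp _ _ _ (fun w' : space3 R => (w'.1, k w))) => //; cont.
  move=> /(_ w) /cvgrPdist_lt /(_ (eta * e) (mulr_gt0 eta0 e0)).
  rewrite kP subrr; apply: filterS => w'; rewrite sub0r normrN => ew.
  rewrite -(ltr_pM2l eta0); apply: le_lt_trans (bound w'.1 _ _) _.
  by rewrite kP distrC.
- by case=> u z; have /= -> := kg (u, z).
- by case=> u v; have /= -> := kP (u, v).
Qed.

(* Alexander's trick. *)
Lemma bounded_isotopy (h : space3 R -> space3 R) (C : R) : homeomorphism h ->
  (forall p, [/\ `|(h p).1.1 - p.1.1| <= C, `|(h p).1.2 - p.1.2| <= C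
              & `|(h p).2 - p.2| <= C]) ->
  exists F : R * space3 R -> space3 R,
    [/\ continuous F, forall p, F (0, p) = p,
        forall t, homeomorphism (fun p => F (t, p)) & forall p, F (1, p) = h p].
Proof.
move=> hh hC.
pose scale (t : R) (p : space3 R) : space3 R := (t * p.1.1, t * p.1.2, t * p.2).
have ch := homeomorphism_cont hh.
(* A coordinate of [t h(p / t)], written as that of [p] plus [t] times a displacement bounded by
   [C]; this form stays continuous at [t = 0], where the inverse of [t] is 0 by convention. *)
pose part (a : space3 R -> R) (tp : R * space3 R) :=
  a tp.2 + tp.1 * (a (h (scale tp.1^-1 tp.2)) - a (scale tp.1^-1 tp.2)).
have cpart a : continuous a -> (forall p, `|a (h p) - a p| <= C) ->
    continuous (part a).
  move=> ca aC; apply: cont_add; first exact: cont_comp (@cont_snd _ _) ca.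
  move=> [t p]; have [->|t0] := eqVneq t 0.
    apply/cvgrPdist_lt => e e0 /=; rewrite mul0r.
    have C0 : 0 < C + 1 by have := aC p; have := normr_ge0 (a (h p) - a p); lra.
    have : \forall q \near ((0, p) : R * space3 R), `|q.1| < e / (C + 1).
      have /(_ (0, p)) := @cont_fst R (space3 R).
      by move=> /cvgrPdist_lt /(_ _ (divr_gt0 e0 C0)); apply: filterS => q;
        rewrite /= sub0r normrN.
    apply: filterS => q qe; rewrite sub0r normrN normrM.
    have := aC (scale q.1^-1 q.2) => aq.
    apply: (@le_lt_trans _ _ (`|q.1| * (C + 1))).
      by apply: ler_wpM2l => //; lra.
    by rewrite -ltr_pdivlMr.
  have cs : {for (t, p), continuous (fun q : R * space3 R => scale q.1^-1 q.2)}.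
    have ct : {for (t, p), continuous (fun q : R * space3 R => q.1^-1)}.
      by apply: cvgV => //; apply: (@cont_fst R (space3 R)).
    have cm (b : space3 R -> R) : continuous b ->
        {for (t, p), continuous (fun q : R * space3 R => q.1^-1 * b q.2)}.
      move=> cb; apply: (@cont_mul_at _ _ (fun q : R * space3 R => q.1^-1) (fun q => b q.2)) => //.
      exact: cont_comp (@cont_snd R (space3 R)) cb (t, p).
    apply: (@cont_pair_at _ _ _
      (fun q : R * space3 R => (q.1^-1 * q.2.1.1, q.1^-1 * q.2.1.2))
      (fun q => q.1^-1 * q.2.2));
      first apply: (@cont_pair_at _ _ _
        (fun q : R * space3 R => q.1^-1 * q.2.1.1) (fun q => q.1^-1 * q.2.1.2)).
    - by apply: (cm (fun p => p.1.1)); cont.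
    - by apply: (cm (fun p => p.1.2)); cont.
    - by apply: (cm (fun p => p.2)); cont.
  have cas : {for (t, p), continuous (fun q : R * space3 R => a (scale q.1^-1 q.2))}.
    by apply: continuous_comp; [exact: cs|exact: ca].
  have cahs : {for (t, p), continuous (fun q : R * space3 R => a (h (scale q.1^-1 q.2)))}.
    apply: (@continuous_comp _ _ _ _ (a \o h)); [exact: cs|].
    by apply: continuous_comp; [exact: ch|exact: ca].
  apply: (@cont_mul_at _ _ fst (fun q : R * space3 R => a (h (scale q.1^-1 q.2)) -
    a (scale q.1^-1 q.2))); first exact: cont_fst.
  by apply: cvgB; [exact: cahs|exact: cas].
exists (fun tp => (part (fun p => p.1.1) tp, part (fun p => p.1.2) tp,
                   part (fun p => p.2) tp)); split.
- by apply: cont_pair; [apply: cont_pair|]; apply: cpart => [|p]; cont;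
    have [] := hC p.
- by move=> [[x y] z]; rewrite /part/= !mul0r !addr0.
- move=> t; have [->|t0] := eqVneq t 0.
    apply: homeomorphism_ext homeomorphism_id => -[[x y] z].
    by rewrite /part/= !mul0r !addr0.
  have hs (s : R) : s != 0 -> homeomorphism (scale s).
    move=> s0; exists (scale s^-1); split; rewrite /scale; cont.
      by move=> [[x y] z]; rewrite /scale/= !mulKf.
    by move=> [[x y] z]; rewrite /scale/= !mulVKf.
  apply: (@homeomorphism_ext (scale t \o h \o scale t^-1)).
    by move=> [[x y] z]; rewrite /part/scale/= !mulrBr !mulVKf// !subrKC.
  apply: homeomorphism_comp; first by apply: hs; rewrite invr_eq0.
  by apply: homeomorphism_comp hh (hs _ t0).
- move=> [[x y] z]; rewrite /part/scale/= invr1 !mul1r !subrKC.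
  by case: (h _) => -[].
Qed.

End Homeomorphisms.

(** * Extension of height functions *)

Section Extension.
Context {R : realType}.

(** Take for [W t] the supremum of [a i * min 1 (t / rho i)]: each term is nondecreasing and
    subadditive in [t] and equals [a i] at [t = rho i]. If [rho i = 0] the quotient is 0 by
    convention, but then smallness forces [a i = 0]. *)
Lemma modulus (I : Type) (i0 : I) (rho a : I -> R) (M : R) :
  (forall i, 0 <= rho i) -> (forall i, 0 <= a i <= M) ->
  (forall e, 0 < e -> exists2 d, 0 < d & forall i, rho i < d -> a i <= e) ->
  exists W : R -> R,
    [/\ forall s t, 0 <= s -> s <= t -> W s <= W t,
        forall s t, 0 <= s -> 0 <= t -> W (s + t) <= W s + W t,
        forall e, 0 < e -> exists2 d, 0 < d & forall t, 0 <= t < d -> W t <= e,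
        W 0 = 0 & forall i, a i <= W (rho i)].
Proof.
move=> rho0 aM small.
have a0 i : 0 <= a i by have /andP[] := aM i.
have aM' i : a i <= M by have /andP[] := aM i.
pose term t i := a i * Num.min 1 (t / rho i).
pose S t := range (term t).
have ratio0 t i : 0 <= t -> 0 <= t / rho i by move=> t0; rewrite divr_ge0.
have term0 t i : 0 <= t -> 0 <= term t i.
  by move=> t0; rewrite mulr_ge0// le_min ler01/= ratio0.
have termM t i : term t i <= M.
  apply: le_trans (aM' i); rewrite -[leRHS]mulr1 ler_wpM2l//.
  by rewrite ge_min lexx.
have supS t : has_sup (S t).
  by split; [exists (term t i0), i0|exists M => _ [i _ <-]].
have ub t i : term t i <= sup (S t).
  by apply: sup_upper_bound (supS t) _ _; exists i.
have lub t b : (forall i, term t i <= b) -> sup (S t) <= b.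
  by move=> tb; apply: ge_sup; [exists (term t i0), i0|move=> _ [i _ <-]].
exists (fun t => sup (S t)); split.
- move=> s t s0 st; apply: lub => i; apply: le_trans (ub t i).
  rewrite ler_wpM2l// le_min ge_min lexx/= ge_min.
  by apply/orP; right; rewrite ler_wpM2r// invr_ge0.
- move=> s t s0 t0; apply: lub => i.
  apply: (@le_trans _ _ (term s i + term t i)); last by rewrite lerD.
  rewrite -mulrDr ler_wpM2l// mulrDl.
  have := ratio0 s i s0; have := ratio0 t i t0.
  by move: (s / rho i) (t / rho i) => x y; rewrite !minEle; do !case: ifP; lra.
- move=> e e0; have [d d0 dP] := small e e0.
  have M0 : 0 <= M by apply: le_trans (a0 i0) _.
  have M1 : 0 < M + 1 by lra.
  (* Indices with [rho i < d] contribute at most [e] anyway; for the others [t / rho i] is at most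
     [e / (M + 1)]. *)
  exists (d * e / (M + 1)); first by rewrite divr_gt0// mulr_gt0.
  move=> t /andP[t0 td]; apply: lub => i.
  have [rd|dr] := ltP (rho i) d.
    by apply: le_trans (dP i rd); rewrite -[leRHS]mulr1 ler_wpM2l// ge_min lexx.
  have r0 : 0 < rho i by apply: lt_le_trans dr.
  apply: (@le_trans _ _ (M * (e / (M + 1)))).
    apply: ler_pM => //; first by rewrite le_min ler01 ratio0.
    rewrite ge_min; apply/orP; right.
    rewrite ler_pdivrMr//; apply: le_trans (ltW td) _.
    by rewrite -mulrA mulrC ler_wpM2l// divr_ge0// ltW.
  by rewrite mulrCA ger_pMr// ler_pdivrMr// mul1r lerDl.
- apply/eqP; rewrite eq_le; apply/andP; split.
    apply: lub => i; rewrite /term mul0r /Num.min ltr10.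
    by rewrite mulr0.
  by apply: le_trans (ub 0 i0); exact: term0.
- move=> i; have [r0|r0] := eqVneq (rho i) 0.
    have /le_trans : a i <= 0.
      apply/ler_addgt0Pl => e e0; rewrite addr0.
      by have [d d0 ->] := small e e0; rewrite ?r0.
    by apply; apply: le_trans (ub _ i); rewrite r0; exact: term0.
  apply: le_trans (ub _ i); rewrite /term divff// minxx mulr1.
  by [].
Qed.

(** An asymmetric distance, zero exactly from a point to those above it on its vertical line. A
    bound [f p <= f q + W (rho p q)] thus contains both continuity and monotony along vertical
    lines. *)
Let rho (p q : space3 R) : R :=
  `|p.1.1 - q.1.1| + `|p.1.2 - q.1.2| + Num.max 0 (p.2 - q.2).

Lemma rho_ge0 p q : 0 <= rho p q.
Proof. by rewrite !addr_ge0// le_max lexx. Qed.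

Lemma rho_trans p q r : rho p r <= rho p q + rho q r.
Proof.
have := ler_normD (p.1.1 - q.1.1) (q.1.1 - r.1.1).
have := ler_normD (p.1.2 - q.1.2) (q.1.2 - r.1.2).
rewrite !subrKA /rho !maxEle; do !case: ifP; lra.
Qed.

Lemma rho_near p e : 0 < e -> \forall q \near p, rho p q < e /\ rho q p < e.
Proof.
move=> e0; have e3 : 0 < e / 3 by lra.
apply: filterS (near_coord p e3) => q [h1 h2 h3]; rewrite /rho.
rewrite (distrC p.1.1) (distrC p.1.2) !maxEle.
have := ler_norm (q.2 - p.2); have := ler_norm (p.2 - q.2).
by rewrite (distrC p.2) => h4 h5; split; case: ifP; lra.
Qed.

Lemma within_near (L : set (space3 R)) (phi : space3 R -> R) p e :
  {within L, continuous phi} -> L p -> 0 < e ->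
  \forall q \near p, L q -> `|phi q - phi p| < e.
Proof.
move=> /subspace_continuousP cphi Lp e0.
have /cvgrPdist_lt/(_ _ e0) := cphi p Lp.
by rewrite near_withinE; apply: filterS => q H /H; rewrite distrC.
Qed.

(* The function [fun p => g p - c * p.2] is an infimal convolution of its
   restriction to [L] with a modulus of continuity for the gauge [rho], which
   vanishes on vertical segments in one direction. *)
Lemma vertical_extension (L : set (space3 R)) (phi : space3 R -> R) (c : R) :
  compact L -> {within L, continuous phi} ->
  (forall p q, L p -> L q -> p.1 = q.1 -> p.2 <= q.2 ->
    c * (q.2 - p.2) <= phi q - phi p) ->
  exists2 g, steep c g & forall p, L p -> g p = phi p.
Proof.
move=> cL cphi phiI.
have [L0|/set0P[p0 Lp0]] := eqVneq L set0.
  exists (fun p => c * p.2); last by rewrite L0.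
  by split; [cont|move=> u z z' _ /=; lra].
(* Removing the slope [c] turns growth at rate [c] into mere monotony on vertical lines; the slope
   is added back at the end. *)
pose psi p := phi p - c * p.2.
have cpsi : {within L, continuous psi}.
  move=> p; apply: cvgB; first exact: cphi.
  have cz : continuous (fun p : space3 R => c * p.2) by cont.
  exact: (continuous_subspaceT cz).
have [B psiB] : exists B : R, forall p, L p -> `|psi p| <= B.
  have /compact_bounded[M [_ MP]] := continuous_compact cpsi cL.
  exists (M + 1) => p Lp; apply: (MP (M + 1)); first by lra.
  by exists p.
pose I := {pq : space3 R * space3 R | L pq.1 /\ L pq.2}.
pose rI (i : I) := rho (sval i).1 (sval i).2.
pose a (i : I) := Num.max 0 (psi (sval i).1 - psi (sval i).2).
have aM i : 0 <= a i <= B + B.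
  rewrite /a; case: i => -[p q] /= [Lp Lq].
  have := psiB p Lp; have := psiB q Lq; rewrite !ler_norml.
  move=> /andP[? ?] /andP[? ?].
  by rewrite maxEle; case: ifP => ?; apply/andP; split; lra.
(* By compactness of the square of [L]. At a pair with [rho p q = 0], [q] lies above [p], so
   [psi p <= psi q] and continuity leaves a margin; near any other pair [rho] stays above half its
   value. *)
have small e : 0 < e -> exists2 d, 0 < d & forall i, rI i < d -> a i <= e.
  move=> e0.
  have e3 : 0 < e / 3 by lra.
  have cLL : compact (L `*` L) by exact: compact_setX.
  pose P (d : R) (pq : space3 R * space3 R) :=
    L pq.1 -> L pq.2 -> rho pq.1 pq.2 < d -> psi pq.1 <= psi pq.2 + e.
  have dP : \forall d \near 0^'+, L `*` L `<=` P d.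
    move/compact_near_coveringP: cLL; apply => -[p q] [/= Lp Lq].
    have [r0|r0] := eqVneq (rho p q) 0.
      have [y1 y2] : p.1 = q.1 /\ p.2 <= q.2.
        move: (ler_norm (p.1.1 - q.1.1)) (ler_norm (q.1.1 - p.1.1)).
        move: (ler_norm (p.1.2 - q.1.2)) (ler_norm (q.1.2 - p.1.2)).
        rewrite (distrC q.1.1) (distrC q.1.2).
        have := normr_ge0 (p.1.1 - q.1.1); have := normr_ge0 (p.1.2 - q.1.2).
        move: r0; rewrite /rho maxEle.
        case: p q {Lp Lq} => [[x y] z] [[x' y'] z'] /= r0 x1 x2 x3 x4 x5 x6.
        by split; [congr pair|]; move: r0; case: ifP; lra.
      have pq : psi p <= psi q by have := phiI p q Lp Lq y1 y2; rewrite /psi; lra.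
      have np := within_near cpsi Lp e3; have nq := within_near cpsi Lq e3.
      exists ([set p' | L p' -> `|psi p' - psi p| < e / 3] `*`
              [set q' | L q' -> `|psi q' - psi q| < e / 3], setT) => /=.
        by split; [exists ([set p' | L p' -> `|psi p' - psi p| < e / 3],
              [set q' | L q' -> `|psi q' - psi q| < e / 3])|exact: filterT].
      move=> [[p' q'] d] [/= [H1 H2] _] Lp' Lq' _ /=.
      have := H1 Lp'; have := H2 Lq'; rewrite !ltr_norml => /andP[? ?] /andP[? ?].
      lra.
    have {}r0 : 0 < rho p q by rewrite lt_neqAle eq_sym r0 rho_ge0.
    have r4 : 0 < rho p q / 4 by lra.
    have np := rho_near p r4; have nq := rho_near q r4.
    exists ([set p' | rho p p' < rho p q / 4 /\ rho p' p < rho p q / 4] `*`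
            [set q' | rho q q' < rho p q / 4 /\ rho q' q < rho p q / 4],
            [set d | d < rho p q / 2]) => /=.
      split; last by apply: nbhs_right_lt; lra.
      by exists ([set p' | rho p p' < rho p q / 4 /\ rho p' p < rho p q / 4],
            [set q' | rho q q' < rho p q / 4 /\ rho q' q < rho p q / 4]).
    move=> [[p' q'] d] [/= [[H1 _] [_ H2]] d2] Lp' Lq' /=.
    have := rho_trans p p' q; have := rho_trans p' q' q; lra.
  have [d d0 dP'] : exists2 d, 0 < d & L `*` L `<=` P d.
    near (0:R)^'+ => d; exists d; first by near: d; exact: nbhs_right_gt.
    by near: d.
  exists d => //.
  move=> [[p q] /= [Lp Lq]]; rewrite /a/rI/= => rd.
  rewrite maxEle; case: ifP => // _; last exact: ltW.
  by have := dP' (p, q) (conj Lp Lq) Lp Lq rd => /=; lra.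
have r0 i : 0 <= rI i by exact: rho_ge0.
have [W [Wle Wadd Wsmall W0 aW]] := modulus (exist _ (p0, p0) (conj Lp0 Lp0) : I) r0 aM small.
have {}aW p q : L p -> L q -> psi p <= psi q + W (rho p q).
  move=> Lp Lq; have := aW (exist _ (p, q) (conj Lp Lq)).
  by rewrite /a /rI /= maxEle; case: ifP; lra.
have W_ge0 t : 0 <= t -> 0 <= W t by move=> t0; rewrite -W0; exact: Wle.
pose S p := [set psi q + W (rho p q) | q in L].
have infS p : has_inf (S p).
  split; first by exists (psi p0 + W (rho p p0)), p0.
  exists (- B) => _ [q Lq <-]; have := psiB q Lq; rewrite ler_norml => /andP[? _].
  by have := W_ge0 _ (rho_ge0 p q); lra.
pose f p := inf (S p).
have fle p q : L q -> f p <= psi q + W (rho p q).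
  by move=> Lq; apply: ge_inf; [case: (infS p)|exists q].
have lef p b : (forall q, L q -> b <= psi q + W (rho p q)) -> b <= f p.
  move=> H; apply: lb_le_inf; first by case: (infS p).
  by move=> _ [q Lq <-]; exact: H.
have fL p : L p -> f p = psi p.
  move=> Lp; apply/eqP; rewrite eq_le; apply/andP; split.
    have := fle p p Lp; have -> : rho p p = 0; last by rewrite W0 addr0.
    by rewrite /rho !subrr normr0 maxxx !addr0.
  by apply: lef => q; exact: aW.
have fW p q : f p <= f q + W (rho p q).
  rewrite -lerBlDr; apply: lef => r Lr; rewrite lerBlDr.
  have := fle p r Lr; have := Wle _ _ (rho_ge0 p r) (rho_trans p q r).
  have := Wadd _ _ (rho_ge0 p q) (rho_ge0 q r); lra.
exists (fun p => f p + c * p.2); last by move=> p Lp; rewrite fL// /psi; lra.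
split.
  apply: cont_add; last by cont.
  move=> p; apply/cvgrPdist_lt => e e0.
  have [d d0 dW] := Wsmall (e / 2) ltac:(lra).
  apply: filterS (rho_near p d0) => q [h1 h2].
  have := dW (rho p q); have := dW (rho q p); rewrite h1 h2 !rho_ge0.
  move=> /(_ isT) h3 /(_ isT) h4; have := fW p q; have := fW q p.
  by rewrite ltr_norml => *; apply/andP; split; lra.
move=> u z z' zz' /=.
suff : f (u, z) <= f (u, z') by lra.
have := fW (u, z) (u, z'); suff -> : rho (u, z) (u, z') = 0 by rewrite W0 addr0.
by rewrite /rho /= !subrr normr0 !add0r; apply/max_idPl; lra.
Unshelve. all: end_near. Qed.

End Extension.

(** * Height functions as a game *)

Section Play.
Context {R : realType}.
Implicit Types (Z : set (space3 R)) (phi : space3 R -> R) (p q : space3 R).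

Definition local_max Z phi p := \forall q \near p, Z q -> phi q <= phi p.

(* [phi] respects the order of the points of [Z] on each vertical line, read
   upwards if [sg] is false and downwards otherwise. *)
Definition graded (sg : bool) Z phi := exists2 c : R, 0 < c &
  forall p q, Z p -> Z q -> p.1 = q.1 -> 0 <= (-1) ^+ sg * (q.2 - p.2) ->
    c * ((-1) ^+ sg * (q.2 - p.2)) <= phi q - phi p.

(** A maximum at a given end is not charged, one at a chosen end is. At a glued point, chosen by one
    piece and given to the other, a maximum of the union is a maximum of both pieces and is paid for
    by the piece that chose. *)
Definition heights sg Z k (ins outs : seq (space3 R)) (vals : seq (space3 R * R)) :=
  exists phi (S : seq (space3 R)),
    [/\ {within Z, continuous phi} /\ graded sg Z phi,
        forall p h, (p, h) \in vals -> Z p /\ phi p = h,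
        (size S <= k)%N,
        forall p, Z p -> local_max Z phi p -> p \in S ++ ins &
        forall p, p \in outs -> Z p /\ (local_max Z phi p -> p \in S)].

Definition event := (space3 R * bool)%type.

Fixpoint game (C : seq (space3 R * R) -> Prop) (s : seq event) vals : Prop :=
  match s with
  | [::] => C vals
  | (p, true) :: s' => forall h, game C s' ((p, h) :: vals)
  | (p, false) :: s' => exists h, game C s' ((p, h) :: vals)
  end.

Definition ins (s : seq event) := [seq e.1 | e <- s & e.2].
Definition outs (s : seq event) := [seq e.1 | e <- s & ~~ e.2].

(* A schedule [s] lists ends of the strands of [Z].  Coming to an end marked
   [true], one is given its height; at an end marked [false] one chooses it.
   This game can be played so that in the end some height function on [Z] has
   at most [k] local maxima, not counting those at given ends. *)
Definition play sg Z k (s : seq event) :=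
  game (heights sg Z k (ins s) (outs s)) s [::].

(** Interleaving of the schedules of two pieces. At a common end one piece chooses and the other is
    given that height at once, so the end disappears from the resulting schedule; [D] collects these
    ends. *)
Inductive merge : seq event -> seq event -> seq event -> seq (space3 R) -> Prop :=
| merge_nil : merge [::] [::] [::] [::]
| merge_left e s1 s2 s D : merge s1 s2 s D -> merge (e :: s1) s2 (e :: s) D
| merge_right e s1 s2 s D : merge s1 s2 s D -> merge s1 (e :: s2) (e :: s) D
| merge_down p s1 s2 s D : merge s1 s2 s D ->
    merge ((p, false) :: s1) ((p, true) :: s2) s (p :: D)
| merge_up p s1 s2 s D : merge s1 s2 s D ->
    merge ((p, true) :: s1) ((p, false) :: s2) s (p :: D).

Lemma mergeC s1 s2 s D : merge s1 s2 s D -> merge s2 s1 s D.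
Proof. by elim=> *; constructor. Qed.

Lemma merge_ins s1 s2 s D p : merge s1 s2 s D ->
  p \in ins s1 -> p \in ins s \/ p \in outs s2.
Proof.
elim=> {s1 s2 s D} //=.
- move=> [q []] s1 s2 s D _ IH; rewrite /ins/outs/= ?inE //.
  by move=> /orP[->|/IH[]->]; rewrite ?orbT; [left|left|right].
- by move=> [q []] s1 s2 s D _ IH /IH[]; rewrite /ins/outs/= ?inE => ->;
    rewrite ?orbT; [left|right|left|right].
- move=> q s1 s2 s D _ IH; rewrite /ins/outs/= !inE => /orP[->|/IH[]->];
    rewrite ?orbT; [by right|by left|by right].
Qed.

Lemma merge_outs s1 s2 s D p : merge s1 s2 s D ->
  p \in outs s -> p \in outs s1 \/ p \in outs s2.
Proof.
elim=> {s1 s2 s D} //=.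
- move=> [q []] s1 s2 s D _ IH; rewrite /outs/= ?inE //.
  by move=> /orP[->|/IH[]->]; rewrite ?orbT; [left|left|right].
- move=> [q []] s1 s2 s D _ IH; rewrite /outs/= ?inE //.
  by move=> /orP[->|/IH[]->]; rewrite ?orbT; [right|left|right].
- by move=> q s1 s2 s D _ IH /IH[]; rewrite /outs/= ?inE => ->;
    rewrite ?orbT; [left|right].
- by move=> q s1 s2 s D _ IH /IH[]; rewrite /outs/= ?inE => ->;
    rewrite ?orbT; [left|right].
Qed.

Lemma game_sub C C' s vals : (forall v, C v -> C' v) ->
  game C s vals -> game C' s vals.
Proof.
move=> CC'; elim: s vals => [|[p []] s IH] vals /=; first exact: CC'.
  by move=> H h; apply: IH.
by move=> [h H]; exists h; apply: IH.
Qed.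

Let coherent (D : seq (space3 R)) (v1 v2 v : seq (space3 R * R)) :=
  {subset v <= v1 ++ v2} /\
  forall p, p \in D -> exists h, (p, h) \in v1 /\ (p, h) \in v2.

(** The two strategies are played against each other, the answer of one at a common end being the
    question put to the other. [coherent] keeps track that they agree on the heights in [D]. *)
Lemma game_merge C1 C2 C s1 s2 s D D0 v1 v2 v : merge s1 s2 s D ->
  coherent D0 v1 v2 v -> game C1 s1 v1 -> game C2 s2 v2 ->
  (forall w1 w2 w, coherent (D ++ D0) w1 w2 w -> C1 w1 -> C2 w2 -> C w) ->
  game C s v.
Proof.
move=> m; elim: m D0 v1 v2 v => {s1 s2 s D}.
- by move=> D0 v1 v2 v J g1 g2 H; apply: (H v1 v2).
- move=> [p b] s1 s2 s D _ IH D0 v1 v2 v [J1 J2] H1 H2 H.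
  have J h : coherent D0 ((p, h) :: v1) v2 ((p, h) :: v).
    split=> [x|x /J2[h' [? ?]]]; last by exists h'; rewrite inE; split=> //; apply/orP; right.
    by rewrite !inE => /orP[->//|/J1]; rewrite mem_cat => ->; rewrite orbT.
  case: b H1 => /= H1; first by move=> h; apply: IH (J h) (H1 h) H2 H.
  by have [h {}H1] := H1; exists h; apply: IH (J h) H1 H2 H.
- move=> [p b] s1 s2 s D _ IH D0 v1 v2 v [J1 J2] H1 H2 H.
  have J h : coherent D0 v1 ((p, h) :: v2) ((p, h) :: v).
    split=> [x|x /J2[h' [? ?]]]; last by exists h'; rewrite inE; split=> //; apply/orP; right.
    rewrite inE mem_cat inE => /orP[->|/J1]; first by rewrite orbT.
    by rewrite mem_cat => /orP[]->; rewrite ?orbT.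
  case: b H2 => /= H2; first by move=> h; apply: IH (J h) H1 (H2 h) H.
  by have [h {}H2] := H2; exists h; apply: IH (J h) H1 H2 H.
- move=> p s1 s2 s D _ IH D0 v1 v2 v [J1 J2] /= [h H1] /(_ h) H2 H.
  apply: (IH (p :: D0)) H1 H2 _.
    split=> [x /J1|x]; first by rewrite !mem_cat !inE => /orP[]->; rewrite ?orbT.
    rewrite inE => /orP[/eqP->|/J2[h' [? ?]]]; first by exists h; rewrite !mem_head.
    by exists h'; rewrite !inE; split; apply/orP; right.
  move=> w1 w2 w [K1 K2]; apply: H; split=> // x xD; apply: K2.
  by move: xD; rewrite /= !(inE, mem_cat) orbCA.
- move=> p s1 s2 s D _ IH D0 v1 v2 v [J1 J2] /= H1 [h H2] H.
  apply: (IH (p :: D0)) (H1 h) H2 _.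
    split=> [x /J1|x]; first by rewrite !mem_cat !inE => /orP[]->; rewrite ?orbT.
    rewrite inE => /orP[/eqP->|/J2[h' [? ?]]]; first by exists h; rewrite !mem_head.
    by exists h'; rewrite !inE; split; apply/orP; right.
  move=> w1 w2 w [K1 K2]; apply: H; split=> // x xD; apply: K2.
  by move: xD; rewrite /= !(inE, mem_cat) orbCA.
Qed.

Lemma local_max_sub Z Z' phi phi' p : Z `<=` Z' -> Z p ->
  (forall q, Z q -> phi' q = phi q) -> local_max Z' phi' p -> local_max Z phi p.
Proof.
move=> ZZ' Zp E; apply: filterS => q H Zq.
by rewrite -!E//; apply/H/ZZ'.
Qed.

Lemma within_cont_eq Z phi phi' : (forall q, Z q -> phi q = phi' q) ->
  {within Z, continuous phi} -> {within Z, continuous phi'}.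
Proof.
by move=> E; apply: subspace_eq_continuous => x /set_mem /E.
Qed.

(** The pieces share vertical lines only at glued points, so no condition of order arises between
    them. A maximum at a glued point is already in the list of the piece that chose its height, so
    the counts simply add. *)
Lemma play_glue sg Z1 Z2 k1 k2 s1 s2 s D : closed Z1 -> closed Z2 ->
  (forall p q, Z1 p -> Z2 q -> p.1 = q.1 -> p = q /\ p \in D) ->
  merge s1 s2 s D -> play sg Z1 k1 s1 -> play sg Z2 k2 s2 ->
  play sg (Z1 `|` Z2) (k1 + k2)%N s.
Proof.
move=> c1 c2 ZD m P1 P2; apply: (game_merge m (D0 := [::]) _ P1 P2) => //.
move=> w1 w2 w; rewrite cats0 => -[J1 J2].
move=> [f1 [S1 [[fc1 [e1 e10 g1]] v1 sz1 M1 O1]]].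
move=> [f2 [S2 [[fc2 [e2 e20 g2]] v2 sz2 M2 O2]]].
pose f p := if `[< Z1 p >] then f1 p else f2 p.
have fE1 p : Z1 p -> f p = f1 p by rewrite /f => /asboolT ->.
have fE2 p : Z2 p -> f p = f2 p.
  rewrite /f; case: asboolP => // z1 z2.
  have [_ /J2[h [h1 h2]]] := ZD p p z1 z2 erefl.
  by have [_ ->] := v1 _ _ h1; have [_ ->] := v2 _ _ h2.
have L1 p : Z1 p -> local_max (Z1 `|` Z2) f p -> local_max Z1 f1 p.
  by move=> z; apply: local_max_sub.
have L2 p : Z2 p -> local_max (Z1 `|` Z2) f p -> local_max Z2 f2 p.
  by move=> z; apply: local_max_sub.
exists f, (S1 ++ S2); split.
- split.
    apply: withinU_continuous => //.
      by apply: within_cont_eq fc1 => q /fE1.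
    by apply: within_cont_eq fc2 => q /fE2.
  exists (Num.min e1 e2); first by rewrite lt_min e10.
  move=> p q [zp|zp] [zq|zq] pq d0.
  + rewrite !fE1//; apply: le_trans (g1 _ _ zp zq pq d0).
    by rewrite ler_wpM2r// ge_min lexx.
  + have [-> _] := ZD _ _ zp zq pq.
    by rewrite !subrr !mulr0.
  + have [-> _] := ZD _ _ zq zp (esym pq).
    by rewrite !subrr !mulr0.
  + rewrite !fE2//; apply: le_trans (g2 _ _ zp zq pq d0).
    by rewrite ler_wpM2r// ge_min lexx orbT.
- move=> p h /J1; rewrite mem_cat => /orP[ph|ph].
    by have [z <-] := v1 _ _ ph; rewrite fE1//; split=> //; left.
  by have [z <-] := v2 _ _ ph; rewrite fE2//; split=> //; right.
- by rewrite size_cat leq_add.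
- move=> p [z|z] lm; rewrite !mem_cat.
    have := M1 p z (L1 p z lm); rewrite mem_cat => /orP[->//|/(merge_ins m)[->|po]].
      by rewrite !orbT.
    by have [z2 ->] := O2 p po; rewrite ?orbT//; exact: L2.
  have := M2 p z (L2 p z lm).
  rewrite mem_cat => /orP[->|/(merge_ins (mergeC m))[->|po]]; rewrite ?orbT//.
  by have [z1 ->] := O1 p po; rewrite ?orbT//; exact: L1.
- move=> p /(merge_outs m)[/O1|/O2] [z H]; split.
  + by left.
  + by move=> /(L1 _ z)/H; rewrite mem_cat => ->.
  + by right.
  + by move=> /(L2 _ z)/H; rewrite mem_cat => ->; rewrite orbT.
Qed.
End Play.

(** * Reordering a game and carrying it through a homeomorphism *)

Section PlayTransformations.
Context {R : realType}.
Implicit Types (Z : set (space3 R)) (phi : space3 R -> R) (p q : space3 R).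

Lemma heights_ext sg Z k i i' o o' v v' : i =i i' -> o =i o' -> v =i v' ->
  @heights R sg Z k i o v -> heights sg Z k i' o' v'.
Proof.
move=> ii eo vv [phi [S [c vP sz M O]]]; exists phi, S; split=> //.
- by move=> p h; rewrite -vv; exact: vP.
- by move=> p zp /(M p zp); rewrite !mem_cat ii.
- by move=> p; rewrite -eo; exact: O.
Qed.

Lemma game_ext (C : seq (space3 R * R) -> Prop) s v v' :
  (forall w w', w =i w' -> C w -> C w') -> v =i v' -> game C s v -> game C s v'.
Proof.
move=> CE; elim: s v v' => [|[p b] s IH] v v' vv /=; first exact: CE.
have E h : (p, h) :: v =i (p, h) :: v' by move=> x; rewrite !inE vv.
case: b => [H h|[h H]]; first exact: IH (E h) (H h).
by exists h; exact: IH (E h) H.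
Qed.

(** A choice may be postponed past a given height, which only adds information, and events of the
    same kind commute. *)
Lemma game_perm (C : seq (space3 R * R) -> Prop) s1 (x y : event) s2 v :
  (forall w w', w =i w' -> C w -> C w') -> x.2 ==> y.2 ->
  game C (s1 ++ x :: y :: s2) v -> game C (s1 ++ y :: x :: s2) v.
Proof.
move=> CE xy; elim: s1 v => [|[p b] s1 IH] v /=; last first.
  case: b => [H h|[h H]]; first by apply: IH (H h).
  by exists h; apply: IH H.
have E p q h h' : (p, h) :: (q, h') :: v =i (q, h') :: (p, h) :: v.
  by move=> z; rewrite !inE orbCA.
case: x y xy => [p []] [q []] //= _.
- by move=> H h h'; apply: game_ext (H h' h).
- by move=> [h H] h'; exists h; apply: game_ext (H h').
- by move=> [h [h' H]]; exists h', h; apply: game_ext H.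
Qed.

Lemma play_perm sg Z k s1 (x y : event) s2 : x.2 ==> y.2 ->
  play sg Z k (s1 ++ x :: y :: s2) -> play sg Z k (s1 ++ y :: x :: s2).
Proof.
move=> xy; rewrite /play.
have E : perm_eq (s1 ++ x :: y :: s2) (s1 ++ y :: x :: s2).
  by rewrite perm_cat2l; apply/permP => a /=; rewrite addnCA.
have Ei : ins (s1 ++ x :: y :: s2) =i ins (s1 ++ y :: x :: s2).
  by apply/perm_mem/perm_map; exact: perm_filter.
have Eo : outs (s1 ++ x :: y :: s2) =i outs (s1 ++ y :: x :: s2).
  by apply/perm_mem/perm_map; exact: perm_filter.
move=> H; have {}H := game_sub (fun v => heights_ext Ei Eo (fun _ => erefl)) H.
by apply: game_perm H => // w w'; exact: heights_ext.
Qed.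

Lemma play_leq sg Z k k' s : (k <= k')%N -> play sg Z k s -> @play R sg Z k' s.
Proof.
move=> kk; apply: game_sub => v [phi [S [c vP sz M O]]].
by exists phi, S; split=> //; exact: leq_trans kk.
Qed.

Lemma within_nearP Z phi :
  (forall p e, Z p -> 0 < e -> \forall q \near p, Z q -> `|phi q - phi p| < e) ->
  {within Z, continuous phi}.
Proof.
move=> H; apply/subspace_continuousP => p Zp; apply/cvgrPdist_lt => e e0.
by rewrite near_withinE; apply: filterS (H p e Zp e0) => q h /h; rewrite distrC.
Qed.

Lemma local_max_image (f g : space3 R -> space3 R) Z phi p :
  continuous f -> cancel f g ->
  local_max (f @` Z) (phi \o g) (f p) -> local_max Z phi p.
Proof.
move=> cf fg lm.
have : \forall q \near p, (f @` Z) (f q) -> (phi \o g) (f q) <= (phi \o g) (f p).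
  exact: cf p _ lm.
by apply: filterS => q /= H Zq; move: H; rewrite !fg; apply; exists q.
Qed.

(** A map that reverses vertical lines exchanges the two readings of [graded]; the factor [lam] only
    changes the rate. *)
Lemma play_image sg (e : bool) (lam : R) f Z k s : homeomorphism f -> 0 < lam ->
  (forall p q, (f p).1 = (f q).1 -> p.1 = q.1 /\
     (f q).2 - (f p).2 = lam * ((-1) ^+ e * (q.2 - p.2))) ->
  play sg Z k s -> play (sg (+) e) (f @` Z) k [seq (f x.1, x.2) | x <- s].
Proof.
move=> hf lam0 fE; have [g [cf cg fg gf]] := hf.
have fi : injective f by exact: can_inj fg.
pose F (v : space3 R * R) := (f v.1, v.2).
have gm C C' s' v : (forall w, C w -> C' [seq F x | x <- w]) ->
    game C s' v -> game C' [seq (f x.1, x.2) | x <- s'] [seq F x | x <- v].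
  move=> CC'; elim: s' v => [|[p b] s' IH] v /=; first exact: CC'.
  case: b => [H h|[h H]]; first by have /IH := H h.
  by exists h; have /IH := H.
have im (b : bool) : [seq x.1 | x <- [seq (f x.1, x.2) | x <- s] & x.2 == b] =
    [seq f x | x <- [seq x.1 | x <- s & x.2 == b]].
  by rewrite filter_map -!map_comp.
have im1 : ins [seq (f x.1, x.2) | x <- s] = [seq f x | x <- ins s].
  by rewrite /ins filter_map -!map_comp.
have im2 : outs [seq (f x.1, x.2) | x <- s] = [seq f x | x <- outs s].
  by rewrite /outs filter_map -!map_comp.
apply: gm => w [phi [S [[cphi [c c0 grad]] vP sz M O]]].
have lmi p : local_max (f @` Z) (phi \o g) (f p) -> local_max Z phi p.
  exact: local_max_image.
rewrite im1 im2; exists (phi \o g), (map f S); split.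
- split.
    apply: within_nearP => _ e0 [p Zp <-] e00 /=.
    rewrite fg; have := within_near cphi Zp e00.
    rewrite -{1}(fg p) => H0.
    have : \forall q \near f p, Z (g q) -> `|phi (g q) - phi p| < e0 by exact: cg (f p) _ H0.
    by apply: filterS => w' /= H [q Zq fq]; move: H; rewrite -fq fg; apply.
  exists (c / lam); first by rewrite divr_gt0.
  move=> _ _ [p Zp <-] [q Zq <-] pq /=; rewrite !fg.
  have [pq1 ->] := fE _ _ pq.
  have -> : (-1) ^+ (sg (+) e) * (lam * ((-1) ^+ e * (q.2 - p.2))) =
      lam * ((-1) ^+ sg * (q.2 - p.2)).
    by rewrite mulrCA; congr (_ * _); case: (sg); case: (e);
      rewrite /= ?expr0 ?expr1 ?mul1r ?mulN1r ?opprK.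
  rewrite pmulr_rge0// mulrA divfK ?gt_eqF// => pos.
  exact: grad.
- by move=> p h /mapP[[q h'] /vP[Zq <-] [-> ->]]; rewrite /= fg; split=> //; exists q.
- by rewrite size_map.
- by move=> _ [p Zp <-] /lmi/(M p Zp); rewrite -map_cat => ?; exact: map_f.
- move=> _ /mapP[p /O[Zp H] ->]; split; first by exists p.
  by move=> /lmi/H ?; exact: map_f.
Qed.

End PlayTransformations.

(** * Games on a single strand *)

Section Strands.
Context {R : realType}.
Implicit Types (Z : set (space3 R)) (F : R -> R).

Lemma closed_le_cont (T : topologicalType) (f g : T -> R) :
  continuous f -> continuous g -> closed [set p | f p <= g p].
Proof.
move=> cf cg.
have -> : [set p | f p <= g p] = (fun p => g p - f p) @^-1` [set x | 0 <= x].
  by apply/seteqP; split=> p /=; rewrite subr_ge0.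
by apply: closed_comp (@closed_ge R 0) => p _; apply: cvgB; [exact: cg|exact: cf].
Qed.

Lemma closed_eq_cont (T : topologicalType) (f g : T -> R) :
  continuous f -> continuous g -> closed [set p | f p = g p].
Proof.
move=> cf cg.
have -> : [set p | f p = g p] = [set p | f p <= g p] `&` [set p | g p <= f p].
  apply/seteqP; split=> p /=; first by move=> ->.
  by move=> [? ?]; apply/eqP; rewrite eq_le; apply/andP.
by apply: closedI; exact: closed_le_cont.
Qed.

(** A graph over an interval of the core direction: it meets each vertical line at most once, so
    [graded] holds for any function on it. *)
Definition strand (c : R -> R * R) (a b : R) : set (space3 R) :=
  [set p | a <= p.1.1 <= b /\ (p.1.2, p.2) = c p.1.1].

Lemma strand_closed c a b : continuous c -> closed (strand c a b).
Proof.
move=> cc.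
have -> : strand c a b = [set p : space3 R | a <= p.1.1] `&` [set p | p.1.1 <= b]
   `&` ([set p | p.1.2 = (c p.1.1).1] `&` [set p | p.2 = (c p.1.1).2]).
  apply/seteqP; split=> -[[x y] z] /=.
    by move=> [/andP[h1 h2]]; case: (c x) => y' z' [-> ->].
  by move=> [[h1 h2] [-> ->]]; split; [apply/andP|case: (c x)].
have cx : continuous (fun p : space3 R => c p.1.1).
  by apply: (@cont_comp _ _ _ (fun p : space3 R => p.1.1)) => //; cont.
by apply: closedI; apply: closedI; (apply: closed_le_cont || apply: closed_eq_cont);
  cont; exact: cx.
Qed.

Let pt (c : R -> R * R) (x : R) : space3 R := (x, (c x).1, (c x).2).

Lemma strand_pt c a b p : strand c a b p -> p = pt c p.1.1.
Proof. by case: p => [[x y] z] [/= _ E]; rewrite /pt -E. Qed.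

Lemma strand_graded sg c a b phi : graded sg (strand c a b) phi.
Proof.
exists 1 => // p q /strand_pt -> /strand_pt -> [-> _] _.
by rewrite /pt !subrr !mulr0.
Qed.

Definition unit_max F t := \forall t' \near t, 0 <= t' <= 1 -> F t' <= F t.

Lemma unit_max_left F t u : unit_max F t -> t <= 1 -> 0 <= u -> u < t ->
  exists t', u < t' < t /\ F t' <= F t.
Proof.
move=> /nbhs_ballP[e /= e0 H] t1 u0 ut.
exists (Num.max ((u + t) / 2) (t - e / 2)); split.
  by rewrite maxEle; case: ifP => ?; apply/andP; split; lra.
apply: H.
  rewrite /ball /= ltr_norml maxEle; case: ifP => ?; apply/andP; split; lra.
by rewrite maxEle; case: ifP => ?; apply/andP; split; lra.
Qed.

Lemma unit_max_right F t u : unit_max F t -> 0 <= t -> u <= 1 -> t < u ->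
  exists t', t < t' < u /\ F t' <= F t.
Proof.
move=> /nbhs_ballP[e /= e0 H] t1 u0 ut.
exists (Num.min ((u + t) / 2) (t + e / 2)); split.
  by rewrite minEle; case: ifP => ?; apply/andP; split; lra.
apply: H.
  rewrite /ball /= ltr_norml minEle; case: ifP => ?; apply/andP; split; lra.
by rewrite minEle; case: ifP => ?; apply/andP; split; lra.
Qed.

Lemma strand_max c a b F p : continuous c -> a < b ->
  strand c a b p ->
  local_max (strand c a b) (fun p => F ((p.1.1 - a) / (b - a))) p ->
  let t := (p.1.1 - a) / (b - a) in
  [/\ 0 <= t <= 1, unit_max F t & p = pt c (a + (b - a) * t)].
Proof.
move=> cc ab sp lm t.
have ba : 0 < b - a by rewrite subr_gt0.
have xE : a + (b - a) * t = p.1.1 by rewrite /t mulrC divfK ?gt_eqF//; lra.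
split; last 1 first.
- by rewrite xE; exact: (strand_pt sp).
- have [/andP[h1 h2] _] := sp; apply/andP; split; first by rewrite divr_ge0; lra.
  by rewrite ler_pdivrMr; lra.
pose g t : space3 R := pt c (a + (b - a) * t).
have cg : continuous g.
  have cca : continuous (fun t => c (a + (b - a) * t)).
    by apply: (@cont_comp _ _ _ (fun t => a + (b - a) * t)) => //; cont.
  by rewrite /g/pt; cont; exact: cca.
have gE : g t = p by rewrite /g xE -(strand_pt sp).
have lm' : \forall q \near g t, strand c a b q ->
    F ((q.1.1 - a) / (b - a)) <= F t by rewrite gE.
have : \forall t' \near t, strand c a b (g t') ->
    F (((g t').1.1 - a) / (b - a)) <= F t by exact: cg t _ lm'.
apply: filterS => t' H /andP[t0 t1].
have -> : t' = ((g t').1.1 - a) / (b - a).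
  by rewrite /= addrC addKr mulrC mulKf// gt_eqF.
apply: H; split; last by rewrite /= -surjective_pairing.
by rewrite /=; apply/andP; split; nra.
Qed.

Lemma strand_heights sg c a b F k i o v : continuous c -> a < b -> continuous F ->
  (forall t, 0 <= t <= 1 -> unit_max F t ->
    pt c (a + (b - a) * t) \in nseq k (pt c ((a + b) / 2)) ++ i /\
    (pt c (a + (b - a) * t) \in o -> (0 < k)%N /\ t = 1 / 2)) ->
  {subset o <= [:: pt c a; pt c b]} ->
  (forall p h, (p, h) \in v -> (p = pt c a /\ h = F 0) \/ (p = pt c b /\ h = F 1)) ->
  heights sg (strand c a b) k i o v.
Proof.
move=> cc ab cF HF Ho Hv; have ba : 0 < b - a by rewrite subr_gt0.
have ca : strand c a b (pt c a).
  by split; [rewrite /= lexx ltW|rewrite /= -surjective_pairing].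
have cb : strand c a b (pt c b).
  by split; [rewrite /= lexx ltW|rewrite /= -surjective_pairing].
exists (fun p => F ((p.1.1 - a) / (b - a))), (nseq k (pt c ((a + b) / 2))); split.
- split; last exact: strand_graded.
  apply: continuous_subspaceT.
  by apply: (@cont_comp _ _ _ (fun p : space3 R => (p.1.1 - a) / (b - a))) => //; cont.
- move=> p h /Hv[[-> ->]|[-> ->]]; split=> //=; first by rewrite subrr mul0r.
  by rewrite divff// gt_eqF.
- by rewrite size_nseq.
- move=> p sp lm; have /= [t01 um ->] := strand_max cc ab sp lm.
  by have [] := HF _ t01 um.
- move=> p po; split; first by have := Ho p po; rewrite !inE => /orP[]/eqP->.
  move=> lm; have sp : strand c a b p by have := Ho p po; rewrite !inE => /orP[]/eqP->.
  have /= [t01 um pE] := strand_max cc ab sp lm.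
  have [_] := HF _ t01 um; rewrite -pE => /(_ po)[k0 tE].
  rewrite pE tE; have -> : a + (b - a) * (1 / 2) = (a + b) / 2 by lra.
  by case: k k0 {HF} => // k _; rewrite mem_head.
Qed.

End Strands.

Section StrandPlays.
Context {R : realType}.
Variables (sg : bool) (c : R -> R * R) (a b : R).
Hypotheses (cc : continuous c) (ab : a < b).

Let en (d : bool) : space3 R :=
  let x := if d then b else a in (x, (c x).1, (c x).2).

Lemma enE d : en d = let x := a + (b - a) * d%:R in (x, (c x).1, (c x).2).
Proof. by rewrite /en; case: d; rewrite /= ?mulr1 ?mulr0 ?addr0 ?subrKC. Qed.

Let en_mid t : 0 <= t <= 1 ->
  let x := a + (b - a) * t in
  forall d, ((x, (c x).1, (c x).2) == en d) = (t == d%:R).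
Proof.
move=> t01 x d; rewrite /x enE; apply/eqP/eqP => [|->//].
move=> -[] /addrI /mulfI E _ _; apply: E.
by rewrite subr_eq0 gt_eqF.
Qed.

Lemma strand_monotone d : play sg (strand c a b) 0 [:: (en d, true); (en (~~ d), false)].
Proof.
move=> h /=; exists (h - 1).
apply: (@strand_heights R sg c a b (fun t => if d then h - 1 + t else h - t)) => //.
- by case: d; cont.
- move=> t t01 um; rewrite /= inE.
  suff td : t = d%:R.
    rewrite enE td eqxx; split=> //; rewrite /outs /= inE -td en_mid// td.
    by case: (d) => //=; rewrite ?oner_eq0// eq_sym oner_eq0.
  have /andP[t0 t1] := t01.
  case: d um => um; apply/eqP; apply: contraPT um => tn um.
    have {}tn : t < 1 by rewrite lt_neqAle tn.
    have [|||t' [/andP[? ?] /=]] := unit_max_right (u := 1) um; lra.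
  have {}tn : 0 < t by rewrite lt_neqAle eq_sym tn.
  have [|||t' [/andP[? ?] /=]] := unit_max_left (u := 0) um; lra.
- by move=> p; rewrite /outs /= !inE => /eqP->; case: (d); rewrite /= eqxx ?orbT.
- move=> p h'; rewrite !inE => /orP[]/eqP[-> ->]; case: (d); [left|right|right|left];
  by split=> //; lra.
Qed.

Lemma strand_valley d : play sg (strand c a b) 0 [:: (en d, true); (en (~~ d), true)].
Proof.
move=> h h' /=.
pose h0 := if d then h' else h; pose h1 := if d then h else h'.
(* The slope of the tent exceeds that between the two given heights, so the function falls from both
   ends to the middle. *)
pose M := `|h1 - h0| + 1.
have M0 : `|h1 - h0| < M by rewrite /M; lra.
have /andP[M1 M2] : - M < h1 - h0 < M by rewrite -ltr_norml.
apply: (@strand_heights R sg c a b (fun t => h0 + (h1 - h0) * t - M * Num.min t (1 - t))) => //.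
- by cont.
- move=> t /[dup] t01 /andP[t0 t1] um; rewrite /= !inE !en_mid//; split=> //.
  suff : (t == 0) || (t == 1) by case: (d); rewrite //= orbC.
  apply: contraPT um; rewrite negb_or => /andP[t0' t1'] um.
  have {}t0' : 0 < t by rewrite lt_neqAle eq_sym t0'.
  have {}t1' : t < 1 by rewrite lt_neqAle t1'.
  have [th|th] := leP t (1 / 2).
    have [|||t' [/andP[? ?]]] := unit_max_left (u := 0) um; try lra.
    by rewrite !minEle !ifT; [nra|lra|lra].
  have [|||t' [/andP[? ?]]] := unit_max_right (u := 1) um; try lra.
  by rewrite !minEle !ifF; [nra| |]; apply/negP; lra.
- move=> p h2; rewrite !inE /h0 /h1 => /orP[]/eqP[-> ->]; case: (d); [left|right|right|left];
  by split=> //; rewrite minEle; case: ifP; lra.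
Qed.

Lemma strand_ridge d : play sg (strand c a b) 1 [:: (en d, false); (en (~~ d), false)].
Proof.
exists 0, 0.
apply: (@strand_heights R sg c a b (fun t => Num.min t (1 - t))) => //.
- by cont.
- move=> t /[dup] t01 /andP[t0 t1] um.
  suff -> : t = 1 / 2.
    rewrite /= !inE; split=> //.
    have -> : a + (b - a) * (1 / 2) = (a + b) / 2 by lra.
    by rewrite eqxx.
  apply: contraPP um => /eqP tn um.
  have [th|th] := ltP t (1 / 2).
    have [|||t' [/andP[? ?]]] := unit_max_right (u := 1/2) um; try lra.
    by rewrite !minEle !ifT; lra.
  have {}tn : 1 / 2 < t by rewrite lt_neqAle eq_sym tn.
  have [|||t' [/andP[? ?]]] := unit_max_left (u := 1/2) um; try lra.
  by rewrite !minEle !ifF; [lra| |]; apply/negP; lra.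
- by move=> p; rewrite /outs /= !inE => /orP[]/eqP->; case: (d); rewrite /= eqxx ?orbT.
- move=> p h2; rewrite !inE => /orP[]/eqP[-> ->]; case: (d); [left|right|right|left];
  by split=> //; rewrite minEle; case: ifP; lra.
Qed.

(* Here the given height is that of the second end to be visited. *)
Lemma strand_ridge_in d : play sg (strand c a b) 1 [:: (en d, false); (en (~~ d), true)].
Proof.
exists 0 => h.
pose h0 := if d then h else 0; pose h1 := if d then 0 else h.
pose M := `|h1 - h0| + 1.
have M0 : `|h1 - h0| < M by rewrite /M; lra.
have /andP[M1 M2] : - M < h1 - h0 < M by rewrite -ltr_norml.
apply: (@strand_heights R sg c a b (fun t => h0 + (h1 - h0) * t + M * Num.min t (1 - t))) => //.
- by cont.
- move=> t /[dup] t01 /andP[t0 t1] um.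
  suff -> : t = 1 / 2.
    rewrite /= !inE; split=> //.
    have -> : a + (b - a) * (1 / 2) = (a + b) / 2 by lra.
    by rewrite eqxx.
  apply: contraPP um => /eqP tn um.
  have [th|th] := ltP t (1 / 2).
    have [|||t' [/andP[? ?]]] := unit_max_right (u := 1/2) um; try lra.
    by rewrite !minEle !ifT; [nra|lra|lra].
  have {}tn : 1 / 2 < t by rewrite lt_neqAle eq_sym tn.
  have [|||t' [/andP[? ?]]] := unit_max_left (u := 1/2) um; try lra.
  by rewrite !minEle !ifF; [nra| |]; apply/negP; lra.
- by move=> p; rewrite /outs /= !inE => /eqP->; case: (d); rewrite /= eqxx ?orbT.
- move=> p h2; rewrite !inE /h0 /h1 => /orP[]/eqP[-> ->]; case: (d); [left|right|right|left];
  by split=> //; rewrite minEle; case: ifP; lra.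
Qed.

End StrandPlays.

(** * Half twists cost no maximum *)

Section Twist.
Context {R : realType}.
Implicit Types (w : int) (x y : R).

Lemma cos_pi_int w : cos (pi * w%:~R) = (-1) ^+ odd `|w|%N :> R.
Proof.
have H n : cos (pi * n%:R) = (-1) ^+ odd n :> R.
  elim: n => [|n IH]; first by rewrite mulr0 cos0.
  by rewrite mulrS mulrDr mulr1 addrC cosDpi IH /= signrN.
case: w => n /=; first exact: H.
by rewrite NegzE mulrNz mulrN cosN H.
Qed.

Lemma sin_pi_int w : sin (pi * w%:~R) = 0 :> R.
Proof.
have H n : sin (pi * n%:R) = 0 :> R.
  elim: n => [|n IH]; first by rewrite mulr0 sin0.
  by rewrite mulrS mulrDr mulr1 addrC sinDpi IH oppr0.
case: w => n /=; first exact: H.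
by rewrite NegzE mulrNz mulrN sinN H oppr0.
Qed.

Lemma sin_lipschitz x y : `|sin x - sin y| <= `|x - y|.
Proof.
wlog yx : x y / y <= x.
  move=> H; have [/H//|/ltW/H] := leP y x.
  by rewrite distrC (distrC y).
have [|z _ ->] := MVT_segment yx (fun z _ => @is_derive_sin R z).
  exact: (continuous_subspaceT (@continuous_sin R)).
by rewrite normrM -[leRHS]mul1r ler_wpM2r// cos_max.
Qed.

(** The sides of a twisted band lie on a common vertical line only after at least a quarter turn. *)
Lemma cos_pi_eq0 w x : cos (pi * w%:~R * x) = 0 -> 1 <= 2 * `|w%:~R| * `|x|.
Proof.
rewrite -mulrA -cos_norm normrM (ger0_norm (pi_ge0 R)) normrM => c0.
rewrite leNgt; apply/negP => lt1.
suff : 0 < cos (pi * (`|w%:~R| * `|x|)) by rewrite c0 ltxx.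
have := pi_gt0 R; have : 0 <= `|w%:~R| * `|x| by rewrite mulr_ge0.
move: lt1; rewrite -mulrA; move: (`|w%:~R| * `|x|) => y lt1 y0 p0.
by apply: cos_gt0_pihalf; apply/andP; split; nra.
Qed.

Variables (sg : bool) (w : int) (r zeta : R -> R) (a b K : R).
Hypotheses (ab : a < b) (zetac : continuous zeta).
Hypotheses (rK : forall x y, `|r x - r y| <= K * `|x - y|).
Hypotheses (r01 : forall x, 0 <= r x <= 1) (ra : r a = 0) (rb : r b = 1).

Definition band (e : bool) (x : R) : R * R :=
  (2^-1 + (e%:R - 2^-1) * cos (pi * w%:~R * r x),
   zeta x + 2^-1 * (e%:R - 2^-1) * sin (pi * w%:~R * r x)).

Let r_cont : continuous r.
Proof.
move=> x; apply/cvgrPdist_lt => e e0.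
have K0 : 0 <= K.
  have := rK (x + 1) x; rewrite addrAC subrr add0r normr1 mulr1.
  exact: le_trans.
have K1 : 0 < K + 1 by lra.
near=> y; apply: le_lt_trans (rK x y) _.
apply: (@le_lt_trans _ _ ((K + 1) * `|x - y|)); first by rewrite ler_wpM2r//; lra.
rewrite -ltr_pdivlMl//; near: y.
by apply: cvgr_dist_lt => //; rewrite mulr_gt0// invr_gt0.
Unshelve. all: end_near. Qed.

Lemma band_cont e : continuous (band e).
Proof. by rewrite /band; cont. Qed.

Definition twist_end (d e : bool) : space3 R :=
  if d then (b, e%:R, zeta b) else (a, e%:R, zeta a).

Let A x := pi * w%:~R * r x.

Lemma band_start e : (a, (band e a).1, (band e a).2) = twist_end false e.
Proof.
by rewrite /band ra mulr0 cos0 sin0 /twist_end mulr1 mulr0 addr0 subrKC.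
Qed.

Lemma band_end e : (b, (band e b).1, (band e b).2) = twist_end true (e (+) odd `|w|%N).
Proof.
rewrite /band rb mulr1 cos_pi_int sin_pi_int /twist_end mulr0 addr0; congr (_, _, _).
by case: e; case: odd; rewrite /= ?expr0 ?expr1; lra.
Qed.

Lemma band_en d e : let x := if d then b else a in
  (x, (band e x).1, (band e x).2) = twist_end d (e (+) d && odd `|w|%N).
Proof.
case: d => /=; first exact: band_end.
by rewrite addbF; exact: band_start.
Qed.

Definition twist_cell := strand (band false) a b `|` strand (band true) a b.

(** Both sides descend at a common rate [N] that exceeds the variation of the difference [D] of
    their heights, so no maximum appears beyond the given ends, however many half twists there are.
    All the work lies in choosing [D] to respect the crossings. *)
Lemma twist_play d : play sg twist_cell 0
  [:: (twist_end d false, true); (twist_end d true, true);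
      (twist_end (~~ d) false, false); (twist_end (~~ d) true, false)].
Proof.
move=> h0 h1 /=.
(* A strand changes its side at the right end if [w] is odd; [tw] and [tw'] record this at the given
   end and at the chosen end. *)
pose tw := d && odd `|w|%N.
pose tw' := (~~ d) && odd `|w|%N.
pose g0 := if tw then h1 else h0; pose g1 := if tw then h0 else h1.
pose u x := if d then 1 - r x else r x.
(* Since a crossing needs [2 * |w| * u >= 1], the region [M * u < 1] near the given end contains
   none. *)
pose M : R := 2 * `|w%:~R| + 1.
(* The first term carries the prescribed difference at the given end and dies out before the first
   crossing; at a crossing the second has the sign that the vertical order demands. *)
pose D x := (g1 - g0) * Num.max 0 (1 - M * u x) + (-1) ^+ sg * sin (A x).
pose LD := `|g1 - g0| * M * K + pi * `|w%:~R| * K.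
pose N := LD + 1.
pose dist x := if d then b - x else x - a.
pose f (e : bool) x := g0 - N * dist x + (if e then D x else 0).
have M0 : 0 <= M by rewrite /M; have := normr_ge0 (w%:~R : R); lra.
have DL x y : `|D x - D y| <= LD * `|x - y|.
  have -> : D x - D y = (g1 - g0) * (Num.max 0 (1 - M * u x) - Num.max 0 (1 - M * u y))
      + (-1) ^+ sg * (sin (A x) - sin (A y)) by rewrite /D; lra.
  apply: le_trans (ler_normD _ _) _; rewrite [leRHS]mulrDl lerD//.
    rewrite normrM -!mulrA ler_wpM2l//.
    apply: (@le_trans _ _ (M * `|u x - u y|)).
      rewrite !maxEle -[M in leRHS]ger0_norm// -normrM mulrBr.
      have [h1' h2'] := (ler_norm (M * u x - M * u y), ler_norm (M * u y - M * u x)).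
      move: h2'; rewrite distrC => h2'.
      by rewrite ler_norml; do !case: ifP => ?; apply/andP; split; lra.
    rewrite ler_wpM2l//; apply: le_trans (rK x y); rewrite /u; case: (d) => //.
    have -> : 1 - r x - (1 - r y) = r y - r x by lra.
    by rewrite distrC.
  rewrite normrMsign; apply: le_trans (sin_lipschitz _ _) _.
  rewrite /A -mulrBr normrM normrM ger0_norm ?pi_ge0// -!mulrA.
  by rewrite ler_wpM2l ?pi_ge0// ler_wpM2l.
have Dstart : D (if d then b else a) = g1 - g0.
  rewrite /D /u /A; case: (d); rewrite ?ra ?rb ?subrr !mulr0 ?mulr1 ?sin0 ?sin_pi_int;
  by rewrite subr0 mulr0 addr0 maxEle ler01 mulr1.
have Dcross x : cos (A x) = 0 -> D x = (-1) ^+ sg * sin (A x).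
  move=> c0; rewrite /D.
  suff -> : Num.max 0 (1 - M * u x) = 0 by rewrite mulr0 add0r.
  have /andP[r0 r1] := r01 x.
  have cu : cos (pi * w%:~R * u x) = 0.
    rewrite /u; case: (d) => //.
    by rewrite mulrBr mulr1 cosB c0 sin_pi_int mulr0 mul0r addr0.
  have u0 : 0 <= u x by rewrite /u; case: (d); lra.
  have := cos_pi_eq0 cu; rewrite (ger0_norm u0) => ?.
  by apply/max_idPl; rewrite /M; lra.
have Dc : continuous D.
  have uc : continuous u by rewrite /u; case: (d); cont.
  by rewrite /D /A; cont.
have fmono e x y : (if d then y < x else x < y) -> f e y < f e x.
  move=> xy.
  have dE : dist y - dist x = `|x - y|.
    rewrite /dist; move: xy; case: (d) => xy.
      by rewrite ger0_norm; lra.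
    by rewrite ltr0_norm; lra.
  have xy0 : 0 < `|x - y|.
    rewrite normr_gt0 subr_eq0; move: xy; case: (d) => xy; first by rewrite gt_eqF.
    by rewrite lt_eqF.
  have LD0 : 0 <= LD * `|x - y| by apply: le_trans (DL x y).
  have : N * dist y - N * dist x = LD * `|x - y| + `|x - y| by rewrite -mulrBr dE /N; lra.
  have := DL x y; rewrite ler_norml => /andP[? ?].
  by rewrite /f; case: (e); lra.
have disj p : strand (band false) a b p -> strand (band true) a b p -> False.
  move=> [_ E0] [_ E1]; move: E1; rewrite E0 /band => -[/= Ec Es].
  have := cos2Dsin2 (A p.1.1); rewrite /A.
  have -> : cos (pi * w%:~R * r p.1.1) = 0 by lra.
  have -> : sin (pi * w%:~R * r p.1.1) = 0 by lra.
  by rewrite expr0n addr0 => /eqP; rewrite eq_sym oner_eq0.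
pose start e : space3 R := twist_end d (e (+) tw).
pose stop e : space3 R := twist_end (~~ d) (e (+) tw').
pose F e t := f e (a + (b - a) * t).
pose phi (p : space3 R) := if `[< strand (band false) a b p >] then f false p.1.1
  else f true p.1.1.
have phi0 p : strand (band false) a b p -> phi p = f false p.1.1.
  by rewrite /phi => /asboolT ->.
have phi1 p : strand (band true) a b p -> phi p = f true p.1.1.
  by rewrite /phi; case: asboolP => // /disj H /H.
have phiE e p : strand (band e) a b p -> phi p = f e p.1.1 by case: e; [exact: phi1|exact: phi0].
have sub e : strand (band e) a b `<=` twist_cell by case: e => p; [right|left].
have cell p : twist_cell p -> exists e, strand (band e) a b p.
  by case=> ?; [exists false|exists true].
have startE e : start e = (if d then b else a, (band e (if d then b else a)).1,
    (band e (if d then b else a)).2).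
  by rewrite band_en.
have stopE e : stop e = (if d then a else b, (band e (if d then a else b)).1,
    (band e (if d then a else b)).2).
  by have := band_en (~~ d) e; rewrite if_neg => ->.
exists (f (tw') (if d then a else b)), (f (~~ tw') (if d then a else b)).
have lm e p : strand (band e) a b p -> local_max twist_cell phi p -> p = start e.
  move=> sp lm.
  have {}lm : local_max (strand (band e) a b)
      (fun p => F e ((p.1.1 - a) / (b - a))) p.
    apply: (local_max_sub (sub e) sp _ lm) => q /phiE ->; rewrite /F mulrC divfK; first by congr f; lra.
    by rewrite subr_eq0 gt_eqF.
  have /= := strand_max (@band_cont e) ab sp lm.
  move: (_ / _) => t [t01 um pE].
  suff td : t = d%:R.
    rewrite pE td startE; case: (d); rewrite /= ?mulr1 ?mulr0 ?addr0//.
    by rewrite subrKC.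
  have /andP[t0 t1] := t01; apply/eqP; apply: contraPT um => tn um.
  have ba : 0 < b - a by rewrite subr_gt0.
  have Flt s1 s2 : (if d then s2 < s1 else s1 < s2) -> F e s2 < F e s1.
    move=> H; apply: fmono; move: H; case: (d) => H;
    by rewrite ltrD2l ltr_pM2l.
  move: Flt tn; case: (d) => Flt tn.
    have {}tn : t < 1 by rewrite lt_neqAle tn.
    have [|||t' [/andP[h h'] H]] := unit_max_right (u := 1) um; try lra.
    by have := Flt _ _ h; lra.
  have {}tn : 0 < t by rewrite lt_neqAle eq_sym tn.
  have [|||t' [/andP[h h'] H]] := unit_max_left (u := 0) um; try lra.
  by have := Flt _ _ h'; lra.
have [aab bab] : a <= a <= b /\ a <= b <= b by rewrite !lexx !ltW.
have startS e : strand (band e) a b (start e).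
  by rewrite startE; split; rewrite /= -?surjective_pairing//; case: (d).
have stopS e : strand (band e) a b (stop e).
  by rewrite stopE; split; rewrite /= -?surjective_pairing//; case: (d).
have startV e : phi (start e) = if e then g1 else g0.
  rewrite (phiE e)// startE /f /=.
  have -> : dist (if d then b else a) = 0 by rewrite /dist; case: (d); rewrite subrr.
  by rewrite Dstart; case: (e); lra.
have stopV e : phi (stop e) = f e (if d then a else b).
  by rewrite (phiE e)// stopE.
have enstart e : twist_end d e = start (e (+) tw) by rewrite /start -addbA addbb addbF.
have enstop e : twist_end (~~ d) e = stop (e (+) tw') by rewrite /stop -addbA addbb addbF.
exists phi, [::]; split=> //.
- split.
    have fc e : continuous (fun p : space3 R => f e p.1.1).
      have fc' : continuous (f e) by rewrite /f /dist; case: (e); case: (d); cont.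
      by apply: (@cont_comp _ _ _ (fun p : space3 R => p.1.1)) => //; cont.
    apply: withinU_continuous.
    + by apply: strand_closed; exact: band_cont.
    + by apply: strand_closed; exact: band_cont.
    + by apply: within_cont_eq (continuous_subspaceT (fc false)) => q /phi0.
    + by apply: within_cont_eq (continuous_subspaceT (fc true)) => q /phi1.
  exists 1 => // p q /cell[e sp] /cell[e' sq] pq.
  rewrite (phiE _ _ sp) (phiE _ _ sq) -pq mul1r.
  have := sp.2; have := sq.2; rewrite -pq => -[q1 q2] [p1 p2].
  have [ee|ne] := eqVneq e e'.
    by move: q2 p2; rewrite ee => -> ->; rewrite !subrr mulr0.
  have cA : cos (A p.1.1) = 0.
    by move: ne q1; rewrite p1 /A; case: (e); case: (e') => //= _; lra.
  rewrite /f Dcross// q2 p2 -/(A p.1.1).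
  set T := sin _; have [V VE] : exists V, V = (-1) ^+ sg * T by eexists.
  have -> : (-1) ^+ sg * (zeta p.1.1 + 2^-1 * (e'%:R - 2^-1) * T -
     (zeta p.1.1 + 2^-1 * (e%:R - 2^-1) * T)) = 2^-1 * (e'%:R - e%:R) * V.
    by rewrite VE; lra.
  by rewrite -VE; move: ne; case: (e); case: (e') => //= _; lra.
- move=> p h; rewrite !inE => /orP[|/orP[|/orP[]]] /eqP[-> ->].
  + by rewrite enstop stopV; split=> //; apply: sub (stopS _).
  + by rewrite enstop stopV; split=> //; apply: sub (stopS _).
  + rewrite enstart startV; split; first by apply: sub (startS _).
    by rewrite /g0 /g1; case: (tw).
  + rewrite enstart startV; split; first by apply: sub (startS _).
    by rewrite /g0 /g1; case: (tw).
- move=> p /cell[e sp] /(lm e p sp) ->; rewrite /ins /= /start.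
  by case: (e (+) tw); rewrite !inE eqxx ?orbT.
- move=> p; rewrite /outs/= !inE => pE.
  have {pE} [e ->] : exists e, p = stop e.
    by move: pE => /orP[]/eqP->; rewrite enstop; eexists.
  split; first by apply: sub (stopS _).
  move=> /(lm e _ (stopS _)); rewrite stopE startE; case: (d) => -[abE _ _]; move: ab;
  by rewrite abE ltxx.
Qed.

End Twist.

(** * From games to the bridge number, from labels to the component number *)

Section Bounds.
Context {R : realType}.

Lemma counting_le (T : choiceType) (A : set T) (s : seq T) :
  (forall x, A x -> x \in s) -> (counting A <= (size s)%:R%:E :> \bar R)%E.
Proof.
move=> As.
have fA : finite_set A.
  by apply: (@sub_finite_set _ _ [set` s]); [exact: As|exact: finite_seq].
rewrite /counting asboolT// lee_fin ler_nat.
apply: uniq_leq_size => [|x]; first exact: fset_uniq.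
by rewrite in_fset_set// => /set_mem/As.
Qed.

Lemma counting_ge (T : choiceType) (A : set T) (s : seq T) : uniq s ->
  (forall x, x \in s -> A x) -> ((size s)%:R%:E <= counting A :> \bar R)%E.
Proof.
move=> us sA; rewrite /counting; case: asboolP => fA; last by rewrite leey.
rewrite lee_fin ler_nat; apply: uniq_leq_size us _ => x /sA Ax.
by rewrite in_fset_set//; exact: mem_set.
Qed.

(** The extension [g] of the height function replaces the vertical coordinate. Convex combinations
    of the two remain steep, hence are homeomorphisms, and composed with Alexander's isotopy for [h]
    they give the isotopy. Maxima on the image come from maxima of [phi]. *)
Lemma bridge_bound (L L1 : set (space3 R)) (h : space3 R -> space3 R) (C : R) k :
  homeomorphism h ->
  (forall p, [/\ `|(h p).1.1 - p.1.1| <= C, `|(h p).1.2 - p.1.2| <= C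
              & `|(h p).2 - p.2| <= C]) ->
  h @` L = L1 -> compact L1 -> play false L1 k [::] ->
  (bridge_number L <= k%:R%:E)%E.
Proof.
move=> hh hC hL cL1 [phi [S [[cphi [c c0 grad]] _ Sk M _]]].
have {}grad p q : L1 p -> L1 q -> p.1 = q.1 -> p.2 <= q.2 ->
    c * (q.2 - p.2) <= phi q - phi p.
  move=> Lp Lq pq pq2; have := grad _ _ Lp Lq pq; rewrite expr0 mul1r; apply.
  by rewrite subr_ge0.
have [g [cg sg] gphi] := vertical_extension cL1 cphi grad.
pose G t (p : space3 R) : space3 R := (p.1, (1 - t) * p.2 + t * g p).
have G1 p : G 1 p = (p.1, g p) by rewrite /G subrr mul0r add0r mul1r.
have hG t : 0 <= t <= 1 -> homeomorphism (G t).
  move=> /andP[t0 t1]; apply: (@steep_homeomorphism _ (Num.min 1 c)).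
    by rewrite lt_min ltr01.
  split; first by cont.
  move=> u z z' zz' /=; have := sg u z z' zz'.
  have : Num.min 1 c <= 1 /\ Num.min 1 c <= c by rewrite !ge_min !lexx orbT.
  move: (Num.min 1 c) => m [m1 m2] H.
  have H1 : m * (z' - z) <= z' - z by nra.
  have H2 : m * (z' - z) <= g (u, z') - g (u, z) by nra.
  nra.
have [F [cF F0 hF F1]] := bounded_isotopy hh hC.
have iso : isotopic L (G 1 @` L1).
  exists (fun tp => G tp.1 (F tp)); split.
  - apply: continuous_subspaceT.
    have cgF : continuous (fun tp : R * space3 R => g (F tp)) by exact: cont_comp cF cg.
    by rewrite /G; cont.
  - by move=> p; rewrite /G F0 /= subr0 mul1r mul0r addr0 -surjective_pairing.
  - move=> t; rewrite in_itv/= => t01.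
    exact: homeomorphism_comp (hF t) (hG t t01).
  - rewrite -hL; apply/seteqP; split=> [_ [p Lp <-]|_ [_ [p Lp <-] <-]].
      by exists (h p); [exists p|rewrite /= F1].
    by exists p => //; rewrite /= F1.
have cG : continuous (G 1) by apply: homeomorphism_cont; apply: hG; rewrite ler01 lexx.
apply: (@le_trans _ _ (counting (local_maxima (G 1 @` L1)))).
  by apply: ereal_inf_lbound; exists (G 1 @` L1).
apply: (@le_trans _ _ (size (map (G 1) S))%:R%:E).
  apply: counting_le => _ [[p Lp <-] lm]; apply: map_f.
  have : p \in S ++ [::].
    apply: M => //.
    have : \forall q \near p, (G 1 @` L1) (G 1 q) -> (G 1 q).2 <= (G 1 p).2.
      exact: cG p _ lm.
    apply: filterS => q H Lq; have /H : (G 1 @` L1) (G 1 q) by exists q.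
    by rewrite !G1 /= !gphi.
  by rewrite cats0.
by rewrite size_map lee_fin ler_nat.
Qed.

(** The values on a connected component form an interval that avoids all [n + 1/2], so the function
    is constant there. *)
Lemma component_bound (L : set (space3 R)) (c : space3 R -> R) (N : nat) :
  {within L, continuous c} -> (forall p, L p -> exists n : nat, c p = n%:R) ->
  (forall n, (n < N)%N -> exists2 p, L p & c p = n%:R) ->
  (N%:R%:E <= component_number L)%E.
Proof.
move=> cc cn surj.
have const p q : L p -> connected_component L p q -> c p = c q.
  move=> Lp pq; pose K := connected_component L p.
  have KL : K `<=` L by exact: connected_component_sub.
  have Kp : K p by exact: connected_component_refl.
  have iK : is_interval (c @` K).
    apply/connected_intervalP; apply: connected_continuous_connected.
      exact: component_connected.
    exact: continuous_subspaceW KL cc.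
  have H a b : K a -> K b -> c a < c b -> False.
    move=> Ka Kb; have [n En] := cn a (KL a Ka); have [m Em] := cn b (KL b Kb).
    rewrite En Em ltr_nat => nm.
    have n0 : n%:R <= n%:R + 2^-1 :> R by rewrite lerDl.
    have m0 : n%:R + 2^-1 <= m%:R :> R.
      have : n.+1%:R <= m%:R :> R by rewrite ler_nat.
      by rewrite -natr1; lra.
    have [|||w Kw Ew] := iK (c a) (c b) _ _ (n%:R + 2^-1).
    + by exists a.
    + by exists b.
    + by rewrite En Em n0 m0.
    have [l El] := cn w (KL w Kw); move: Ew; rewrite El => Ew.
    have [ln|nl] := leqP l n.
      have : l%:R <= n%:R :> R by rewrite ler_nat.
      by lra.
    have : n.+1%:R <= l%:R :> R by rewrite ler_nat.
    by rewrite -natr1; lra.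
  by have [pq0|pq0|//] := ltgtP (c p) (c q); [case: (H p q)|case: (H q p)].
have ex (n : 'I_N) : exists p, L p /\ c p = n%:R.
  by have [p] := surj n (ltn_ord n); exists p.
have [P PP] := choice ex.
have := @counting_ge _ [set connected_component L p | p in L]
  [seq connected_component L (P n) | n <- enum 'I_N].
rewrite size_map size_enum_ord; apply.
- rewrite map_inj_uniq ?enum_uniq// => n m E.
  have [Ln cn'] := PP n; have [Lm cm] := PP m.
  have : connected_component L (P n) (P m).
    by rewrite E; exact: connected_component_refl.
  move=> /(const _ _ Ln); rewrite cn' cm => /eqP; rewrite eqr_nat => /eqP.
  exact: val_inj.
- by move=> _ /mapP[n _ ->]; exists (P n) => //; have [] := PP n.
Qed.

End Bounds.

Ltac merge_tac := repeat first
  [ apply: merge_down | apply: merge_up | apply: merge_left | apply: merge_right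
  | apply: merge_nil ].

(** * Games on consecutive pieces of a band *)

Section Schedules.
Context {R : realType}.
Variable pt : nat -> bool -> space3 R.

(* Schedules for a piece of a band between the positions [i] and [j], whose
   ends [(d, b)] lie at [i] or [j] according to [d], on the side [b]. *)
Definition en i j (d b : bool) : space3 R := pt (if d then j else i) b.

Definition thruS i j d b d' : seq (event (R := R)) :=
  [:: (en i j d b, true); (en i j (~~ d) b, false);
      (en i j d' (~~ b), true); (en i j (~~ d') (~~ b), false)].

Definition passS i j d b b' : seq (event (R := R)) :=
  [:: (en i j d b, true); (en i j d (~~ b), true);
      (en i j (~~ d) b', false); (en i j (~~ d) (~~ b'), false)].

(** This schedule and [collectS] are the two kinds of hub: a single strand comes in, or a single
    strand goes out. [thruS] and [passS] describe the pieces between a hub and the ends of the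
    band. *)
Definition spreadS i j d b : seq (event (R := R)) :=
  [:: (en i j d b, true); (en i j (~~ d) b, false);
      (en i j d (~~ b), false); (en i j (~~ d) (~~ b), false)].

Definition collectS i j d b : seq (event (R := R)) :=
  [:: (en i j (~~ d) b, true); (en i j (~~ d) (~~ b), true);
      (en i j d (~~ b), true); (en i j d b, false)].

(* The same for a whole vertex, with the events in the order in which the
   parent vertex meets them. *)
Definition openS i j d b : seq (event (R := R)) :=
  [:: (en i j d b, true); (en i j d (~~ b), false);
      (en i j (~~ d) b, false); (en i j (~~ d) (~~ b), false)].

Definition shutS i j d b : seq (event (R := R)) :=
  [:: (en i j (~~ d) (~~ b), true); (en i j (~~ d) b, true);
      (en i j d (~~ b), true); (en i j d b, false)].

Definition halfS i j d b : seq (event (R := R)) :=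
  [:: (en i j d b, true); (en i j (~~ d) b, true);
      (en i j d (~~ b), false); (en i j (~~ d) (~~ b), false)].

Definition closedS i j d b b' : seq (event (R := R)) :=
  [:: (en i j d b, true); (en i j d (~~ b), false);
      (en i j (~~ d) b', true); (en i j (~~ d) (~~ b'), false)].

End Schedules.

Section Chain.
Context {R : realType}.
Variables (sg : bool) (N : nat) (cell : nat -> set (space3 R)).
Variables (bp : nat -> R) (pt : nat -> bool -> space3 R).
Hypothesis cell_closed : forall k, (k < N)%N -> closed (cell k).
Hypothesis cell_range : forall k p, (k < N)%N -> cell k p -> bp k <= p.1.1 <= bp k.+1.
Hypothesis bp_lt : forall k, (k < N)%N -> bp k < bp k.+1.
Hypothesis cell_adj : forall k p q, (k.+1 < N)%N -> cell k p -> cell k.+1 q ->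
  p.1 = q.1 -> p = q /\ exists b, p = pt k.+1 b.

Definition chain i j : set (space3 R) :=
  [set p | exists k, [/\ (i <= k)%N, (k < j)%N & cell k p]].

Lemma chain1 i : chain i i.+1 = cell i.
Proof.
apply/seteqP; split=> [p [k [ik ki]]|p cp]; last by exists i; rewrite leqnn ltnSn.
by have -> : k = i by apply/eqP; rewrite eqn_leq -ltnS ki.
Qed.

Lemma chain_cat i j k : (i <= j)%N -> (j <= k)%N -> chain i k = chain i j `|` chain j k.
Proof.
move=> ij jk; apply/seteqP; split=> [p [l [il lk cl]]|p [[l [il lj cl]]|[l [jl lk cl]]]].
- have [lj|jl] := ltnP l j; first by left; exists l.
  by right; exists l.
- by exists l; split=> //; exact: leq_trans jk.
- by exists l; split=> //; exact: leq_trans jl.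
Qed.

Lemma chain_closed i j : (j <= N)%N -> closed (chain i j).
Proof.
elim: j => [|j IH] jN.
  have -> : chain i 0 = set0 by apply/seteqP; split=> p // [k []].
  exact: closed0.
have [ij|ji] := leqP i j.
  rewrite (chain_cat ij)// chain1; apply: closedU; last exact: cell_closed.
  exact/IH/ltnW.
have -> : chain i j.+1 = set0.
  apply/seteqP; split=> p // [k [ik kj _]].
  by have := leq_trans (leq_trans kj ji) ik; rewrite ltnn.
exact: closed0.
Qed.

Lemma bp_mono i j : (i <= j)%N -> (j <= N)%N -> bp i <= bp j ?= iff (i == j).
Proof.
move=> ij jN; split.
  elim: j ij jN => [|j IH]; first by rewrite leqn0 => /eqP->.
  rewrite leq_eqVlt => /orP[/eqP->//|ij] jN.
  by apply: le_trans (IH ij (ltnW jN)) (ltW (bp_lt _)).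
have [->|ne] := eqVneq i j; first by rewrite eqxx.
apply/negbTE; rewrite lt_eqF//.
have {ij ne} ij : (i < j)%N by rewrite ltn_neqAle ne.
elim: j ij jN => // j IH; rewrite ltnS leq_eqVlt => /orP[/eqP->|ij] jN.
  exact: bp_lt.
by apply: lt_trans (IH ij (ltnW jN)) (bp_lt _).
Qed.

Lemma chain_meet i j k p q : (k <= N)%N -> chain i j p -> chain j k q -> p.1 = q.1 ->
  p = q /\ exists b, p = pt j b.
Proof.
move=> kN [a [ia aj ca]] [b [jb bk cb]] pq.
have aN : (a < N)%N by apply: leq_trans (leq_trans aj (leq_trans jb (ltnW bk))) kN.
have bN : (b < N)%N by exact: leq_trans kN.
have /andP[_ h1] := cell_range aN ca; have /andP[h2 _] := cell_range bN cb.
have [h3 e3] := bp_mono aj (leq_trans jb (ltnW bN)).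
have [h4 e4] := bp_mono jb (ltnW bN).
move: h2; rewrite -pq => h2.
have e3' : a.+1 == j by rewrite -e3 eq_le; apply/andP; split; lra.
have e4' : j == b by rewrite -e4 eq_le; apply/andP; split; lra.
move: e3' e4' bN cb => /eqP<- /eqP<- bN cb.
exact: cell_adj cb pq.
Qed.

Lemma chain_glue i j k k1 k2 s1 s2 s D : (i <= j)%N -> (j <= k)%N -> (k <= N)%N ->
  merge s1 s2 s D -> pt j false \in D -> pt j true \in D ->
  play sg (chain i j) k1 s1 -> play sg (chain j k) k2 s2 ->
  play sg (chain i k) (k1 + k2) s.
Proof.
move=> ij jk kN m D0 D1 P1 P2; rewrite (chain_cat ij jk).
apply: play_glue m P1 P2; try by apply: chain_closed => //; exact: leq_trans kN.
move=> p q cp cq pq; have [pq' [b pE]] := chain_meet kN cp cq pq.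
by split=> //; rewrite pE; case: b {pE}.
Qed.

Ltac glue_by ij jk kN P1 P2 :=
  apply: (chain_glue ij jk kN _ _ _ P1 P2);
  [by merge_tac|by rewrite !inE eqxx ?orbT|by rewrite !inE eqxx ?orbT].

Lemma thru_glue i j k c1 c2 d b d' : (i <= j)%N -> (j <= k)%N -> (k <= N)%N ->
  play sg (chain i j) c1 (thruS pt i j d b d') ->
  play sg (chain j k) c2 (thruS pt j k d b d') ->
  play sg (chain i k) (c1 + c2) (thruS pt i k d b d').
Proof.
by rewrite /thruS /en => ij jk kN; case: d; case: d'; case: b => /= P1 P2; glue_by ij jk kN P1 P2.
Qed.

Lemma pass_glue i j k c1 c2 d : (i <= j)%N -> (j <= k)%N -> (k <= N)%N ->
  play sg (chain i j) c1 (passS pt i j d false false) ->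
  play sg (chain j k) c2 (passS pt j k d false false) ->
  play sg (chain i k) (c1 + c2) (passS pt i k d false false).
Proof.
by rewrite /passS /en => ij jk kN; case: d => /= P1 P2; glue_by ij jk kN P1 P2.
Qed.

Lemma pass_perm Z i j c d b b' b1 b1' :
  play sg Z c (passS pt i j d b b') -> play sg Z c (passS pt i j d b1 b1').
Proof.
have H1 b2 b2' : play sg Z c (passS pt i j d b2 b2') ->
    play sg Z c (passS pt i j d (~~ b2) b2').
  by move=> /(@play_perm _ _ _ _ [::]) => /(_ isT); rewrite /passS negbK.
have H2 b2 b2' : play sg Z c (passS pt i j d b2 b2') ->
    play sg Z c (passS pt i j d b2 (~~ b2')).
  rewrite /passS negbK; set x := (_, true); set y := (_, true).
  by move=> /(@play_perm _ _ _ _ [:: x; y]); apply.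
by move=> H; case: b1 b1' b b' H => -[] [] [] H //;
  (exact: H1 H || exact: H2 H || exact: (H1 _ _ (H2 _ _ H))).
Qed.

Lemma thru_pass Z i j c d : play sg Z c (thruS pt i j d false d) ->
  play sg Z c (passS pt i j d false false).
Proof.
rewrite /thruS /passS; set x := (_, true).
by move=> /(@play_perm _ _ _ _ [:: x]); apply.
Qed.

Section Sums.
Variable c : nat -> nat.

Lemma thru_chain i j d b d' : (i < j)%N -> (j <= N)%N ->
  (forall k, (i <= k)%N -> (k < j)%N -> play sg (cell k) (c k) (thruS pt k k.+1 d b d')) ->
  play sg (chain i j) (\sum_(i <= k < j) c k)%N (thruS pt i j d b d').
Proof.
elim: j => // j IH; rewrite ltnS leq_eqVlt => /orP[/eqP<-|ij] jN H.
  by rewrite big_nat1 chain1; apply: H.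
rewrite big_nat_recr ?(ltnW ij)//=.
apply: (@thru_glue _ j); rewrite ?(ltnW ij)//; last by rewrite chain1; apply: H; rewrite ?(ltnW ij).
by apply: IH (ltnW jN) _ => // k ik kj; apply: H => //; exact: ltnW.
Qed.

Lemma pass_chain i j d b b' : (i < j)%N -> (j <= N)%N ->
  (forall k, (i <= k)%N -> (k < j)%N ->
     play sg (cell k) (c k) (passS pt k k.+1 d false false)) ->
  play sg (chain i j) (\sum_(i <= k < j) c k)%N (passS pt i j d b b').
Proof.
move=> + + H; move=> ij jN; apply: (@pass_perm _ _ _ _ _ false false).
elim: j ij jN H => // j IH; rewrite ltnS leq_eqVlt => /orP[/eqP<-|ij] jN H.
  by rewrite big_nat1 chain1; apply: H.
rewrite big_nat_recr ?(ltnW ij)//=.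
apply: (@pass_glue _ j); rewrite ?(ltnW ij)//; last by rewrite chain1; apply: H; rewrite ?(ltnW ij).
by apply: IH (ltnW jN) _ => // k ik kj; apply: H => //; exact: ltnW.
Qed.

End Sums.

Section Pairs.
Variables (i j k c1 c2 : nat).
Hypotheses (ij : (i <= j)%N) (jk : (j <= k)%N) (kN : (k <= N)%N).

Lemma spread_left b : play sg (chain i j) c1 (thruS pt i j false b true) ->
  play sg (chain j k) c2 (spreadS pt j k false b) ->
  play sg (chain i k) (c1 + c2) (spreadS pt i k false b).
Proof. by rewrite /thruS /spreadS /en; case: b => /= P1 P2; glue_by ij jk kN P1 P2. Qed.

Lemma spread_right b : play sg (chain i j) c1 (spreadS pt i j true b) ->
  play sg (chain j k) c2 (thruS pt j k true b false) ->
  play sg (chain i k) (c1 + c2) (spreadS pt i k true b).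
Proof. by rewrite /thruS /spreadS /en; case: b => /= P1 P2; glue_by ij jk kN P1 P2. Qed.

Lemma collect_right b : play sg (chain i j) c1 (collectS pt i j true b) ->
  play sg (chain j k) c2 (thruS pt j k true (~~ b) false) ->
  play sg (chain i k) (c1 + c2) (collectS pt i k true b).
Proof. by rewrite /thruS /collectS /en; case: b => /= P1 P2; glue_by ij jk kN P1 P2. Qed.

Lemma collect_left b : play sg (chain i j) c1 (thruS pt i j false (~~ b) true) ->
  play sg (chain j k) c2 (collectS pt j k false b) ->
  play sg (chain i k) (c1 + c2) (collectS pt i k false b).
Proof. by rewrite /thruS /collectS /en; case: b => /= P1 P2; glue_by ij jk kN P1 P2. Qed.

(** The strand that comes in at the left end is led to the hub on the left; the hub sends one strand
    back along the other side and two strands on, in parallel, to the right end. *)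
Lemma open_left b : play sg (chain i j) c1 (spreadS pt i j false b) ->
  play sg (chain j k) c2 (passS pt j k false b b) ->
  play sg (chain i k) (c1 + c2) (openS pt i k false b).
Proof. by rewrite /spreadS /passS /openS /en; case: b => /= P1 P2; glue_by ij jk kN P1 P2. Qed.

Lemma open_right b : play sg (chain i j) c1 (passS pt i j true b b) ->
  play sg (chain j k) c2 (spreadS pt j k true b) ->
  play sg (chain i k) (c1 + c2) (openS pt i k true b).
Proof. by rewrite /spreadS /passS /openS /en; case: b => /= P1 P2; glue_by ij jk kN P1 P2. Qed.

(** Two parallel strands come from the left end to the hub on the right and meet there a third from
    the right end; what remains leaves at the right end. *)
Lemma shut_right b : play sg (chain i j) c1 (passS pt i j false (~~ b) b) ->
  play sg (chain j k) c2 (collectS pt j k true b) ->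
  play sg (chain i k) (c1 + c2) (shutS pt i k true b).
Proof. by rewrite /collectS /passS /shutS /en; case: b => /= P1 P2; glue_by ij jk kN P1 P2. Qed.

Lemma shut_left b : play sg (chain i j) c1 (collectS pt i j false b) ->
  play sg (chain j k) c2 (passS pt j k true (~~ b) b) ->
  play sg (chain i k) (c1 + c2) (shutS pt i k false b).
Proof. by rewrite /collectS /passS /shutS /en; case: b => /= P1 P2; glue_by ij jk kN P1 P2. Qed.

End Pairs.

Section Triples.
Variables (i j j' k c1 c2 c3 : nat).
Hypotheses (ij : (i <= j)%N) (jj : (j <= j')%N) (jk : (j' <= k)%N) (kN : (k <= N)%N).

Let jN : (j' <= N)%N := leq_trans jk kN.
Let ij' : (i <= j')%N := leq_trans ij jj.
Let jk' : (j <= k)%N := leq_trans jj jk.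

(** A spreading hub on the left feeds a collecting hub on the right through two parallel strands.
    Each end of the band keeps one given and one chosen height, as a branch seen as closed
    requires. *)
Lemma closed_left b b' : play sg (chain i j) c1 (spreadS pt i j false b) ->
  play sg (chain j j') c2 (passS pt j j' false b (~~ b')) ->
  play sg (chain j' k) c3 (collectS pt j' k true (~~ b')) ->
  play sg (chain i k) (c1 + c2 + c3) (closedS pt i k false b b').
Proof.
rewrite /spreadS /passS /collectS /closedS /en => P1 P2 P3.
have P12 : play sg (chain i j') (c1 + c2) [:: (pt i b, true); (pt i (~~ b), false);
    (pt j' (~~ b'), false); (pt j' b', false)].
  by move: P1 P2 {P3}; case: b; case: b' => /= P1 P2; glue_by ij jj jN P1 P2.
by move: P12 P3 {P1 P2}; case: b; case: b' => /= P12 P3; glue_by ij' jk kN P12 P3.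
Qed.

Lemma closed_right b b' : play sg (chain i j) c1 (collectS pt i j false (~~ b')) ->
  play sg (chain j j') c2 (passS pt j j' true b (~~ b')) ->
  play sg (chain j' k) c3 (spreadS pt j' k true b) ->
  play sg (chain i k) (c1 + c2 + c3) (closedS pt i k true b b').
Proof.
rewrite -addnA /spreadS /passS /collectS /closedS /en => P1 P2 P3.
have P23 : play sg (chain j k) (c2 + c3) [:: (pt k b, true); (pt k (~~ b), false);
    (pt j (~~ b'), false); (pt j b', false)].
  by move: P2 P3 {P1}; case: b; case: b' => /= P2 P3; glue_by jj jk kN P2 P3.
by move: P1 P23 {P2 P3}; case: b; case: b' => /= P1 P23; glue_by ij jk' kN P1 P23.
Qed.

End Triples.

Lemma closed_half Z i j c d b : play sg Z c (closedS pt i j d b b) ->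
  play sg Z c (halfS pt i j d b).
Proof.
rewrite /closedS /halfS; set x := (_, true).
by move=> /(@play_perm _ _ _ _ [:: x]); apply.
Qed.

Lemma half_flip Z i j c d b : play sg Z c (halfS pt i j d b) ->
  play sg Z c (halfS pt i j (~~ d) b).
Proof.
rewrite /halfS negbK => P.
have := @play_perm _ sg Z c [::] (en pt i j d b, true)
  (en pt i j (~~ d) b, true) _ isT P; set x := (_, true); set y := (_, true).
by move=> /(@play_perm _ _ _ _ [:: x; y]); apply.
Qed.

Section Flat.
Variables (k : nat) (st : bool -> set (space3 R)).
Hypothesis st_closed : forall b, closed (st b).
Hypothesis cellE : cell k = st false `|` st true.
Hypothesis st_disj : forall p q, st false p -> st true q -> p.1 <> q.1.
Hypothesis st_mono : forall b d, play sg (st b) 0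
  [:: (en pt k k.+1 d b, true); (en pt k k.+1 (~~ d) b, false)].
Hypothesis st_valley : forall b d, play sg (st b) 0
  [:: (en pt k k.+1 d b, true); (en pt k k.+1 (~~ d) b, true)].
Hypothesis st_ridge : forall b d, play sg (st b) 1
  [:: (en pt k k.+1 d b, false); (en pt k k.+1 (~~ d) b, false)].

Lemma flat_glue b c1 c2 s1 s2 s : merge s1 s2 s [::] ->
  play sg (st b) c1 s1 -> play sg (st (~~ b)) c2 s2 -> play sg (cell k) (c1 + c2) s.
Proof.
move=> m P1 P2.
have -> : cell k = st b `|` st (~~ b) by rewrite cellE; case: (b); rewrite //= setUC.
apply: play_glue m P1 P2 => //; case: (b) => p q sp sq pq.
  by case: (st_disj sq sp).
by case: (st_disj sp sq).
Qed.

Lemma flat_thru d b d' : play sg (cell k) 0 (thruS pt k k.+1 d b d').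
Proof. by apply: (flat_glue _ (st_mono b d) (st_mono (~~ b) d')); merge_tac. Qed.

Lemma flat_spread d b : play sg (cell k) 1 (spreadS pt k k.+1 d b).
Proof. by apply: (flat_glue _ (st_mono b d) (st_ridge (~~ b) d)); merge_tac. Qed.

Lemma flat_collect d b : play sg (cell k) 0 (collectS pt k k.+1 d b).
Proof.
have := st_mono b (~~ d); have := st_valley (~~ b) (~~ d); rewrite !negbK => P2 P1.
apply: (flat_glue _ P1 P2).
apply: merge_left; do 2 apply: merge_right; apply: merge_left.
exact: merge_nil.
Qed.

End Flat.
End Chain.

(** * Moving bands and their children *)

Section Moves.
Context {R : realType}.

Definition box : set (space3 R) :=
  [set p | [/\ - 4^-1 < p.1.1 < 5 / 4, - 4^-1 < p.1.2 < 5 / 4 & 0 < p.2 < 1]].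

Definition clamp (x : R) : R := Num.max 0 (Num.min 1 x).

Lemma clamp_ge0 x : 0 <= clamp x.
Proof. by rewrite le_max lexx. Qed.

Lemma clamp_le1 x : clamp x <= 1.
Proof. by rewrite ge_max ler01 ge_min lexx. Qed.

Lemma clamp0 x : x <= 0 -> clamp x = 0.
Proof. by move=> x0; apply/max_idPl; rewrite ge_min x0 orbT. Qed.

Lemma clamp1 x : 1 <= x -> clamp x = 1.
Proof. by move=> x1; rewrite /clamp (min_idPl x1); apply/max_idPr. Qed.

Lemma clamp_id x : 0 <= x <= 1 -> clamp x = x.
Proof. by move=> /andP[x0 x1]; rewrite /clamp (min_idPr x1); apply/max_idPr. Qed.

Lemma clamp_lipschitz x y : `|clamp x - clamp y| <= `|x - y|.
Proof.
have [h1 h2] := (ler_norm (x - y), ler_norm (y - x)).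
rewrite distrC in h2; rewrite ler_norml /clamp !minEle.
by do !case: ifP => ?; rewrite !maxEle; do !case: ifP => ?; apply/andP; split; lra.
Qed.

(** The factor 4 matches [twisted], whose vertical amplitude is half the horizontal one. The sides
    of a flat or twisted band have value 1/4, children in their slots reach at most 1/2, and the
    ellipse of value 9/16 still fits into [box]. *)
Definition radius2 (p : space3 R) : R :=
  (p.1.2 - 2^-1) * (p.1.2 - 2^-1) + 4 * ((p.2 - 2^-1) * (p.2 - 2^-1)).

Definition turn (th : R) (p : space3 R) : space3 R :=
  (p.1.1,
   2^-1 + ((p.1.2 - 2^-1) * cos th - 2 * (p.2 - 2^-1) * sin th),
   2^-1 + (2^-1 * (p.1.2 - 2^-1) * sin th + (p.2 - 2^-1) * cos th)).

Lemma turn_radius th p : radius2 (turn th p) = radius2 p.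
Proof.
have A (x : R) : 2^-1 + x - 2^-1 = x by lra.
rewrite /radius2 /turn /= !A.
move: (p.1.2 - 2^-1) (p.2 - 2^-1) => u v.
transitivity ((u * u + 4 * (v * v)) * (cos th ^+ 2 + sin th ^+ 2)); first by field.
by rewrite cos2Dsin2 mulr1.
Qed.

Lemma turn0 p : turn 0 p = p.
Proof.
case: p => [[x y] z]; rewrite /turn /= cos0 sin0 !mulr0 !mulr1 subr0 add0r.
by rewrite !subrKC.
Qed.

Lemma turnD th th' p : turn th (turn th' p) = turn (th + th') p.
Proof.
case: p => [[x y] z]; rewrite /turn /= cosD sinD; congr (_, _, _); lra.
Qed.

(* A rotation of the disc [radius2 <= 1/2] in each plane orthogonal to the
   core, damped to the identity outside of the disc [radius2 < 9/16]. *)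
Definition spin (t : R -> R) (p : space3 R) : space3 R :=
  turn (t p.1.1 * clamp (9 - 16 * radius2 p)) p.

Lemma spin_homeomorphism t : continuous t -> homeomorphism (spin t).
Proof.
have c t' : continuous t' -> continuous (spin t').
  move=> ct; have ct' : continuous (fun p : space3 R => t' p.1.1).
    by apply: (@cont_comp _ _ _ (fun p : space3 R => p.1.1)) => //; cont.
  rewrite /spin /turn /radius2 /clamp; cont.
have K t' t'' : (forall x, t'' x = - t' x) -> cancel (spin t') (spin t'').
  move=> tt p; rewrite {1}/spin turn_radius turnD tt -[X in turn X](mulrDl).
  by rewrite addNr mul0r turn0.
move=> ct; exists (spin (fun x => - t x)); split.
- exact: c.
- by apply: c; cont.
- exact: K.
- by apply: K => x; rewrite opprK.
Qed.

Lemma spin_out t p : t p.1.1 = 0 \/ 9 / 16 <= radius2 p -> spin t p = p.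
Proof.
move=> H; rewrite /spin; suff -> : t p.1.1 * clamp (9 - 16 * radius2 p) = 0 by exact: turn0.
by case: H => [->|H]; rewrite ?mul0r// clamp0 ?mulr0//; lra.
Qed.

Lemma spin_in t p : radius2 p <= 2^-1 -> spin t p = turn (t p.1.1) p.
Proof. by move=> H; rewrite /spin clamp1 ?mulr1//; lra. Qed.

Lemma spin_box t p : (forall x, x <= 0 \/ 1 <= x -> t x = 0) -> ~ box p -> spin t p = p.
Proof.
move=> t0 bp; apply: spin_out.
have [x0|x0] := leP p.1.1 0; first by left; apply: t0; left.
have [x1|x1] := leP 1 p.1.1; first by left; apply: t0; right.
have [?|h] := leP (9 / 16) (radius2 p); [by right|exfalso].
have sq (u k : R) : u * u < k * k -> 0 < k -> - k < u < k.
  by move=> uk k0; apply/andP; split; nra.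
have uu (u : R) : 0 <= u * u by rewrite -expr2 sqr_ge0.
move: h; rewrite /radius2.
have := uu (p.1.2 - 2^-1); have := uu (p.2 - 2^-1) => v0 u0 h.
have /andP[? ?] := sq (p.1.2 - 2^-1) (3 / 4) ltac:(lra) ltac:(lra).
have /andP[? ?] := sq (p.2 - 2^-1) (3 / 8) ltac:(lra) ltac:(lra).
by apply: bp; split; apply/andP; split; lra.
Qed.

Variable eps : R.
Hypothesis eps01 : 0 < eps < 2^-1.

(** A bump with peak [eps / 4] at 0, zero outside the interval from -1/4 to [eps], of slope at least
    -1/4. As [squeeze] uses two mirrored bumps, it keeps a rate of at least 1/2 in the core
    direction. *)
Definition pull (x : R) : R :=
  Num.max 0 (Num.min (eps / 4 * (1 + 4 * x)) ((eps - x) / 4)).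

(** Tilts the vertical walls of an arch inwards, in proportion to the height, and compresses the
    ends of its top ahead of them. The sides of the band thereby become graphs over the core
    direction, as [strand] demands. *)
Definition squeeze (p : space3 R) : space3 R :=
  (p.1.1 + clamp (1 - 4 * Num.max (- p.1.2) (p.1.2 - 1)) *
     clamp (Num.min (2 * p.2) (2 - 2 * p.2)) * (pull p.1.1 - pull (1 - p.1.1)),
   p.1.2, p.2).

Lemma squeeze_homeomorphism : homeomorphism squeeze.
Proof.
have /andP[e0 e1] := eps01.
have [perm _] := @homeomorphism_permute R.
pose g (p : space3 R) := (squeeze (p.2, p.1.2, p.1.1)).1.1.
have hg : homeomorphism (fun p : space3 R => (p.1, g p)).
  apply: (@steep_homeomorphism _ 2^-1) => //.
  split; first by rewrite /g /squeeze /clamp /pull /=; cont.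
  move=> [z y] x x' xx' /=; rewrite /g /squeeze /=.
  set c := clamp _; set q := clamp _.
  have c01 : 0 <= c <= 1 by rewrite clamp_ge0 clamp_le1.
  have q01 : 0 <= q <= 1 by rewrite clamp_ge0 clamp_le1.
  have : - (2^-1 * (x' - x)) <= pull x' - pull (1 - x') - (pull x - pull (1 - x)).
    have L u v : u <= v -> - (4^-1 * (v - u)) <= pull v - pull u.
      move=> uv; rewrite /pull !minEle; have ee : eps * u <= eps * v by rewrite ler_wpM2l// ltW.
      by do !case: ifP => ?; rewrite !maxEle; do !case: ifP => ?; lra.
    have := L x x' xx'; have := L (1 - x') (1 - x); rewrite lerD2l lerN2 => /(_ xx').
    lra.
  move: (pull x' - _) (pull x - _) => d' d H.
  have cq : 0 <= c * q <= 1.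
    move: c01 q01 => /andP[c0 c1] /andP[q0 q1].
    by apply/andP; split; [exact: mulr_ge0|exact: mulr_ile1].
  move: (c * q) cq => k /andP[k0 k1]; nra.
apply: (@homeomorphism_ext _ (_ \o _ \o _)); last exact:
  (homeomorphism_comp perm (homeomorphism_comp hg perm)).
by move=> [[x y] z].
Qed.

Lemma pull0 x : x <= - 4^-1 \/ eps <= x -> pull x = 0.
Proof.
have /andP[e0 e1] := eps01.
move=> H; apply/max_idPl; rewrite ge_min; case: H => H; apply/orP; [left|right]; nra.
Qed.

Lemma squeeze_box p : ~ box p -> squeeze p = p.
Proof.
have /andP[e0 e1] := eps01.
case: p => [[x y] z]; rewrite /squeeze /= => bp; congr (_, _, _).
suff : clamp (1 - 4 * Num.max (- y) (y - 1)) = 0 \/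
    clamp (Num.min (2 * z) (2 - 2 * z)) = 0 \/ pull x - pull (1 - x) = 0.
  by case=> [->|[->|->]]; rewrite ?mul0r ?mulr0 ?mul0r addr0.
have [y0|y0] := leP (5 / 4) (Num.max (- y) (y - 1) + 1).
  by left; apply: clamp0; lra.
have [z0|z0] := leP (Num.min (2 * z) (2 - 2 * z)) 0.
  by right; left; exact: clamp0.
right; right.
have [|/negP] := boolP ((- 4^-1 < x) && (x < 5 / 4)) => xb.
  exfalso; apply: bp; split=> //=.
    by move: y0; rewrite maxEle; case: ifP => ? ?; apply/andP; split; lra.
  by move: z0; rewrite minEle; case: ifP => ? ?; apply/andP; split; lra.
have [x0|x0] := leP x (- 4^-1); first by rewrite !pull0; [lra|right; lra|left].
have [x1|x1] := leP (5 / 4) x; first by rewrite !pull0; [lra|left; lra|right; lra].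
by case: xb; rewrite x0.
Qed.

Lemma squeeze_mid p : eps <= p.1.1 <= 1 - eps -> squeeze p = p.
Proof.
case: p => [[x y] z] /= /andP[x0 x1]; rewrite /squeeze /= !pull0; try (right; lra).
by rewrite subrr mulr0 addr0.
Qed.

Lemma squeeze_left p : 0 <= p.1.2 <= 1 -> 0 <= p.2 <= 2^-1 -> 0 <= p.1.1 <= eps ->
  squeeze p = (p.1.1 + 2 * p.2 * ((eps - p.1.1) / 4), p.1.2, p.2).
Proof.
have /andP[e0 e1] := eps01.
case: p => [[x y] z] /= /andP[y0 y1] /andP[z0 z1] /andP[x0 x1].
rewrite /squeeze /= clamp1; last by rewrite maxEle; case: ifP => ?; lra.
have -> : Num.min (2 * z) (2 - 2 * z) = 2 * z by apply/min_idPl; lra.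
rewrite clamp_id; last by apply/andP; split; lra.
rewrite (pull0 (x := 1 - x)); last by right; lra.
rewrite subr0 mul1r; congr (_ + _ * _, _, _); rewrite /pull.
rewrite (min_idPr _); last by nra.
by apply/max_idPr; lra.
Qed.

Lemma squeeze_right p : 0 <= p.1.2 <= 1 -> 0 <= p.2 <= 2^-1 -> 1 - eps <= p.1.1 <= 1 ->
  squeeze p = (p.1.1 - 2 * p.2 * ((eps - (1 - p.1.1)) / 4), p.1.2, p.2).
Proof.
have /andP[e0 e1] := eps01.
case: p => [[x y] z] /= /andP[y0 y1] /andP[z0 z1] /andP[x0 x1].
rewrite /squeeze /= clamp1; last by rewrite maxEle; case: ifP => ?; lra.
have -> : Num.min (2 * z) (2 - 2 * z) = 2 * z by apply/min_idPl; lra.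
rewrite clamp_id; last by apply/andP; split; lra.
rewrite (pull0 (x := x)); last by right; lra.
rewrite sub0r mul1r -mulrN; congr (_ + _ * - _, _, _); rewrite /pull.
rewrite (min_idPr _); last by nra.
by apply/max_idPr; lra.
Qed.

End Moves.

(** * Induction on plane trees and the pieces of an arch *)

Fixpoint inseq (A : Type) (x : A) (s : seq A) : Prop :=
  if s is y :: s' then x = y \/ inseq x s' else False.

Lemma nth_inseq (A : Type) (d : A) s i : (i < size s)%N -> inseq (nth d s i) s.
Proof.
by elim: s i => [|y s IH] [|i] //= si; [left|right; exact: IH].
Qed.

Lemma inseq_cat (A : Type) (x : A) s t : inseq x (s ++ t) <-> inseq x s \/ inseq x t.
Proof.
by elim: s => [|y s IH] /=; [split; [right|case]|rewrite IH or_assoc].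
Qed.

(** Built by hand with an inner recursion on each of the two lists of children. Membership is the
    proposition [inseq], since the labels come from an arbitrary type. *)
Lemma tree_induction (A : Type) (P : plane_tree A -> Prop) :
  (forall a l r, (forall c, inseq c (l ++ r) -> P c) -> P (Node a l r)) ->
  forall T, P T.
Proof.
move=> H; fix IH 1; case=> a l r; apply: H => c /inseq_cat[].
  revert c; refine ((fix all (s : seq (plane_tree A)) : forall c, inseq c s -> P c :=
    match s with
    | [::] => fun c h => match h with end
    | x :: s' => fun c h => match h with
        | or_introl e => eq_ind_r P (IH x) e
        | or_intror h' => all s' c h'
        end
    end) l).
revert c; refine ((fix all (s : seq (plane_tree A)) : forall c, inseq c s -> P c :=
    match s with
    | [::] => fun c h => match h with end
    | x :: s' => fun c h => match h with
        | or_introl e => eq_ind_r P (IH x) e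
        | or_intror h' => all s' c h'
        end
    end) r).
Qed.

(** The entry [None], at index [size l], stands for the half twists, so that children and twists are
    numbered together along the arch. *)
Definition pieces (A : Type) (l r : seq (plane_tree A)) : seq (option (plane_tree A)) :=
  [seq Some c | c <- l] ++ None :: [seq Some c | c <- r].

Section Pieces.
Variables (A : Type) (l r : seq (plane_tree A)).

Lemma size_pieces : size (pieces l r) = (size l + size r).+1.
Proof. by rewrite size_cat /= !size_map addnS. Qed.

Lemma nth_pieces : nth None (pieces l r) (size l) = None.
Proof. by rewrite nth_cat size_map ltnn subnn. Qed.

Lemma nth_pieces_child i : (i <= size l + size r)%N -> i != size l ->
  exists2 c, nth None (pieces l r) i = Some c & inseq c (l ++ r).
Proof.
move=> iN il.
have S (s : seq (plane_tree A)) j : (j < size s)%N ->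
    exists2 c, nth None [seq Some c | c <- s] j = Some c & inseq c s.
  elim: s j => [|x s IH] [|j] //= js; first by exists x => //; left.
  by have [c ? ?] := IH j js; exists c => //; right.
rewrite nth_cat size_map; case: ltnP => li.
  by have [c ? ?] := S l i li; exists c => //; apply/inseq_cat; left.
have {}li : (size l < i)%N by rewrite ltn_neqAle eq_sym il.
have [|c ? ?] := S r (i - size l).-1 _; first by lia.
exists c; last by apply/inseq_cat; right.
by have -> : (i - size l = (i - size l).-1.+1)%N by lia.
Qed.

End Pieces.

Section ArchDescription.
Context {R : realType}.
Implicit Types (E : set R).

Lemma arch_topE E (ps : seq (set (space3 R))) :
  arch_top E ps = [set p | exists k, (k < (size ps).*2.+1)%N /\
     (place (size ps).*2.+1 k @` (if odd k then nth set0 ps k./2 else flat E)) p].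
Proof.
rewrite /arch_top.
set qs := flat E :: _.
have szE : size qs = (size ps).*2.+1.
  by rewrite /qs; elim: (ps) => //= x s [->].
have nthE k : nth set0 qs k =
    if (k < (size ps).*2.+1)%N then (if odd k then nth set0 ps k./2 else flat E) else set0.
  rewrite /qs; elim: (ps) k => [|x s IH] [|[|k]] //=.
  by have := IH k; rewrite /= negbK => ->.
rewrite szE; apply/seteqP; split=> p.
  move=> [k _]; rewrite nthE; case: ifP => ks H; first by exists k.
  by case: H.
by move=> [k [ks H]]; exists k => //; rewrite nthE ks.
Qed.

End ArchDescription.

Notation bits := ([set 0; 1] : set _).

(** * Normal position of a branch *)

Section Position.
Context {R : realType}.
Local Notation branch := (@branch R bits).

Definition corner (a b : bool) : space3 R := (a%:R, b%:R, 0).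

Lemma bitsP (x : R) : bits x <-> exists e : bool, x = e%:R.
Proof.
split; first by case=> ->; [exists false|exists true].
by case=> [[] ->]; [right|left].
Qed.

Lemma corner_branch T a b : branch T (corner a b).
Proof.
case: T => w l r /=; left.
exists a%:R; first by apply/bitsP; exists a.
exists (b%:R, 0) => //; split=> /=; first by apply/bitsP; exists b.
by rewrite in_itv/= lexx invr_ge0 ler0n.
Qed.

(* The points of [Y] other than the corners lie above the open interval in
   the direction of the core, and high enough to leave room for the strands
   that close the band of the root. *)
Definition position (T : plane_tree int) (Y : set (space3 R)) :=
  [/\ displaces box (branch T) Y, closed Y,
      forall p, Y p -> [/\ 0 <= p.1.1 <= 1, 0 <= p.1.2 <= 1, p.2 <= 1
        & Num.min p.1.1 (1 - p.1.1) <= 4 * p.2] &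
      forall p, Y p -> p.1.1 = 0 \/ p.1.1 = 1 -> exists a b, p = corner a b].

Lemma position_corner T Y a b : position T Y -> Y (corner a b).
Proof.
move=> [[h [_ hb <-]] _ _ _]; exists (corner a b); first exact: corner_branch.
by apply: hb => -[_ _]; rewrite /= ltxx.
Qed.

Lemma position_range T Y p : position T Y -> branch T p ->
  - 4^-1 <= p.1.2 <= 5 / 4 /\ p.2 <= 1.
Proof.
move=> [[h [_ hb hY]] _ Yr _] Bp.
have [[_ /andP[h1 h2] /andP[h3 h4]]|nb] := pselect (box p).
  by split; [apply/andP; split|]; exact: ltW.
have [] := Yr p; first by rewrite -hY; exists p => //; exact: hb.
by move=> _ /andP[? ?] ? _; split => //; apply/andP; split; lra.
Qed.

Variables (w : int) (l r : seq (plane_tree int)).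
Let n1 := size l.
Let n := (size l + size r)%N.
Let mn := n.+1.*2.+1.
Let M : R := mn%:R.

Let M_gt0 : 0 < M.
Proof. by rewrite ltr0n. Qed.

(** Cells of even index are flat and those of odd index hold the pieces; among the latter only that
    of the half twists belongs to the band itself. *)
Definition in_band (x : R) := exists k : nat,
  [/\ (k < mn)%N, ~~ odd k || (k == n1.*2.+1) & k%:R <= M * x <= k.+1%:R].

(** The index [e] follows a strand along the whole band. Past an odd number of half twists it
    therefore differs from the side on which the strand runs. *)
Definition band_set (rr zz : R -> R) : set (space3 R) :=
  [set p | exists e, in_band p.1.1 /\ (p.1.2, p.2) = band w rr zz e p.1.1].

(** With [rot] the child is turned by half a turn about the core of the parent, which is what a
    flype with [w] odd does to it. *)
Definition slot (rot : bool) (i : nat) (p : space3 R) : space3 R :=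
  ((i.*2.+1%:R + p.1.2) / M, if rot then 1 - p.1.1 else p.1.1,
   if rot then 2^-1 + p.2 / 4 else 2^-1 - p.2 / 4).

Definition children (rot : nat -> bool) (X : nat -> set (space3 R)) :=
  [set p | exists i, [/\ (i <= n)%N, i != n1 & (slot (rot i) i @` X i) p]].

Definition ramp0 (x : R) := clamp (M * x - n1.*2.+1%:R).

Lemma band_flat rr zz e (b : bool) (x : R) : rr x = b%:R ->
  band w rr zz (e (+) (b && odd `|w|%N)) x = (e%:R, zz x).
Proof.
move=> rb; rewrite /band rb; case: b {rb} => /=.
  rewrite mulr1 cos_pi_int sin_pi_int mulr0 addr0; congr pair.
  by case: e; case: odd; rewrite /= ?expr0 ?expr1; lra.
by rewrite addbF mulr0 cos0 sin0 mulr0 addr0; congr pair; lra.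
Qed.

Lemma slot_homeomorphism rot i : homeomorphism (slot rot i).
Proof.
exists (fun p : space3 R => (if rot then 1 - p.1.2 else p.1.2,
  M * p.1.1 - i.*2.+1%:R, if rot then 4 * (p.2 - 2^-1) else 4 * (2^-1 - p.2))).
have M0 : M != 0 by rewrite gt_eqF.
split.
- by rewrite /slot; case: rot; cont.
- by case: rot; cont.
- move=> [[x y] z]; rewrite /slot /= mulrC divfK//.
  by case: rot; congr (_, _, _); lra.
- move=> [[x y] z]; rewrite /slot /= subrKC mulrC mulKf//.
  by case: rot; congr (_, _, _); lra.
Qed.

Lemma ramp0_const k x : k != n1.*2.+1 -> k%:R <= M * x <= k.+1%:R ->
  ramp0 x = (n1.*2 < k)%N%:R.
Proof.
move=> kn1 /andP[h1 h2]; rewrite /ramp0; case: ltnP => kn /=.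
  have kn' : (n1.*2.+2 <= k)%N by rewrite ltn_neqAle eq_sym kn1.
  apply: clamp1; have : n1.*2.+2%:R <= k%:R :> R by rewrite ler_nat.
  by rewrite -[in X in X -> _]natr1; lra.
apply: clamp0; have : k.+1%:R <= n1.*2.+1%:R :> R by rewrite ler_nat.
lra.
Qed.

(** The corners of a plumbed square are the feet of the walls of the child, so they are absorbed
    into its branch. *)
Lemma branch_node (X : nat -> set (space3 R)) :
  (forall i c, (i <= n)%N -> nth None (pieces l r) i = Some c -> X i = branch c) ->
  branch (Node w l r) =
  walls bits `|` (band_set ramp0 (cst 2^-1) `|` children (fun=> false) X).
Proof.
move=> HX; rewrite /=; congr (_ `|` _).
set ps := _ ++ _.
pose F o := if o is Some c then plumb bits (branch c) else twisted bits w.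
have psE : ps = map F (pieces l r) by rewrite /ps map_cat /= -!map_comp.
have sz : size ps = n.+1 by rewrite psE size_map size_pieces.
have nthE i : (i <= n)%N -> nth set0 ps i = F (nth None (pieces l r) i).
  by move=> iN; rewrite psE (nth_map None)// size_pieces.
rewrite arch_topE sz -/mn.
have MK (x y : R) : x = y / M -> M * x = y by move=> ->; rewrite mulrC divfK// gt_eqF.
apply/seteqP; split=> [_ [k [kn [[[x y] z] H <-]]]|p].
  have Mx : M * ((k%:R + x) / M) = k%:R + x by rewrite mulrC divfK// gt_eqF.
  case: ifP H => ok.
    have kE : k = k./2.*2.+1 by rewrite -[LHS]odd_double_half ok.
    have i_n : (k./2 <= n)%N by move: kn; rewrite /mn; lia.
    rewrite nthE//; have [i1|i1] := eqVneq k./2 n1.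
      rewrite i1 nth_pieces /= => -[x'].
      rewrite /= in_itv/= => /andP[x0 x1] [y' /bitsP[e ->]] [xE yE zE].
      subst x' y z; left; exists e; rewrite /=; split.
        exists k; rewrite kn Mx; split=> //; first by rewrite kE i1 eqxx orbT.
        by rewrite -natr1; apply/andP; split; lra.
      rewrite /band /ramp0 Mx kE i1 addrAC subrr add0r clamp_id ?x0//.
    have [c cE _] := nth_pieces_child i_n i1; rewrite cE /= => -[q qB qE].
    right; exists k./2; split=> //; exists q.
      rewrite (HX _ _ i_n cE); case: qB => // -[a /bitsP[a' ->]] [b /bitsP[b' ->]] <-.
      exact: corner_branch.
    by case: q qE {qB} => [[x' y'] z'] [<- <- <-]; rewrite /slot /= -kE.
  move=> [x']; rewrite /= in_itv/= => /andP[x0 x1] [y' /bitsP[e ->]] [xE yE zE].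
  subst x' y z; left.
  have kx : k%:R <= M * ((k%:R + x) / M) <= k.+1%:R.
    by rewrite Mx -natr1; apply/andP; split; lra.
  exists (e (+) ((n1.*2 < k)%N && odd `|w|%N)); split; first by exists k; rewrite kn ok.
  by rewrite band_flat /= ?addr0//; apply: ramp0_const => //;
    apply: contraFneq ok => ->; rewrite /= odd_double.
case=> [[e [[k [kn ok kx]] pE]]|[i [i_n i1 [q Xq <-]]]]; last first.
  have [c cE _] := nth_pieces_child i_n i1.
  exists i.*2.+1; split; first by rewrite /mn; lia.
  rewrite /= odd_double /= uphalf_double nthE// cE /=.
  exists (q.1.2, q.1.1, - (q.2 / 4)).
    exists q; last by case: (q) => [[x y] z].
    by right; rewrite -(HX _ _ i_n cE).
  by rewrite /slot /place.
case: p kx pE => [[x y] z] /= /andP[kx kx'] pE.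
have xE : x = (k%:R + (M * x - k%:R)) / M by rewrite subrKC mulrC mulKf// gt_eqF.
have x'01 : (M * x - k%:R) \in `[0, 1].
  by rewrite in_itv/=; move: kx'; rewrite -natr1 => ?; apply/andP; split; lra.
exists k; split=> //; case: ifP ok => /= ok.
  move=> /eqP k1.
  have -> : k./2 = n1 by rewrite k1 /= uphalf_double.
  rewrite nthE ?leq_addr// nth_pieces /=.
  move: pE; rewrite /band /ramp0 -k1 clamp_id; last by move: x'01; rewrite in_itv.
  move=> [-> ->].
  exists (M * x - k%:R, 2^-1 + (e%:R - 2^-1) * cos (pi * w%:~R * (M * x - k%:R)),
          2^-1 * (e%:R - 2^-1) * sin (pi * w%:~R * (M * x - k%:R))).
    by exists (M * x - k%:R) => //; exists e%:R => //; apply/bitsP; exists e.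
  by rewrite /place /= -xE.
move=> _.
pose e' := e (+) ((n1.*2 < k)%N && odd `|w|%N).
have := @band_flat ramp0 (cst 2^-1) e' (n1.*2 < k)%N x.
rewrite (@ramp0_const k) ?kx//; last by apply: contraFneq ok => ->; rewrite /= odd_double.
move=> /(_ erefl); rewrite /e' addbK -pE => -[-> ->].
exists (M * x - k%:R, e'%:R, 0).
  by exists (M * x - k%:R) => //; exists e'%:R => //; apply/bitsP; exists e'.
by rewrite /place /= -xE addr0.
Qed.

End Position.

Section Arch.
Context {R : realType}.
Local Notation branch := (@branch R bits).
Variables (w : int) (l r : seq (plane_tree int)) (i0 : nat).
Variable Yf : nat -> set (space3 R).
Let n1 := size l.
Let n := (size l + size r)%N.
Let mn := n.+1.*2.+1.
Let M : R := mn%:R.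
Hypothesis i0n : (i0 <= n.+1)%N.
Hypothesis HY : forall i c, (i <= n)%N -> nth None (pieces l r) i = Some c ->
  position c (Yf i).

Let M_gt0 : 0 < M.
Proof. by rewrite ltr0n. Qed.

Let Yf_position i : (i <= n)%N -> i != n1 ->
  exists2 c, nth None (pieces l r) i = Some c & position c (Yf i).
Proof.
move=> i_n i1; have [c cE _] := nth_pieces_child i_n i1.
by exists c => //; exact: HY cE.
Qed.

Let slot_Mx rot i p : M * (slot (R := R) l r rot i p).1.1 = i.*2.+1%:R + p.1.2.
Proof. by rewrite /slot /= mulrC divfK// gt_eqF. Qed.

Let doubleS_natr i : i.*2.+1%:R = 2 * i%:R + 1 :> R.
Proof. by rewrite -natr1 -mul2n natrM. Qed.

Let M_def : M = 2 * n%:R + 3.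
Proof. by rewrite /M /mn doubleS_natr -natr1; lra. Qed.

Let X0 i : set (space3 R) :=
  if nth None (pieces l r) i is Some c then branch c else set0.

(** Children are put into position one by one, each inside the image of [box] under its slot. Before
    the flype all slots hang below the core at height 1/2 and are two cells apart, so this image
    avoids the walls, the band and the other children. *)
Lemma children_displace :
  displaces box (branch (Node w l r))
    (walls bits `|` (band_set w l r (ramp0 l r) (cst 2^-1) `|` children l r xpred0 Yf)).
Proof.
rewrite (@branch_node R w l r X0); last by rewrite /X0 => i c _ ->.
set W := walls bits; set B := band_set _ _ _ _ _.
pose X j i := if (i < j)%N then Yf i else X0 i.
have step j : (j <= n.+1)%N ->
    displaces box (W `|` (B `|` children l r xpred0 X0)) (W `|` (B `|` children l r xpred0 (X j))).
  elim: j => [_|j IH jn].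
    by have -> : X 0%N = X0; [apply/funext|exact: displaces_refl].
  apply: displaces_trans (IH (ltnW jn)) _ => {IH}.
  have [j1|j1] := eqVneq j n1.
    suff -> : children l r xpred0 (X j.+1) = children l r xpred0 (X j).
      exact: displaces_refl.
    have E i : i != n1 -> X j.+1 i = X j i.
      by rewrite /X ltnS leq_eqVlt -j1 => /negbTE->.
    by apply/seteqP; split=> p [i [i_n ij H]]; exists i; split=> //; move: H; rewrite E.
  have jn' : (j <= n)%N by [].
  have [c cE cpos] := Yf_position jn' j1.
  pose Z := W `|` (B `|` [set p | exists i, [/\ (i <= n)%N, i != n1, i != j &
    (slot l r false i @` X j i) p]]).
  have E X' : (forall i, i != j -> X' i = X j i) ->
      W `|` (B `|` children l r xpred0 X') = (slot l r false j @` X' j) `|` Z.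
    move=> EX; apply/seteqP; split=> p.
      case=> [?|[?|[i [i_n i1 H]]]]; [by right; left|by right; right; left|].
      have [ij|ij] := eqVneq i j; first by left; rewrite -ij.
      by right; right; right; exists i; split=> //; rewrite -EX.
    case=> [?|[?|[?|[i [i_n i1 ij H]]]]].
    - by right; right; exists j.
    - by left.
    - by right; left.
    - by right; right; exists i; split=> //; rewrite EX.
  rewrite (E (X j))//; last first.
  rewrite (E (X j.+1)); last first.
    by move=> i ij; rewrite /X ltnS leq_eqVlt (negbTE ij).
  have XE : X j j = branch c /\ X j.+1 j = Yf j by rewrite /X ltnn ltnSn /X0 cE.
  rewrite XE.1 XE.2.
  have hs := slot_homeomorphism l r false j.
  apply: (@displaces_sub _ (slot l r false j @` box)).
    move=> _ [[[x y] z] [/= /andP[x0 x1] /andP[y0 y1] /andP[z0 z1]] <-].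
    have jr : j%:R <= n%:R :> R by rewrite ler_nat.
    have jr0 : 0 <= j%:R :> R by [].
    rewrite /box /slot /= -/M doubleS_natr; split; last by apply/andP; split; lra.
      rewrite ltr_pdivlMr// ltr_pdivrMr// M_def.
      by apply/andP; split; nra.
    by apply/andP; split; lra.
  apply: displaces_setU; last by apply: displaces_image => //; case: cpos.
  apply/seteqP; split=> // p [H [q [/andP[x0 x1] /andP[y0 y1] /andP[z0 z1]] qE]].
  move: H; rewrite -qE => {p qE}.
  have qx := slot_Mx false j q; rewrite doubleS_natr in qx.
  have jr : j%:R <= n%:R :> R by rewrite ler_nat.
  have jr0 : 0 <= j%:R :> R by [].
  case=> [[a aE [yz _]]|[[e [[k [kn ok kx]] bE]]|[i [i_n i1 ij [q' Xq' qq']]]]].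
  - move=> /(congr1 (fun p : space3 R => p.1.1)) /= aE'.
    have xa : (slot l r false j q).1.1 = a by exact: esym aE'.
    by move: qx; rewrite xa M_def; case: aE => ->; lra.
  - move: kx; rewrite qx => /andP[k1 k2].
    (* The slot reaches only a quarter of a cell beyond its own. The neighbouring cells are flat at
       height 1/2, while the slot is strictly lower. *)
    have kj : k = j.*2.+1 \/ k = j.*2 \/ k = j.*2.+2.
      have h1 : k%:R < j.*2.+3%:R :> R by rewrite -!natr1 -mul2n natrM; lra.
      have h2 : j.*2%:R < k.+1%:R :> R.
        by move: k2; rewrite -natr1 -mul2n natrM; lra.
      by move: h1 h2; rewrite !ltr_nat; clear; lia.
    case: kj => [kE|kE].
      by move: ok; rewrite kE /= odd_double /= eqSS (inj_eq double_inj) (negbTE j1).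
    have ek : odd k = false by case: kE => ->; rewrite /= odd_double.
    have kn1 : k != n1.*2.+1 by apply: contraFneq ek => ->; rewrite /= odd_double.
    have kx : k%:R <= M * (slot l r false j q).1.1 <= k.+1%:R by rewrite qx k1.
    have rE := ramp0_const kn1 kx.
    have := band_flat w (cst 2^-1) (e (+) ((n1.*2 < k)%N && odd `|w|%N)) rE.
    rewrite addbK -bE /= => -[_]; lra.
  - have [c' cE' pos'] := Yf_position i_n i1.
    have [/andP[y0' y1'] _] : - 4^-1 <= q'.1.2 <= 5 / 4 /\ q'.2 <= 1.
      move: Xq'; rewrite /X; case: ifP => _ Xq'.
        have [_ _ Yr _] := pos'; have [? /andP[? ?] ? _] := Yr _ Xq'.
        by split=> //; apply/andP; split; lra.
      by apply: position_range pos' _; move: Xq'; rewrite /X0 cE'.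
    have := slot_Mx false i q'; rewrite qq' qx doubleS_natr.
    have [lt|gt|eq] := ltngtP i j; last by rewrite eq eqxx in ij.
      have : i.+1%:R <= j%:R :> R by rewrite ler_nat.
      by rewrite -natr1; lra.
    have : j.+1%:R <= i%:R :> R by rewrite ler_nat.
    by rewrite -natr1; lra.
have -> : children l r xpred0 Yf = children l r xpred0 (X n.+1).
  by apply/seteqP; split=> p [i [i_n i1 H]]; exists i; split=> //; move: H;
    rewrite /X ltnS i_n.
exact: step.
Qed.

End Arch.

(** * Flypes, and tilting the walls of an arch *)

Section ArchMoves.
Context {R : realType}.
Local Notation branch := (@branch R bits).
Variables (w : int) (l r : seq (plane_tree int)) (i0 : nat).
Let n1 := size l.
Let n := (size l + size r)%N.
Let mn := n.+1.*2.+1.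
Let M : R := mn%:R.
Hypothesis i0n : (i0 <= n.+1)%N.

Let M_gt0 : 0 < M.
Proof. by rewrite ltr0n. Qed.

Let doubleS_natr i : i.*2.+1%:R = 2 * i%:R + 1 :> R.
Proof. by rewrite -natr1 -mul2n natrM. Qed.

Let M_def : M = 2 * n%:R + 3.
Proof. by rewrite /M /mn doubleS_natr -natr1; lra. Qed.

Definition wall_width : R := (3 * M)^-1.
Let eps := wall_width.

(** The half twists go to the middle third of the flat cell [i0.*2]. The ramp is then constant
    within [eps], a third of a cell, of the ends of the band, where the squeezing takes place. *)
Definition ramp (x : R) := clamp (3 * (M * x) - (i0 * 6 + 1)%:R).

Definition profile (x : R) := Num.min 2^-1 (2 * (Num.min x (1 - x)) / eps).

(* The children that the half twists pass when they are moved to their new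
   place are turned over along with the core. *)
Definition rotated (i : nat) := odd `|w|%N && ((i0 <= i)%N (+) (n1 < i)%N).

(** Turning by this angle replaces [ramp0] by [ramp]. Between the old and the new place of the
    twists it is plus or minus [w] half turns, and outside of both ramps it is 0. *)
Let th x := pi * w%:~R * (ramp x - ramp0 l r x).

Let Meps : M * eps = 3^-1.
Proof. by rewrite /eps /wall_width invfM mulrCA mulfV ?gt_eqF// mulr1. Qed.

Let eps01 : 0 < eps < 2^-1.
Proof.
have := Meps; have : 0 <= n%:R :> R by [].
rewrite M_def => n0 E; apply/andP; split; nra.
Qed.

Lemma ramp_const k x : k != i0.*2 -> k%:R <= M * x <= k.+1%:R ->
  ramp x = (i0.*2 < k)%N%:R.
Proof.
move=> ki /andP[h1 h2]; rewrite /ramp natrD natrM; case: ltnP => kn /=.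
  apply: clamp1; have : i0.*2.+1%:R <= k%:R :> R by rewrite ler_nat.
  by rewrite doubleS_natr; lra.
apply: clamp0; have : k.+1%:R <= i0.*2%:R :> R by rewrite ler_nat ltn_neqAle ki.
by rewrite -mul2n natrM; lra.
Qed.

Lemma ramp_left x : x <= eps -> ramp x = 0.
Proof.
move=> xe; apply: clamp0; rewrite natrD natrM.
have : M * x <= 3^-1 by rewrite -Meps ler_wpM2l// ltW.
have : 0 <= i0%:R :> R by [].
lra.
Qed.

Lemma ramp_right x : 1 - eps <= x -> ramp x = 1.
Proof.
move=> xe; apply: clamp1; rewrite natrD natrM.
have : M * (1 - eps) <= M * x by rewrite ler_wpM2l// ltW.
have : i0%:R <= n.+1%:R :> R by rewrite ler_nat.
rewrite -natr1 mulrBr mulr1 Meps M_def; lra.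
Qed.

Lemma ramp0_left x : x <= eps -> ramp0 l r x = 0.
Proof.
move=> xe; apply: clamp0; rewrite -/M doubleS_natr.
have : M * x <= 3^-1 by rewrite -Meps ler_wpM2l// ltW.
have : 0 <= (size l)%:R :> R by [].
lra.
Qed.

Lemma ramp0_right x : 1 - eps <= x -> ramp0 l r x = 1.
Proof.
move=> xe; apply: clamp1; rewrite -/M doubleS_natr.
have : M * (1 - eps) <= M * x by rewrite ler_wpM2l// ltW.
have : (size l)%:R <= n%:R :> R by rewrite ler_nat leq_addr.
rewrite mulrBr mulr1 Meps M_def; lra.
Qed.

Lemma profile_mid x : eps / 4 <= x <= 1 - eps / 4 -> profile x = 2^-1.
Proof.
have /andP[e0 _] := eps01.
move=> /andP[h1 h2]; apply/min_idPl; rewrite ler_pdivlMr//.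
by rewrite minEle; case: ifP => _; lra.
Qed.

Lemma profile_left x : x <= eps / 4 -> profile x = 2 * x / eps.
Proof.
have /andP[e0 e1] := eps01.
move=> h; rewrite /profile; have -> : Num.min x (1 - x) = x by apply/min_idPl; lra.
by apply/min_idPr; rewrite ler_pdivrMr//; lra.
Qed.

Lemma profile_right x : 1 - eps / 4 <= x -> profile x = 2 * (1 - x) / eps.
Proof.
have /andP[e0 e1] := eps01.
move=> h; rewrite /profile; have -> : Num.min x (1 - x) = 1 - x by apply/min_idPr; lra.
by apply/min_idPr; rewrite ler_pdivrMr//; lra.
Qed.

Let in_band_left (x : R) : 0 <= x <= eps -> in_band l r x.
Proof.
move=> /andP[x0 x1]; exists 0%N; split=> //; rewrite -/M.
have : M * x <= M * eps by rewrite ler_wpM2l// ltW.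
have : 0 <= M * x by rewrite mulr_ge0// ltW.
by rewrite Meps => ? ?; apply/andP; split; lra.
Qed.

Let in_band_right (x : R) : 1 - eps <= x <= 1 -> in_band l r x.
Proof.
move=> /andP[x0 x1]; exists n.+1.*2; split=> //; first by rewrite odd_double.
have : M * x <= M by rewrite -[leRHS]mulr1 ler_wpM2l// ltW.
have : M * (1 - eps) <= M * x by rewrite ler_wpM2l// ltW.
rewrite mulrBr mulr1 Meps -/M -/mn => h1 h2.
apply/andP; split; last exact: h2.
have : n.+1.*2.+1%:R = M :> R by [].
by rewrite -natr1; lra.
Qed.

Lemma in_band_range (x : R) : in_band l r x -> 0 <= x <= 1.
Proof.
move=> [k [kn _]]; rewrite -/M => /andP[h1 h2].
have h3 : k.+1%:R <= M by rewrite ler_nat.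
have h4 : 0 <= k%:R :> R by [].
apply/andP; split; first by rewrite -(pmulr_rge0 _ M_gt0); lra.
rewrite -(ler_pM2l M_gt0); lra.
Qed.

Let move p := squeeze eps (spin th p).

Let band_flat' rr zz e (b : bool) (x : R) : rr x = b%:R ->
  band w rr zz e x = ((e (+) (b && odd `|w|%N))%:R, zz x).
Proof.
by move=> rb; have := band_flat w zz (e (+) (b && odd `|w|%N)) rb; rewrite addbK.
Qed.

(* The core sits at height 1/2 where it is not affected by the squeezing, and
   a band piece there is only rotated. *)
Let spin_band (e : bool) x :
  spin th (x, (band w (ramp0 l r) (cst 2^-1) e x).1, (band w (ramp0 l r) (cst 2^-1) e x).2)
  = (x, (band w ramp (cst 2^-1) e x).1, (band w ramp (cst 2^-1) e x).2).
Proof.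
have A (a : R) : 2^-1 + a - 2^-1 = a by lra.
have ee : (e%:R - 2^-1) * (e%:R - 2^-1) = 4^-1 :> R by case: e => /=; lra.
rewrite spin_in.
  rewrite /turn /band /cst /= !A.
  have -> : pi * w%:~R * ramp x = pi * w%:~R * ramp0 l r x + th x by rewrite /th; lra.
  by rewrite cosD sinD; congr (_, _, _); lra.
rewrite /radius2 /band /cst /= !A.
have := cos2Dsin2 (pi * w%:~R * ramp0 l r x); rewrite !expr2.
move: (cos _) (sin _) => c s cs.
have -> : (e%:R - 2^-1) * c * ((e%:R - 2^-1) * c) +
   4 * (2^-1 * (e%:R - 2^-1) * s * (2^-1 * (e%:R - 2^-1) * s)) =
   ((e%:R - 2^-1) * (e%:R - 2^-1)) * (c * c + s * s) by lra.
by rewrite ee cs; lra.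
Qed.

Let wall_move (a b : bool) (z : R) : 0 <= z <= 2^-1 ->
  let x := if a then 1 - eps * z / 2 else eps * z / 2 in
  move (a%:R, b%:R, z) = (x, b%:R, profile x).
Proof.
have /andP[e0 e1] := eps01.
move=> /andP[z0 z1] x; rewrite /move spin_out; last first.
  left; rewrite /th; case: (a) => /=.
    by rewrite ramp_right ?ramp0_right ?subrr ?mulr0//; lra.
  by rewrite ramp_left ?ramp0_left ?subrr ?mulr0//; lra.
have b01 : 0 <= (b%:R : R) <= 1 by case: (b) => /=; rewrite ?lexx ler01.
have ez : 0 <= eps * z / 2 <= eps / 4 by apply/andP; split; nra.
move: ez => /andP[ez0 ez1].
rewrite /x; case: (a) => /=.
  rewrite squeeze_right//=; try by apply/andP; split; lra.
  rewrite profile_right; last by lra.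
  have -> : 2 * (1 - (1 - eps * z / 2)) = z * eps by lra.
  by rewrite mulfK ?gt_eqF//; congr (_, _, _); lra.
rewrite squeeze_left//=; try by apply/andP; split; lra.
rewrite profile_left; last by lra.
have -> : 2 * (eps * z / 2) = z * eps by lra.
by rewrite mulfK ?gt_eqF//; congr (_, _, _); lra.
Qed.

Let left_move (e : bool) (x : R) : 0 <= x <= eps ->
  let x' := x + (eps - x) / 4 in move (x, e%:R, 2^-1) = (x', e%:R, profile x').
Proof.
have /andP[e0 e1] := eps01.
move=> /andP[x0 x1] x'; rewrite /move spin_out; last first.
  by left; rewrite /th ramp_left ?ramp0_left ?subrr ?mulr0//; lra.
have b01 : 0 <= (e%:R : R) <= 1 by case: (e) => /=; rewrite ?lexx ler01.
rewrite squeeze_left//=; try by apply/andP; split; lra.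
rewrite profile_mid; last by rewrite /x'; apply/andP; split; lra.
by rewrite /x'; congr (_, _, _); lra.
Qed.

Let right_move (e : bool) (x : R) : 1 - eps <= x <= 1 ->
  let x' := x - (eps - (1 - x)) / 4 in move (x, e%:R, 2^-1) = (x', e%:R, profile x').
Proof.
have /andP[e0 e1] := eps01.
move=> /andP[x0 x1] x'; rewrite /move spin_out; last first.
  by left; rewrite /th ramp_right ?ramp0_right ?subrr ?mulr0//; lra.
have b01 : 0 <= (e%:R : R) <= 1 by case: (e) => /=; rewrite ?lexx ler01.
rewrite squeeze_right//=; try by apply/andP; split; lra.
rewrite profile_mid; last by rewrite /x'; apply/andP; split; lra.
by rewrite /x'; congr (_, _, _); lra.
Qed.

Let band_profile e x : eps / 4 <= x <= 1 - eps / 4 ->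
  band w ramp (cst 2^-1) e x = band w ramp profile e x.
Proof. by move=> h; rewrite /band profile_mid. Qed.

(** Near each end the foot of the wall stays, its top moves to distance [eps / 4], and the strip of
    width [eps] above is compressed onto the remaining three quarters; this is the graph of
    [profile]. In the middle only the rotation acts. *)
Lemma move_band :
  move @` (walls bits `|` band_set w l r (ramp0 l r) (cst 2^-1)) =
  band_set w l r ramp profile.
Proof.
have /andP[e0 e1] := eps01.
have mem0 (e : bool) (x : R) : in_band l r x -> ramp x = 0 ->
    band_set w l r ramp profile (x, e%:R, profile x).
  by move=> ix rx; exists e; split=> //=; rewrite (@band_flat' _ _ _ false)// addbF.
have mem1 (e : bool) (x : R) : in_band l r x -> ramp x = 1 ->
    band_set w l r ramp profile (x, e%:R, profile x).
  move=> ix rx; exists (e (+) odd `|w|%N); split=> //=.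
  by rewrite (@band_flat' _ _ _ true)// addbK.
apply/seteqP; split.
  move=> _ [p [[a aE [[b z] [/= bE z01] <-]]|[e [ix pE]]] <-].
    move: z01; rewrite in_itv/= => z01.
    move: aE bE => /bitsP[a' ->] /bitsP[b' ->].
    have /= -> := wall_move a' b' z01.
    move: z01 => /andP[z0 z1].
    have [ez0 ez1] : 0 <= eps * z / 2 /\ eps * z / 2 <= eps / 4 by split; nra.
    case: a' => /=.
      apply: mem1; first by apply: in_band_right; apply/andP; split; lra.
      by apply: ramp_right; lra.
    apply: mem0; first by apply: in_band_left; apply/andP; split; lra.
    by apply: ramp_left; lra.
  have {pE} -> : p = (p.1.1, (band w (ramp0 l r) (cst 2^-1) e p.1.1).1,
      (band w (ramp0 l r) (cst 2^-1) e p.1.1).2).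
    by rewrite -pE; case: (p) => -[].
  move: (p.1.1) ix => x ix; have /andP[x0 x1] := in_band_range ix.
  have [xe|xe] := leP x eps.
    rewrite (@band_flat' _ _ _ false) ?ramp0_left// addbF.
    have /= -> := left_move e (introT andP (conj x0 xe)).
    by apply: mem0; [apply: in_band_left; apply/andP; split; lra|apply: ramp_left; lra].
  have [xe'|xe'] := leP (1 - eps) x.
    rewrite (@band_flat' _ _ _ true) ?ramp0_right//=.
    have /= -> := right_move (e (+) odd `|w|%N) (introT andP (conj xe' x1)).
    by apply: mem1; [apply: in_band_right; apply/andP; split; lra|apply: ramp_right; lra].
  rewrite /move spin_band squeeze_mid//=; last by apply/andP; split; lra.
  have h : eps / 4 <= x <= 1 - eps / 4 by apply/andP; split; lra.
  by exists e; split=> //; exact: (band_profile e h).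
move=> p [e [ix pE]].
have {pE} -> : p = (p.1.1, (band w ramp profile e p.1.1).1, (band w ramp profile e p.1.1).2).
  by rewrite -pE; case: (p) => -[].
move: (p.1.1) ix => x ix; have /andP[x0 x1] := in_band_range ix.
have flat0 (e' : bool) (y : R) : 0 <= y <= eps ->
    band_set w l r (ramp0 l r) (cst 2^-1) (y, e'%:R, 2^-1).
  move=> /[dup] y0 /andP[_ ye]; exists e'; split; first exact: in_band_left.
  by rewrite (@band_flat' _ _ _ false) ?ramp0_left//= addbF.
have flat1 (e' : bool) (y : R) : 1 - eps <= y <= 1 ->
    band_set w l r (ramp0 l r) (cst 2^-1) (y, e'%:R, 2^-1).
  move=> /[dup] y0 /andP[ye _]; exists (e' (+) odd `|w|%N); split; first exact: in_band_right.
  by rewrite (@band_flat' _ _ _ true) ?ramp0_right//= addbK.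
have wall (a b : bool) (z : R) : 0 <= z <= 2^-1 -> (walls bits : set (space3 R)) (a%:R, b%:R, z).
  move=> z01; exists a%:R; first by apply/bitsP; exists a.
  by exists (b%:R, z) => //; split=> /=; [apply/bitsP; exists b|rewrite in_itv].
have [xe|xe] := leP x (eps / 4).
  rewrite (@band_flat' _ _ _ false) ?ramp_left//=; try lra.
  have z01 : 0 <= 2 * x / eps <= 2^-1.
    by rewrite ler_pdivrMr// divr_ge0//=; lra.
  exists (false%:R, (e (+) false)%:R, 2 * x / eps); first by left; exact: wall.
  have /= -> := wall_move false (e (+) false) z01.
  suff -> : eps * (2 * x / eps) / 2 = x by [].
  by rewrite mulrCA mulfV ?gt_eqF//; lra.
have [xe2|xe2] := leP x eps.
  rewrite (@band_flat' _ _ _ false) ?ramp_left//=.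
  have x'01 : 0 <= (4 * x - eps) / 3 <= eps by apply/andP; split; lra.
  exists ((4 * x - eps) / 3, (e (+) false)%:R, 2^-1); first by right; exact: flat0.
  have /= -> := left_move (e (+) false) x'01.
  by suff -> : (4 * x - eps) / 3 + (eps - (4 * x - eps) / 3) / 4 = x by []; lra.
have [xe3|xe3] := leP (1 - eps / 4) x.
  rewrite (@band_flat' _ _ _ true) ?ramp_right//=; try lra.
  have z01 : 0 <= 2 * (1 - x) / eps <= 2^-1.
    by rewrite ler_pdivrMr// divr_ge0//=; lra.
  exists (true%:R, (e (+) odd `|w|%N)%:R, 2 * (1 - x) / eps); first by left; exact: wall.
  have /= -> := wall_move true (e (+) odd `|w|%N) z01.
  suff -> : 1 - eps * (2 * (1 - x) / eps) / 2 = x by [].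
  by rewrite mulrCA mulfV ?gt_eqF//; lra.
have [xe4|xe4] := leP (1 - eps) x.
  rewrite (@band_flat' _ _ _ true) ?ramp_right//=.
  have x'01 : 1 - eps <= (4 * x - 1 + eps) / 3 <= 1 by apply/andP; split; lra.
  exists ((4 * x - 1 + eps) / 3, (e (+) odd `|w|%N)%:R, 2^-1); first by right; exact: flat1.
  have /= -> := right_move (e (+) odd `|w|%N) x'01.
  by suff -> : (4 * x - 1 + eps) / 3 - (eps - (1 - (4 * x - 1 + eps) / 3)) / 4 = x by []; lra.
exists (x, (band w (ramp0 l r) (cst 2^-1) e x).1, (band w (ramp0 l r) (cst 2^-1) e x).2).
  by right; exists e; split=> //; case: (band w _ (cst _) e x).
rewrite /move spin_band squeeze_mid//=; last by apply/andP; split; lra.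
by rewrite profile_mid//; apply/andP; split; lra.
Qed.

(** Both ramps are constant on the cell of a child, so the flype moves it rigidly by a whole number
    of half turns; the cell is also too far from the ends to be squeezed. *)
Lemma move_child i p : (i <= n)%N -> i != n1 ->
  0 <= p.1.1 <= 1 -> 0 <= p.1.2 <= 1 -> 0 <= p.2 <= 1 ->
  move (slot l r false i p) = slot l r (rotated i) i p.
Proof.
move=> i_n i1 /andP[x0 x1] /andP[y0 y1] /andP[z0 z1].
set q := slot l r false i p.
have qx : M * q.1.1 = i.*2.+1%:R + p.1.2 by rewrite /q /slot /= mulrC divfK// gt_eqF.
have kq : i.*2.+1%:R <= M * q.1.1 <= i.*2.+2%:R.
  by rewrite qx -[i.*2.+2%:R]natr1; apply/andP; split; lra.
have r1 : ramp q.1.1 = (i0 <= i)%N%:R.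
  rewrite (ramp_const _ kq) ?ltnS ?leq_double//.
  by apply/negP => /eqP/(congr1 odd); rewrite /= !odd_double.
have r0 : ramp0 l r q.1.1 = (n1 < i)%N%:R.
  rewrite (ramp0_const _ kq) ?ltnS ?leq_double.
    by rewrite [in RHS]ltn_neqAle eq_sym i1.
  by rewrite eqSS (inj_eq double_inj).
have qrad : radius2 q <= 2^-1.
  have sq (u k : R) : - k <= u <= k -> u * u <= k * k.
    by move=> /andP[? ?]; nra.
  rewrite /radius2 /q /slot /=.
  have := sq (p.1.1 - 2^-1) 2^-1 _; have := sq (2^-1 - p.2 / 4 - 2^-1) 4^-1 _.
  move=> /(_ ltac:(apply/andP; split; lra)) h1 /(_ ltac:(apply/andP; split; lra)) h2.
  lra.
have [cth sth] : cos (th q.1.1) = (-1) ^+ rotated i /\ sin (th q.1.1) = 0.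
  rewrite /th r1 r0 /rotated; case: (i0 <= i)%N; case: (n1 < i)%N => /=.
  - by rewrite subrr mulr0 cos0 sin0 andbF.
  - by rewrite subr0 mulr1 cos_pi_int sin_pi_int andbT.
  - by rewrite sub0r mulrN1 cosN sinN cos_pi_int sin_pi_int oppr0 andbT.
  - by rewrite subrr mulr0 cos0 sin0 andbF.
rewrite /move spin_in// squeeze_mid//.
  rewrite /turn cth sth /q /slot /=.
  by case: (rotated i); rewrite /= ?expr0 ?expr1; congr (_, _, _); lra.
change (eps <= q.1.1 <= 1 - eps); have /andP[h1 h2] := kq.
have i0' : 0 <= i%:R :> R by [].
have i1' : i%:R <= n%:R :> R by rewrite ler_nat.
move: h1 h2; rewrite -[i.*2.+2%:R]natr1 doubleS_natr => h1 h2.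
apply/andP; split; rewrite -(ler_pM2l M_gt0) ?mulrBr ?mulr1 Meps; first lra.
by rewrite [X in X - _]M_def; lra.
Qed.

Lemma move_homeomorphism : homeomorphism move.
Proof.
apply: homeomorphism_comp; last exact: squeeze_homeomorphism.
apply: spin_homeomorphism; rewrite /th /ramp /ramp0 /clamp.
by cont.
Qed.

Lemma move_box p : ~ box p -> move p = p.
Proof.
have /andP[e0 e1] := eps01.
move=> bp; rewrite /move spin_box//; first exact: squeeze_box.
move=> x [x0|x1]; rewrite /th.
  by rewrite ramp_left ?ramp0_left ?subrr ?mulr0//; lra.
by rewrite ramp_right ?ramp0_right ?subrr ?mulr0//; lra.
Qed.

Lemma arch_displace (Yf : nat -> set (space3 R)) :
  (forall i c, (i <= n)%N -> nth None (pieces l r) i = Some c -> position c (Yf i)) ->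
  displaces box (branch (Node w l r))
    (band_set w l r ramp profile `|` children l r rotated Yf).
Proof.
move=> HY; apply: displaces_trans (children_displace w HY) _.
exists move; split; [exact: move_homeomorphism|exact: move_box|].
rewrite setUA image_setU move_band; congr (_ `|` _).
have Yr i q : (i <= n)%N -> i != n1 -> Yf i q ->
    [/\ 0 <= q.1.1 <= 1, 0 <= q.1.2 <= 1 & 0 <= q.2 <= 1].
  move=> i_n i1 Yq; have [c cE _] := nth_pieces_child i_n i1.
  have [_ _ Yr _] := HY _ _ i_n cE; have [q1 q2 q3 q4] := Yr q Yq.
  split=> //; move: q1 q4 => /andP[? ?]; rewrite minEle => q4.
  by apply/andP; split=> //; move: q4; case: ifP; lra.
apply/seteqP; split=> [_ [_ [i [i_n i1 [q Yq <-]]] <-]|_ [i [i_n i1 [q Yq <-]]]].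
  have [? ? ?] := Yr i q i_n i1 Yq; rewrite move_child//.
  by exists i; split=> //; exists q.
have [? ? ?] := Yr i q i_n i1 Yq; rewrite -move_child//.
by exists (slot l r false i q) => //; exists i; split=> //; exists q.
Qed.

End ArchMoves.

(** * Cells of a band *)

Section Cells.
Context {R : realType}.
Local Notation branch := (@branch R bits).
Variables (w : int) (l r : seq (plane_tree int)) (i0 : nat).
Variable Yf : nat -> set (space3 R).
Let n1 := size l.
Let n := (size l + size r)%N.
Let mn := n.+1.*2.+1.
Let M : R := mn%:R.
Let eps : R := wall_width l r.
Hypothesis i0n : (i0 <= n.+1)%N.
Hypothesis HY : forall i c, (i <= n)%N -> nth None (pieces l r) i = Some c ->
  position c (Yf i).

Let M_gt0 : 0 < M.
Proof. by rewrite ltr0n. Qed.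

Let Meps : M * eps = 3^-1.
Proof. by rewrite /eps /wall_width invfM mulrCA mulfV ?gt_eqF// mulr1. Qed.

Let M_ge3 : 3 <= M.
Proof. by rewrite ler_nat. Qed.

Let eps_gt0 : 0 < eps.
Proof. by rewrite -(pmulr_rgt0 _ M_gt0) Meps. Qed.

(* [M] times the position of the [j]-th cut: the band is cut at multiples of
   [1 / M], and at distance [eps] from its ends. *)
Definition cut (j : nat) : R :=
  if j == 0%N then 0 else if (mn < j.-1)%N then M
  else Num.max 3^-1 (Num.min (M - 3^-1) j.-1%:R).

Definition bp j : R := cut j / M.

Definition cut_pt j (b : bool) : space3 R := (bp j, b%:R, profile l r (bp j)).

(** The first and the last cell of the arch are each cut in two, so that a flat hub finds room
    beside the half twists. This shifts the numbering: child [i] occupies cell [i.*2.+2]. *)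
Definition is_child j := [&& ~~ odd j, (0 < j)%N, (j < mn)%N & j./2.-1 != n1].

Definition band_cell j := if is_child j
  then slot l r (rotated w l i0 j./2.-1) j./2.-1 @` Yf j./2.-1
  else twist_cell w (ramp l r i0) (profile l r) (bp j) (bp j.+1).

Let N := mn.+2.

Let bpM j : M * bp j = cut j.
Proof. by rewrite /bp mulrC divfK// gt_eqF. Qed.

Lemma cut0 : cut 0 = 0. Proof. by []. Qed.

Lemma cutN : cut N = M.
Proof. by rewrite /cut /= ltnSn. Qed.

Lemma cut_mid k : (k <= mn)%N ->
  cut k.+1 = Num.max 3^-1 (Num.min (M - 3^-1) k%:R).
Proof. by move=> kn; rewrite /cut /= ltnNge kn. Qed.

Lemma cut_bound k : (k < mn)%N ->
  [/\ k%:R <= cut k.+1, cut k.+1 <= k%:R + 3^-1,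
      k%:R + 1 - 3^-1 <= cut k.+2 & cut k.+2 <= k%:R + 1].
Proof.
move=> kn; rewrite !cut_mid// ?(ltnW kn)// -[k.+1%:R]natr1.
have kM : k%:R + 1 <= M by rewrite natr1 ler_nat.
have k0 : 0 <= k%:R :> R by [].
rewrite !minEle; do !case: ifP => ?; rewrite !maxEle; do !case: ifP => ?;
by split; lra.
Qed.

Lemma cut_natr k : (0 < k)%N -> (k < mn)%N -> cut k.+1 = k%:R.
Proof.
move=> k0 kn; rewrite cut_mid ?(ltnW kn)//.
have kM : k.+1%:R <= M by rewrite ler_nat.
have k1 : 1 <= k%:R :> R by rewrite ler1n.
move: kM; rewrite -[k.+1%:R]natr1 => kM.
have -> : Num.min (M - 3^-1) k%:R = k%:R by apply/min_idPr; lra.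
by apply/max_idPr; lra.
Qed.

Lemma cut_lt j : (j < N)%N -> cut j < cut j.+1.
Proof.
case: j => [_|k]; first by rewrite cut0 cut_mid// lt_max invr_gt0 ltr0n.
rewrite !ltnS leq_eqVlt => /orP[/eqP ->|kn].
  rewrite cutN cut_mid// -/M.
  have := M_ge3; generalize M => m m3.
  have -> : Num.min (m - 3^-1) m = m - 3^-1 by apply/min_idPl; lra.
  by rewrite maxEle; case: ifP => ?; lra.
by have [h1 h2 h3 h4] := cut_bound kn; lra.
Qed.

Lemma bp_lt j : (j < N)%N -> bp j < bp j.+1.
Proof. by move=> /cut_lt; rewrite /bp ltr_pM2r// invr_gt0. Qed.

Let bp_le j x : (M * x <= cut j) = (x <= bp j).
Proof. by rewrite -bpM ler_pM2l. Qed.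

Let bp_ge j x : (cut j <= M * x) = (bp j <= x).
Proof. by rewrite -bpM ler_pM2l. Qed.

Let cut_in k : (k <= mn)%N -> 3^-1 <= cut k.+1 <= M - 3^-1.
Proof.
move=> kn; rewrite cut_mid// le_max lexx /= ge_max ge_min lexx /= andbT.
by have := M_ge3; generalize M => m m3; lra.
Qed.

Lemma bp0 : bp 0 = 0.
Proof. by rewrite /bp cut0 mul0r. Qed.

Lemma bpN : bp N = 1.
Proof. by rewrite /bp cutN mulfV// gt_eqF. Qed.

Lemma bp_mid j : (0 < j)%N -> (j < N)%N -> eps <= bp j <= 1 - eps.
Proof.
case: j => // k _; rewrite ltnS => /cut_in /andP[h1 h2].
by apply/andP; split; rewrite -(ler_pM2l M_gt0) bpM ?mulrBr ?mulr1 Meps.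
Qed.

(* The [k]-th of the [mn] original cells of the band. *)
Let in_cell k x : (k < mn)%N -> bp k.+1 <= x <= bp k.+2 -> k%:R <= M * x <= k.+1%:R.
Proof.
move=> kn; rewrite -bp_le -bp_ge -natr1 => /andP[h1 h2].
by have [h3 h4 h5 h6] := cut_bound kn; apply/andP; split; lra.
Qed.

Lemma ramp_cell j x : (j < N)%N -> j != i0.*2.+1 -> bp j <= x <= bp j.+1 ->
  exists b : bool, ramp l r i0 x = b%:R /\
    (forall y, bp j <= y <= bp j.+1 -> ramp l r i0 y = b%:R).
Proof.
case: j => [_ _|k].
  rewrite bp0 => /andP[_ xe].
  have H y : y <= bp 1 -> ramp l r i0 y = 0.
    move=> ye; apply: ramp_left => //; apply: le_trans ye _.
    rewrite -(ler_pM2l M_gt0) bpM -/eps Meps cut_mid//=.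
    by rewrite ge_max lexx ge_min; apply/orP; right; rewrite invr_ge0 ler0n.
  by exists false; split=> [|y /andP[_ ?]]; exact: H.
rewrite ltnS eqSS leq_eqVlt => /orP[/eqP[->] _|kn ki].
  move=> /andP[xe _].
  have H y : bp mn.+1 <= y -> ramp l r i0 y = 1.
    move=> ye; apply: ramp_right => //; apply: le_trans _ ye.
    rewrite -(ler_pM2l M_gt0) bpM -/eps mulrBr mulr1 Meps cut_mid// -/M.
    by rewrite minEle ifT ?le_max ?lexx ?orbT// gerBl invr_ge0 ler0n.
  by exists true; split=> [|y /andP[? _]]; exact: H.
move=> xk; exists (i0.*2 < k)%N.
have H y : bp k.+1 <= y <= bp k.+2 -> ramp l r i0 y = (i0.*2 < k)%N%:R.
  by move=> yk; apply: (ramp_const ki); exact: in_cell.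
by split=> //; exact: H.
Qed.

Lemma ramp_start : ramp l r i0 (bp i0.*2.+1) = 0.
Proof.
have kn : (i0.*2 < mn)%N by rewrite /mn ltnS leq_double.
have [h1 h2 h3 h4] := cut_bound kn.
apply: clamp0; rewrite -/M bpM natrD natrM.
by move: h2; rewrite -mul2n natrM; lra.
Qed.

Lemma ramp_stop : ramp l r i0 (bp i0.*2.+2) = 1.
Proof.
have kn : (i0.*2 < mn)%N by rewrite /mn ltnS leq_double.
have [h1 h2 h3 h4] := cut_bound kn.
apply: clamp1; rewrite -/M bpM natrD natrM.
by move: h3; rewrite -mul2n natrM; lra.
Qed.

Lemma ramp_bp j : (j <= N)%N -> exists b : bool, ramp l r i0 (bp j) = b%:R.
Proof.
rewrite leq_eqVlt => /orP[/eqP->|jN].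
  exists true; apply: ramp_right => //; rewrite bpN.
  by rewrite gerBl -/eps ltW.
have [->|ji] := eqVneq j i0.*2.+1; first by exists false; exact: ramp_start.
have [|b [? _]] := @ramp_cell j (bp j) jN ji; last by exists b.
by rewrite lexx ltW// bp_lt.
Qed.

Lemma profile_cut j : (0 < j)%N -> (j < N)%N -> profile l r (bp j) = 2^-1.
Proof.
move=> j0 jN; have /andP[h1 h2] := bp_mid j0 jN.
apply: profile_mid => //; move: h1 h2 eps_gt0; rewrite /eps.
by generalize (wall_width l r : R) => e h1 h2 e0; apply/andP; split; lra.
Qed.

Lemma profile0 : profile l r 0 = 0 :> R.
Proof.
rewrite profile_left ?mulr0 ?mul0r//.
by rewrite divr_ge0// ltW.
Qed.

Lemma profile1 : profile l r 1 = 0 :> R.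
Proof.
rewrite profile_right ?subrr ?mulr0 ?mul0r//.
by rewrite gerBl divr_ge0// ltW.
Qed.

Lemma pt0 b : cut_pt 0 b = corner false b.
Proof. by rewrite /cut_pt bp0 profile0. Qed.

Lemma ptN b : cut_pt N b = corner true b.
Proof. by rewrite /cut_pt bpN profile1. Qed.

Let band_flat' rr zz e (b : bool) (x : R) : rr x = b%:R ->
  band w rr zz e x = ((e (+) (b && odd `|w|%N))%:R, zz x).
Proof.
by move=> rb; have := band_flat w zz (e (+) (b && odd `|w|%N)) rb; rewrite addbK.
Qed.

Lemma child_index j : is_child j ->
  [/\ j = (j./2.-1).*2.+2, (j./2.-1 <= n)%N & j./2.-1 != n1].
Proof.
move=> /and4P[ej j0 jm ->]; split=> //.
  by move: ej j0; clear; lia.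
by move: ej j0 jm; rewrite /mn; clear; lia.
Qed.

Lemma is_child_index i : (i <= n)%N -> i != n1 -> is_child i.*2.+2.
Proof.
move=> i_n i1; rewrite /is_child /= odd_double /= doubleK i1 andbT.
by rewrite /mn; move: i_n; clear; lia.
Qed.

Lemma twist_cellP (a b : R) p : twist_cell w (ramp l r i0) (profile l r) a b p ->
  a <= p.1.1 <= b /\ exists e, (p.1.2, p.2) = band w (ramp l r i0) (profile l r) e p.1.1.
Proof. by case=> -[h E]; split=> //; [exists false|exists true]. Qed.

Lemma childP j p : is_child j -> band_cell j p -> exists q,
  [/\ Yf j./2.-1 q, p = slot l r (rotated w l i0 j./2.-1) j./2.-1 q,
      M * p.1.1 = (j./2.-1).*2.+1%:R + q.1.2 &
      q.1.1 = 0 \/ q.1.1 = 1 -> exists a b, q = corner a b] /\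
  [/\ 0 <= q.1.1 <= 1, 0 <= q.1.2 <= 1 & 0 <= q.2 <= 1].
Proof.
move=> /[dup] ch; rewrite /band_cell => -> [q Yq <-]; exists q.
have [_ i_n i1] := child_index ch.
have [c cE _] := nth_pieces_child i_n i1.
have [_ _ Yr Yc] := HY i_n cE; have [q1 q2 q3 q4] := Yr q Yq.
split; split=> //; last 1 first.
- move: q1 q4 => /andP[? ?]; rewrite minEle => q4.
  by apply/andP; split=> //; move: q4; case: ifP; lra.
- by rewrite /slot /= mulrC divfK// gt_eqF.
- exact: Yc.
Qed.

Lemma cell_closed j : (j < N)%N -> closed (band_cell j).
Proof.
move=> jN; rewrite /band_cell; case: ifP => ch.
  have [_ i_n i1] := child_index ch.
  have [c cE _] := nth_pieces_child i_n i1.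
  apply: homeomorphism_closed; first exact: slot_homeomorphism.
  by have [_ + _ _] := HY i_n cE.
have rc : continuous (ramp l r i0 : R -> R) by rewrite /ramp /clamp; cont.
have pc : continuous (profile l r : R -> R) by rewrite /profile; cont.
by apply: closedU; apply: strand_closed; rewrite /band; cont.
Qed.

Lemma cell_range j p : (j < N)%N -> band_cell j p -> bp j <= p.1.1 <= bp j.+1.
Proof.
move=> jN; have [ch|nch] := boolP (is_child j).
  move=> /(childP ch)[q [[_ _ px _] [_ /andP[y0 y1] _]]].
  have [jE i_n i1] := child_index ch.
  rewrite -bp_le -bp_ge px jE /= doubleK.
  rewrite [in cut _.*2.+3]cut_natr; last 2 first.
  - by [].
  - by rewrite /mn; move: i_n; clear; lia.
  rewrite cut_natr//; last by rewrite /mn; move: i_n; clear; lia.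
  by rewrite -[_.*2.+2%:R]natr1; apply/andP; split; lra.
by rewrite /band_cell (negbTE nch) => /twist_cellP[].
Qed.

Let flat_end j p : (j < N)%N -> ~~ is_child j -> band_cell j p ->
  forall k, (k <= N)%N -> p.1.1 = bp k -> exists b, p = cut_pt k b.
Proof.
move=> jN nch; rewrite /band_cell (negbTE nch) => /twist_cellP[_ [e pE]] k kN px.
have [b rb] := ramp_bp kN.
move: pE; rewrite px (band_flat' _ _ rb); case: p px => [[x y] z] /= -> [-> ->].
by exists (e (+) b && odd `|w|%N).
Qed.

Let child_end j p : (j < N)%N -> is_child j -> band_cell j p ->
  p.1.2 = 0 \/ p.1.2 = 1 -> exists b, p.1.2 = b%:R /\ p.2 = 2^-1.
Proof.
move=> jN ch /(childP ch)[q [[Yq -> _ Yc] _]] /= pE.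
have [a [b ->]] : exists a b, q = corner a b.
  by apply: Yc; move: pE; case: ifP => _ [] ?; [right|left|left|right]; lra.
exists (a (+) rotated w l i0 j./2.-1); case: rotated; rewrite /= ?mul0r ?addr0 ?subr0.
  by split=> //; case: (a) => /=; lra.
by rewrite addbF.
Qed.

(** By the last clause of [position], only the corners of a child lie over the sides of the parent's
    band, and in the slot they have height 1/2, like the cut points. *)
Lemma cell_adj j p q : (j.+1 < N)%N -> band_cell j p -> band_cell j.+1 q -> p.1 = q.1 ->
  p = q /\ exists b, p = cut_pt j.+1 b.
Proof.
move=> jN cp cq pq.
have jN' := ltnW jN.
have /andP[_ h1] := cell_range jN' cp; have /andP[h2 _] := cell_range jN cq.
move: h2; rewrite -pq => h2.
have px : p.1.1 = bp j.+1 by apply/eqP; rewrite eq_le h1.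
have qx : q.1.1 = bp j.+1 by rewrite -pq.
have two : p.2 = 2^-1 -> q.2 = 2^-1 -> p = q.
  by move: pq; case: (p) => [u z]; case: (q) => [u' z'] /= -> -> ->.
have ptE b : (cut_pt j.+1 b).2 = 2^-1 by rewrite /= profile_cut.
have [chp|nchp] := boolP (is_child j).
  have nchq : ~~ is_child j.+1 by move: chp => /and4P[oj _ _ _]; rewrite /is_child /= oj.
  have [b qE] := flat_end jN nchq cq jN' qx.
  have [|b' [_ p2]] := child_end jN' chp cp.
    by rewrite pq qE; case: (b); [right|left].
  by have E := two p2 (etrans (congr1 snd qE) (ptE b)); split=> //; exists b; rewrite E.
have [b pE] := flat_end jN' nchp cp jN' px.
have p2 : p.2 = 2^-1 by rewrite pE ptE.
split; last by exists b.
apply: two => //.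
have [chq|nchq] := boolP (is_child j.+1); last first.
  by have [b' qE] := flat_end jN nchq cq jN' qx; rewrite qE ptE.
have [|b' [_ //]] := child_end jN chq cq.
by rewrite -pq pE; case: (b); [right|left].
Qed.

Lemma chain_band : chain band_cell 0 N =
  band_set w l r (ramp l r i0) (profile l r) `|` children l r (rotated w l i0) Yf.
Proof.
apply/seteqP; split=> p.
  move=> [j [_ jN cp]]; have [ch|nch] := boolP (is_child j).
    right; move: cp; rewrite /band_cell ch => cp.
    by have [_ i_n i1] := child_index ch; exists j./2.-1.
  have /andP[h1 h2] := cell_range jN cp.
  move: (cp); rewrite /band_cell (negbTE nch) => /twist_cellP[_ [e pE]].
  left; exists e; split=> //.
  case: j jN nch h1 h2 {cp pE} => [_ _ h1 h2|k].
    exists 0%N; split=> //; rewrite -/M.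
    have := cut_mid (leq0n mn); have := bp_le 1 p.1.1; rewrite h2 => h3 c1.
    move: h1; rewrite bp0 => h1; rewrite mulr_ge0 ?(ltW M_gt0)//=.
    apply: le_trans h3 _; rewrite c1 ge_max ge_min ler01 orbT andbT.
    by rewrite invf_le1// ler1n.
  rewrite ltnS leq_eqVlt => /orP[/eqP[->] _ h1 h2|kn nch h1 h2].
    exists n.+1.*2; split=> //; first by rewrite odd_double.
    rewrite -/M; have := bp_ge mn.+1 p.1.1; rewrite h1 cut_mid// => h3.
    have h2' : M * p.1.1 <= M by rewrite -[leRHS]mulr1 ler_wpM2l ?(ltW M_gt0)// -bpN.
    apply/andP; split; last exact: h2'.
    have Mn : n.+1.*2%:R = M - 1 by rewrite /M /mn -natr1 addrK.
    rewrite Mn; apply: le_trans _ h3; rewrite le_max; apply/orP; right; rewrite le_min -/M.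
    by generalize M => m; apply/andP; split; lra.
  exists k; split=> //; last by apply: in_cell => //; apply/andP.
  case: (boolP (odd k)) => //= ok.
  have kn' : (k.+1 < mn)%N by move: kn ok; rewrite /mn; clear; lia.
  move: nch; rewrite /is_child /= ok kn' /= negbK => /eqP E.
  rewrite -[size l]/n1 -E; have -> : uphalf k = k./2.+1 by rewrite uphalf_half ok add1n.
  by rewrite /= -[eqbLHS](odd_double_half k) ok.
case=> [[e [[k [kn ok kx]] pE]]|[i [i_n i1 H]]]; last first.
  exists i.*2.+2; split=> //; first by rewrite /N /mn; move: i_n; clear; lia.
  by rewrite /band_cell is_child_index//= doubleK.
have [x1|x1] := ltP p.1.1 (bp 1).
  exists 0%N; split=> //; rewrite /band_cell /=.
  have h : bp 0 <= p.1.1 <= bp 1.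
    rewrite (ltW x1) andbT bp0 -(pmulr_rge0 _ M_gt0).
    by move: kx => /andP[kx _]; apply: le_trans kx.
  by case: e pE => pE; [right|left].
have [x2|x2] := ltP (bp mn.+1) p.1.1.
  exists mn.+1; split=> //; rewrite /band_cell /is_child /= ltnNge leqnSn andbF.
  have h : bp mn.+1 <= p.1.1 <= bp mn.+2.
    rewrite (ltW x2) bpN /= -(ler_pM2l M_gt0) mulr1.
    by move: kx => /andP[_ kx]; apply: le_trans kx _; rewrite ler_nat.
  by case: e pE => pE; [right|left].
exists k.+1; split=> //; first by rewrite /N !ltnS ltnW.
have nch : is_child k.+1 = false.
  rewrite /is_child /=; case: (boolP (odd k)) ok => //= ok /eqP ->.
  by rewrite /= doubleK eqxx !andbF.
rewrite /band_cell nch.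
have h : bp k.+1 <= p.1.1 <= bp k.+2.
  move: x1 x2; rewrite -!bp_le -!bp_ge => x1 x2.
  have /andP[u1 _] := cut_in (leq0n mn); have /andP[_ u2] := cut_in (leqnn mn).
  have {}u1 := le_trans u1 x1; have {}u2 := le_trans x2 u2.
  move: kx => /andP[k1 k2]; rewrite !cut_mid// ?(ltnW kn)//.
  by rewrite ge_max u1 ge_min k1 orbT /= le_max le_min u2 k2 orbT.
by case: e pE => pE; [right|left].
Qed.

Let eps_le : eps <= 9^-1.
Proof.
have := Meps; have := M_ge3; move: eps_gt0; generalize M eps => m e *.
nra.
Qed.

Let profile_ge (x : R) : 0 <= x <= 1 -> Num.min x (1 - x) <= 4 * profile l r x.
Proof.
move=> /andP[x0 x1]; rewrite /profile -/eps.
have m0 : 0 <= Num.min x (1 - x) by rewrite le_min x0 subr_ge0.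
have m1 : Num.min x (1 - x) <= 2^-1 by rewrite minEle; case: ifP => ?; lra.
move: m0 m1; generalize (Num.min x (1 - x)) => m m0 m1.
rewrite [Num.min 2^-1 _]minEle; case: ifP => _; first by lra.
rewrite mulrA ler_pdivlMr//.
by have := eps_le; move: eps_gt0; generalize eps => e *; nra.
Qed.

Let profile_range (x : R) : 0 <= x <= 1 -> 0 <= profile l r x <= 2^-1.
Proof.
move=> /[dup] /profile_ge h /andP[x0 x1]; rewrite [_ <= 2^-1]ge_min lexx andbT.
move: h; rewrite minEle; case: ifP => ?; lra.
Qed.

Let unit_cell j p : (j < N)%N -> band_cell j p -> 0 <= p.1.1 <= 1.
Proof.
move=> jN /(cell_range jN) /andP[h1 h2]; rewrite -bp0 -bpN; apply/andP; split.
  apply: le_trans h1; apply: (leif_le (bp_mono bp_lt _ _)) => //; exact: ltnW.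
by apply: le_trans h2 _; apply: (leif_le (bp_mono bp_lt _ _)).
Qed.

Let inner_cell j p : (0 < j)%N -> (j.+1 < N)%N -> band_cell j p -> eps <= p.1.1 <= 1 - eps.
Proof.
move=> j0 jN /(cell_range (ltnW jN)) /andP[h1 h2].
have /andP[h3 _] := bp_mid j0 (ltnW jN); have /andP[_ h4] := bp_mid (ltn0Sn j) jN.
by rewrite (le_trans h3 h1) (le_trans h2 h4).
Qed.

(** The lower bound on heights reproduces itself: children end up at height at least 1/4, and the
    band twists only where its core has height 1/2, so it stays above 1/4 there; elsewhere it
    follows [profile]. *)
Lemma cell_position : position (Node w l r) (chain band_cell 0 N).
Proof.
split.
- by rewrite chain_band; exact: arch_displace.
- by apply: (chain_closed (N := N)) => // k; exact: cell_closed.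
- move=> p [j [_ jN cp]]; have /andP[x0 x1] := unit_cell jN cp.
  have m1 : Num.min p.1.1 (1 - p.1.1) <= 2^-1 by rewrite minEle; case: ifP => ?; lra.
  have [ch|nch] := boolP (is_child j).
    move: cp => /(childP ch)[q [[_ pE _ _] [/andP[a0 a1] /andP[b0 b1] /andP[c0 c1]]]].
    have py : 0 <= p.1.2 <= 1.
      by rewrite pE /=; case: ifP => _; apply/andP; split; lra.
    have [z0 z1] : 4^-1 <= p.2 /\ p.2 <= 1 by rewrite pE /=; case: ifP => _; split; lra.
    by split=> //; [apply/andP|apply: le_trans m1 _; lra].
  move: cp; rewrite /band_cell (negbTE nch) => /twist_cellP[xj [e [-> ->]]] /=.
  have x01 : 0 <= p.1.1 <= 1 by apply/andP.
  have [e1 e2] : - (2^-1 : R) <= e%:R - 2^-1 /\ e%:R - 2^-1 <= 2^-1 :> R.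
    by case: (e) => /=; split; lra.
  have := profile_ge x01; have /andP[z0 z1] := profile_range x01.
  have := cos_le1 (pi * w%:~R * ramp l r i0 p.1.1).
  have := cos_geN1 (pi * w%:~R * ramp l r i0 p.1.1).
  have := sin_le1 (pi * w%:~R * ramp l r i0 p.1.1).
  have := sin_geN1 (pi * w%:~R * ramp l r i0 p.1.1).
  have : sin (pi * w%:~R * ramp l r i0 p.1.1) = 0 \/ profile l r p.1.1 = 2^-1.
    have [jE|jE] := eqVneq j i0.*2.+1.
      right; apply: profile_mid.
      have j1 : (j.+1 < N)%N by rewrite jE /N /mn; move: i0n; clear; lia.
      have j0 : (0 < j)%N by rewrite jE.
      have /andP[_ h1] := bp_mid (ltn0Sn j) j1; have /andP[h2 _] := bp_mid j0 jN.
      move: xj eps_gt0 h1 h2 => /andP[]; rewrite /eps.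
      by generalize (wall_width l r : R) => ee *; apply/andP; split; lra.
    have [b [-> _]] := ramp_cell jN jE xj; left.
    by case: b; rewrite ?mulr1 ?mulr0 ?sin_pi_int ?sin0.
  move: e1 e2 m1 z0 z1.
  move: (e%:R - 2^-1) (cos _) (sin _) (Num.min _ _) (profile _ _ _) => a c s m z.
  move=> a0 a1 m1 z0 z1 sz s0 s1 c0 c1 mz.
  have [u0 u1] : - 2^-1 <= a * c /\ a * c <= 2^-1 by split; nra.
  have [v0 v1] : - 2^-1 <= a * s /\ a * s <= 2^-1 by split; nra.
  split=> //; first by apply/andP; split; lra.
    by lra.
  by case: sz => [s_0|->]; [rewrite s_0 mulr0|]; lra.
move=> p [j [_ jN cp]] pE.
have [k kN px] : exists2 k, (k <= N)%N & p.1.1 = bp k.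
  by case: pE => ->; [exists 0%N; rewrite ?bp0|exists N; rewrite ?bpN].
have [ch|nch] := boolP (is_child j).
  have [j0 jN1] : (0 < j)%N /\ (j.+1 < N)%N.
    by have [-> i_n _] := child_index ch; split=> //; rewrite /N /mn; move: i_n; clear; lia.
  have /andP[h1 h2] := inner_cell j0 jN1 cp.
  by exfalso; move: h1 h2 eps_gt0; generalize eps => ee h1 h2 h3; case: pE => pE; lra.
have [b E] := flat_end jN nch cp kN px.
rewrite E; move: E pE => ->; rewrite /=; case=> bk.
  by exists false, b; rewrite /cut_pt bk profile0.
by exists true, b; rewrite /cut_pt bk profile1.
Qed.

Section Plays.
Variable sg : bool.

Lemma flat_play j : (j < N)%N -> ~~ is_child j -> j != i0.*2.+1 ->
  (forall d b d', play sg (band_cell j) 0 (thruS cut_pt j j.+1 d b d')) /\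
  (forall d b, play sg (band_cell j) 1 (spreadS cut_pt j j.+1 d b)) /\
  (forall d b, play sg (band_cell j) 0 (collectS cut_pt j j.+1 d b)).
Proof.
move=> jN nch ji.
pose c (b : bool) (x : R) : R * R := (b%:R, profile l r x).
have cc b : continuous (c b) by rewrite /c /profile; cont.
have cE : band_cell j = strand (c false) (bp j) (bp j.+1) `|` strand (c true) (bp j) (bp j.+1).
  have [b [_ H]] := @ramp_cell j (bp j) jN ji ltac:(by rewrite lexx ltW// bp_lt).
  rewrite /band_cell (negbTE nch); apply/seteqP; split=> p.
    move=> /twist_cellP[xj [e pE]].
    move: pE; rewrite (band_flat' _ _ (H _ xj)).
    by case: (e (+) _) => pE; [right|left].
  have G e : strand (c e) (bp j) (bp j.+1) p ->
      twist_cell w (ramp l r i0) (profile l r) (bp j) (bp j.+1) p.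
    move=> [xj pE].
    have {}pE : (p.1.2, p.2) = band w (ramp l r i0) (profile l r) (e (+) (b && odd `|w|%N)) p.1.1.
      by rewrite (band_flat' _ _ (H _ xj)) addbK.
    by case: (e (+) _) pE => pE; [right|left].
  by case=> /G.
have disj p q : strand (c false) (bp j) (bp j.+1) p -> strand (c true) (bp j) (bp j.+1) q ->
    p.1 <> q.1.
  move=> [_ [p2 _]] [_ [q2 _]] pq; move: p2; rewrite pq q2 /= => /eqP.
  by rewrite oner_eq0.
have lt := bp_lt jN.
have enE d b : en cut_pt j j.+1 d b =
    let x := if d then bp j.+1 else bp j in (x, (c b x).1, (c b x).2).
  by case: d.
split; [|split].
- move=> d b d'; apply: (flat_thru (st := fun b => strand (c b) (bp j) (bp j.+1))) => //.
    by move=> b'; exact: strand_closed.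
  by move=> b' d''; rewrite !enE; exact: strand_monotone.
- move=> d b; apply: (flat_spread (st := fun b => strand (c b) (bp j) (bp j.+1))) => //.
  + by move=> b'; exact: strand_closed.
  + by move=> b' d''; rewrite !enE; exact: strand_monotone.
  + by move=> b' d''; rewrite !enE; exact: strand_ridge.
- move=> d b; apply: (flat_collect (st := fun b => strand (c b) (bp j) (bp j.+1))) => //.
  + by move=> b'; exact: strand_closed.
  + by move=> b' d''; rewrite !enE; exact: strand_monotone.
  + by move=> b' d''; rewrite !enE; exact: strand_valley.
Qed.

End Plays.

End Cells.

(** * Layouts of a band around its hubs *)

Section Segments.
Context {R : realType}.
Variables (sg : bool) (N : nat) (cell : nat -> set (space3 R)).
Variables (bp : nat -> R) (pt : nat -> bool -> space3 R).
Hypothesis cell_closed : forall k, (k < N)%N -> closed (cell k).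
Hypothesis cell_range : forall k p, (k < N)%N -> cell k p -> bp k <= p.1.1 <= bp k.+1.
Hypothesis bp_lt : forall k, (k < N)%N -> bp k < bp k.+1.
Hypothesis cell_adj : forall k p q, (k.+1 < N)%N -> cell k p -> cell k.+1 q ->
  p.1 = q.1 -> p = q /\ exists b, p = pt k.+1 b.
Variable c : nat -> nat.
Local Notation chain := (chain cell).

Section First.
Variables (j : nat) (b : bool).
Hypothesis jN : (j < N)%N.

Lemma first_spread :
  (forall k, (k < j)%N -> play sg (cell k) (c k) (thruS pt k k.+1 false b true)) ->
  play sg (cell j) (c j) (spreadS pt j j.+1 false b) ->
  play sg (chain 0 j.+1) (\sum_(0 <= k < j.+1) c k)%N (spreadS pt 0 j.+1 false b).
Proof.
case: j jN => [|i] iN Ht Hs; first by rewrite big_nat1 chain1.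
rewrite big_nat_recr//=.
apply: (spread_left cell_closed cell_range bp_lt cell_adj (j := i.+1)) => //.
  apply: (thru_chain cell_closed cell_range bp_lt cell_adj) => //; first exact: ltnW.
  by move=> k _; exact: Ht.
by rewrite chain1.
Qed.

Lemma first_collect :
  (forall k, (k < j)%N -> play sg (cell k) (c k) (thruS pt k k.+1 false (~~ b) true)) ->
  play sg (cell j) (c j) (collectS pt j j.+1 false b) ->
  play sg (chain 0 j.+1) (\sum_(0 <= k < j.+1) c k)%N (collectS pt 0 j.+1 false b).
Proof.
case: j jN => [|i] iN Ht Hs; first by rewrite big_nat1 chain1.
rewrite big_nat_recr//=.
apply: (collect_left cell_closed cell_range bp_lt cell_adj (j := i.+1)) => //.
  apply: (thru_chain cell_closed cell_range bp_lt cell_adj) => //; first exact: ltnW.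
  by move=> k _; exact: Ht.
by rewrite chain1.
Qed.

Lemma last_spread :
  (forall k, (j < k)%N -> (k < N)%N -> play sg (cell k) (c k) (thruS pt k k.+1 true b false)) ->
  play sg (cell j) (c j) (spreadS pt j j.+1 true b) ->
  play sg (chain j N) (\sum_(j <= k < N) c k)%N (spreadS pt j N true b).
Proof.
move=> Ht Hs; rewrite big_ltn//; move: jN; rewrite leq_eqVlt => /orP[/eqP jE|jN'].
  by rewrite -jE big_geq// addn0 chain1.
apply: (spread_right cell_closed cell_range bp_lt cell_adj (j := j.+1)) => //.
  by rewrite chain1.
exact: (thru_chain cell_closed cell_range bp_lt cell_adj).
Qed.

Lemma last_collect :
  (forall k, (j < k)%N -> (k < N)%N ->
     play sg (cell k) (c k) (thruS pt k k.+1 true (~~ b) false)) ->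
  play sg (cell j) (c j) (collectS pt j j.+1 true b) ->
  play sg (chain j N) (\sum_(j <= k < N) c k)%N (collectS pt j N true b).
Proof.
move=> Ht Hs; rewrite big_ltn//; move: jN; rewrite leq_eqVlt => /orP[/eqP jE|jN'].
  by rewrite -jE big_geq// addn0 chain1.
apply: (collect_right cell_closed cell_range bp_lt cell_adj (j := j.+1)) => //.
  by rewrite chain1.
exact: (thru_chain cell_closed cell_range bp_lt cell_adj).
Qed.

End First.

Inductive mode := Thru of bool & bool & bool | Pass of bool
  | Spread of bool & bool | Collect of bool & bool.

Definition scheduled m k := match m with
  | Thru d b d' => thruS pt k k.+1 d b d'
  | Pass d => passS pt k k.+1 d false false
  | Spread d b => spreadS pt k k.+1 d b
  | Collect d b => collectS pt k k.+1 d b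
  end.

(* The cells before [lo] form a first segment, with a hub in its last cell, and
   those from [hi] on a last one, with a hub in its first cell. *)
Definition layout lo hi (A H : mode) (d : bool) (H' A' : mode) k :=
  if (k.+1 < lo)%N then A else if k.+1 == lo then H
  else if (k < hi)%N then Pass d else if k == hi then H' else A'.

Section LayoutCases.
Variables (lo hi : nat) (A H : mode) (d : bool) (H' A' : mode) (k : nat).
Hypothesis lohi : (lo < hi)%N.
Local Notation L := (layout lo hi A H d H' A' k).

Lemma layout_thru : (k.+1 < lo)%N -> L = A.
Proof. by rewrite /layout => ->. Qed.

Lemma layout_hub : k.+1 = lo -> L = H.
Proof. by rewrite /layout => ->; rewrite ltnn eqxx. Qed.

Lemma layout_pass : (lo <= k)%N -> (k < hi)%N -> L = Pass d.
Proof.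
rewrite /layout => lk ->; case: ltnP => kl; first by move: lk kl; clear; lia.
by case: eqP => //; move: lk; clear; lia.
Qed.

Lemma layout_hub' : k = hi -> L = H'.
Proof.
move=> kE; rewrite /layout; case: ltnP => kl; first by move: lohi kE kl; clear; lia.
case: eqP => [|_]; first by move: lohi kE; clear; lia.
by rewrite kE ltnn eqxx.
Qed.

Lemma layout_thru' : (hi < k)%N -> L = A'.
Proof.
move=> hk; rewrite /layout; case: ltnP => kl; first by move: lohi hk kl; clear; lia.
case: eqP => [|_]; first by move: lohi hk; clear; lia.
case: ltnP => kh; first by move: hk kh; clear; lia.
by case: eqP => // kE; move: hk; rewrite kE ltnn.
Qed.

End LayoutCases.

Variables (lo hi : nat).
Hypothesis lohi : (lo < hi)%N.
Hypothesis hiN : (hi <= N)%N.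

Let total := (\sum_(0 <= k < N) c k)%N.
Let loN : (lo <= N)%N := leq_trans (ltnW lohi) hiN.

Let total_cat : total =
  (\sum_(0 <= k < lo) c k + \sum_(lo <= k < hi) c k + \sum_(hi <= k < N) c k)%N.
Proof.
rewrite /total (big_cat_nat (n := hi))// (big_cat_nat (n := lo) (p := hi))//.
exact: ltnW.
Qed.

Let plays (A H : mode) d (H' A' : mode) := forall k, (k < N)%N ->
  play sg (cell k) (c k) (scheduled (layout lo hi A H d H' A' k) k).

Let pass_mid A H d H' A' b b' : plays A H d H' A' ->
  play sg (chain lo hi) (\sum_(lo <= k < hi) c k)%N (passS pt lo hi d b b').
Proof.
move=> md; apply: (pass_chain cell_closed cell_range bp_lt cell_adj) => // k lk kh.
by have := md k (leq_trans kh hiN); rewrite layout_pass.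
Qed.

Let spread_lo d b H' A' : (0 < lo)%N ->
  plays (Thru false b true) (Spread false b) d H' A' ->
  play sg (chain 0 lo) (\sum_(0 <= k < lo) c k)%N (spreadS pt 0 lo false b).
Proof.
move=> l0 md; have [j loE] : exists j, lo = j.+1 by case: (lo) l0 => // j; exists j.
have jN : (j < N)%N by rewrite -loE.
rewrite loE; apply: first_spread => // [k kj|].
  by have := md k (ltn_trans kj jN); rewrite layout_thru ?loE.
by have := md j jN; rewrite layout_hub.
Qed.

Let collect_lo d b H' A' : (0 < lo)%N ->
  plays (Thru false (~~ b) true) (Collect false b) d H' A' ->
  play sg (chain 0 lo) (\sum_(0 <= k < lo) c k)%N (collectS pt 0 lo false b).
Proof.
move=> l0 md; have [j loE] : exists j, lo = j.+1 by case: (lo) l0 => // j; exists j.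
have jN : (j < N)%N by rewrite -loE.
rewrite loE; apply: first_collect => // [k kj|].
  by have := md k (ltn_trans kj jN); rewrite layout_thru ?loE.
by have := md j jN; rewrite layout_hub.
Qed.

Let spread_hi A H d b : (hi < N)%N ->
  plays A H d (Spread true b) (Thru true b false) ->
  play sg (chain hi N) (\sum_(hi <= k < N) c k)%N (spreadS pt hi N true b).
Proof.
move=> hN md; apply: last_spread => // [k hk kN|].
  by have := md k kN; rewrite layout_thru'.
by have := md hi hN; rewrite layout_hub'.
Qed.

Let collect_hi A H d b : (hi < N)%N ->
  plays A H d (Collect true b) (Thru true (~~ b) false) ->
  play sg (chain hi N) (\sum_(hi <= k < N) c k)%N (collectS pt hi N true b).
Proof.
move=> hN md; apply: last_collect => // [k hk kN|].
  by have := md k kN; rewrite layout_thru'.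
by have := md hi hN; rewrite layout_hub'.
Qed.

Lemma layout_open_left b H' A' : (0 < lo)%N -> hi = N ->
  plays (Thru false b true) (Spread false b) false H' A' ->
  play sg (chain 0 N) total (openS pt 0 N false b).
Proof.
move=> l0 hE md; rewrite total_cat [X in (_ + X)%N]big_geq ?hE// addn0.
have := pass_mid b b md; have := spread_lo l0 md; rewrite hE.
exact: (open_left cell_closed cell_range bp_lt cell_adj).
Qed.

Lemma layout_shut_left b H' A' : (0 < lo)%N -> hi = N ->
  plays (Thru false (~~ b) true) (Collect false b) true H' A' ->
  play sg (chain 0 N) total (shutS pt 0 N false b).
Proof.
move=> l0 hE md; rewrite total_cat [X in (_ + X)%N]big_geq ?hE// addn0.
have := pass_mid (~~ b) b md; have := collect_lo l0 md; rewrite hE.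
exact: (shut_left cell_closed cell_range bp_lt cell_adj).
Qed.

Lemma layout_open_right b A H : lo = 0%N -> (hi < N)%N ->
  plays A H true (Spread true b) (Thru true b false) ->
  play sg (chain 0 N) total (openS pt 0 N true b).
Proof.
move=> lE hN md; rewrite total_cat [X in (X + _ + _)%N]big_geq ?lE// add0n.
have := spread_hi hN md; have := pass_mid b b md; rewrite lE.
exact: (open_right cell_closed cell_range bp_lt cell_adj).
Qed.

Lemma layout_shut_right b A H : lo = 0%N -> (hi < N)%N ->
  plays A H false (Collect true b) (Thru true (~~ b) false) ->
  play sg (chain 0 N) total (shutS pt 0 N true b).
Proof.
move=> lE hN md; rewrite total_cat [X in (X + _ + _)%N]big_geq ?lE// add0n.
have := collect_hi hN md; have := pass_mid (~~ b) b md; rewrite lE.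
exact: (shut_right cell_closed cell_range bp_lt cell_adj).
Qed.

Lemma layout_closed_left b b' : (0 < lo)%N -> (hi < N)%N ->
  plays (Thru false b true) (Spread false b) false
        (Collect true (~~ b')) (Thru true (~~ ~~ b') false) ->
  play sg (chain 0 N) total (closedS pt 0 N false b b').
Proof.
move=> l0 hN md; rewrite total_cat.
have := collect_hi hN md; have := pass_mid b (~~ b') md; have := spread_lo l0 md.
by apply: (closed_left cell_closed cell_range bp_lt cell_adj) => //; exact: ltnW.
Qed.

Lemma layout_closed_right b b' : (0 < lo)%N -> (hi < N)%N ->
  plays (Thru false (~~ ~~ b') true) (Collect false (~~ b')) true
        (Spread true b) (Thru true b false) ->
  play sg (chain 0 N) total (closedS pt 0 N true b b').
Proof.
move=> l0 hN md; rewrite total_cat.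
have := spread_hi hN md; have := pass_mid b (~~ b') md; have := collect_lo l0 md.
by apply: (closed_right cell_closed cell_range bp_lt cell_adj) => //; exact: ltnW.
Qed.

End Segments.

(** * Upper bound *)

(* The number of paths in a smallest cover of the vertices by disjoint paths,
   and whether some such cover has a path ending at the root. *)
Fixpoint path_cover (A : Type) (T : plane_tree A) : nat * bool :=
  let: Node _ l r := T in
  let s := [seq path_cover c | c <- l] ++ [seq path_cover c | c <- r] in
  let S := sumn (unzip1 s) in
  match count snd s with
  | 0 => (S.+1, true)
  | 1 => (S, true)
  | _ => (S.-1, false)
  end.

Section Upper.
Context {R : realType}.

Definition corners (i : nat) (b : bool) : space3 R := corner (i == 1%N) b.

Lemma en_corners a b : en corners 0 1 a b = corner a b.
Proof. by case: a. Qed.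

Definition achieves (T : plane_tree int) sg k s :=
  exists2 Y : set (space3 R), position T Y & play sg Y k s.

(** Both signs occur since the parent may turn the branch over. The position is chosen after the
    schedule, because the place of the half twists depends on the hubs. The saving of one in [shutS]
    is what makes a collecting child profitable. *)
Definition efficient (T : plane_tree int) := forall sg : bool,
  let P := (path_cover T).1 in
  if (path_cover T).2 then
    (forall a b, [/\ achieves T sg P (openS corners 0 1 a b),
                    achieves T sg P.-1 (shutS corners 0 1 a b) &
                    achieves T sg P (halfS corners 0 1 a b)])
  else forall a b b', achieves T sg P (closedS corners 0 1 a b b').

Definition allowed (m : mode) (o : bool) :=
  match m with Thru _ _ _ => ~~ o | Pass _ => true | _ => o end.

Definition child_cost (m : mode) (P : nat) :=
  if m is Collect _ _ then P.-1 else P.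

Definition flat_cost (m : mode) : nat := if m is Spread _ _ then 1%N else 0%N.

Section NodeCells.
Variables (w : int) (l r : seq (plane_tree int)) (i0 : nat).
Let n1 := size l.
Let n := (size l + size r)%N.
Let mn := n.+1.*2.+1.
Let N := mn.+2.
Hypothesis i0n : (i0 <= n.+1)%N.
Local Notation pt := (@cut_pt R l r).

Lemma slot_corner rot i a b : (i <= n)%N ->
  slot l r rot i (corner a b) = en pt i.*2.+2 i.*2.+3 b (a (+) rot).
Proof.
move=> i_n; have h1 : (i.*2.+2 < mn)%N by rewrite /mn; move: i_n; clear; lia.
have E (e : bool) : (i.*2.+1%:R + e%:R) / mn%:R = bp l r (if e then i.*2.+3 else i.*2.+2) :> R.
  rewrite /bp; case: e; rewrite cut_natr ?(ltnW h1)//.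
    by rewrite natr1.
  by rewrite addr0.
rewrite /slot /en /cut_pt /= E profile_cut; last 2 first.
- by case: (b).
- by case: (b); rewrite /= ?ltnS ?(ltnW h1)// ltnW// ltnW.
rewrite mul0r addr0 subr0; case: b; case: rot; case: a => //=; rewrite ?subr0 ?subrr//.
Qed.

(** An upright slot reverses the vertical axis, as plumbing does, and a turned one restores it,
    whence the sign [~~ rot]. *)
Lemma child_play sg rot i k s (Y : set (space3 R)) : play (sg (+) ~~ rot) Y k s ->
  play sg (slot l r rot i @` Y) k [seq (slot l r rot i x.1, x.2) | x <- s].
Proof.
move=> /(@play_image _ _ (~~ rot) 4^-1 (slot l r rot i)); rewrite addbK; apply=> //.
  exact: slot_homeomorphism.
move=> p q; have M0 : (mn%:R : R) != 0 by rewrite pnatr_eq0.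
rewrite /slot /= => -[/(mulIf _) + E]; rewrite invr_eq0 => /(_ M0)/addrI yE; split.
  case: p q E yE => [[x y] z] [[x' y'] z'] /=.
  by case: rot => [/(congr1 (fun u => 1 - u))|] E ->; [move: E; rewrite !subKr|move: E] => ->.
by case: rot {E} => /=; rewrite ?expr0 ?expr1; lra.
Qed.

(** Plumbing exchanges direction and side: the parent sees [openS] as spreading, [shutS] as
    collecting, [halfS] as passing and [closedS] as two independent passages. A closed child passes
    both sides in parallel by taking equal directions and postponing a choice. *)
Lemma child_mode sg rot i c m : (i <= n)%N -> efficient c -> allowed m (path_cover c).2 ->
  exists2 Y : set (space3 R), position c Y &
    play sg (slot l r rot i @` Y) (child_cost m (path_cover c).1)
      (scheduled pt m i.*2.+2).
Proof.
move=> i_n eff; have := eff (sg (+) ~~ rot) => /=; case: (path_cover c) => P o /= H.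
have E a b := slot_corner rot a b i_n.
case: m => [d b d'|d|d b|d b] /=; case: o H => // H _.
- have [Y pY plY] := H (b (+) rot) d d'; exists Y => //.
  by have := child_play i plY; rewrite /= !en_corners !E !addNb addbK.
- have [_ _ [Y pY plY]] := H rot d; exists Y => //.
  by have := child_play i plY; rewrite /= !en_corners !E !addNb addbb.
- have [Y pY plY] := H rot d d; exists Y => //; apply: thru_pass.
  by have := child_play i plY; rewrite /= !en_corners !E !addNb addbb.
- have [[Y pY plY] _ _] := H (b (+) rot) d; exists Y => //.
  by have := child_play i plY; rewrite /= !en_corners !E !addNb addbK.
- have [_ [Y pY plY] _] := H (b (+) rot) d; exists Y => //.
  have := child_play i plY; rewrite /= !en_corners !E !addNb addbK.
  set x1 := (_, true); set x2 := (_, true); set x3 := (_, true); set x4 := (_, false).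
  move=> /(@play_perm _ _ _ _ [:: x1]) /= /(_ isT).
  by move=> /(@play_perm _ _ _ _ [::]) /= /(_ isT).
Qed.

Definition piece_cover i :=
  if nth None (pieces l r) i is Some c then path_cover c else (0%N, false).

Definition cell_cost (md : nat -> mode) j :=
  if is_child l r j then child_cost (md j) (piece_cover j./2.-1).1 else flat_cost (md j).

Lemma ramp_lipschitz x y : `|ramp l r i0 x - ramp l r i0 y| <= (3 * mn%:R) * `|x - y| :> R.
Proof.
apply: le_trans (clamp_lipschitz _ _) _; rewrite opprB addrA subrK.
have -> : 3 * (mn%:R * x) - 3 * (mn%:R * y) = (3 * mn%:R) * (x - y) :> R by lra.
by rewrite normrM (@ger0_norm _ (3 * mn%:R))// mulr_ge0// ler0n.
Qed.

(** Each child takes the position suited to the mode of its cell. The strategy for half twists leads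
    both sides in the same direction, so their cell has to be in mode [Pass]. *)
Lemma node_cells sg (md : nat -> mode) d :
  (forall i c, (i <= n)%N -> nth None (pieces l r) i = Some c ->
     efficient c /\ allowed (md i.*2.+2) (path_cover c).2) ->
  md i0.*2.+1 = Pass d ->
  exists2 Yf : nat -> set (space3 R),
    (forall i c, (i <= n)%N -> nth None (pieces l r) i = Some c -> position c (Yf i)) &
    forall j, (j < N)%N -> play sg (band_cell w l r i0 Yf j) (cell_cost md j)
      (scheduled pt (md j) j).
Proof.
move=> Hmd twist.
have /choice[Yf HYf] (i : nat) : exists Y : set (space3 R), forall c, (i <= n)%N ->
    nth None (pieces l r) i = Some c -> position c Y /\
    play sg (slot l r (rotated w l i0 i) i @` Y)
      (child_cost (md i.*2.+2) (path_cover c).1) (scheduled pt (md i.*2.+2) i.*2.+2).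
  have [i_n|i_n] := leqP i n; last by exists set0 => c.
  case E : (nth None (pieces l r) i) => [c|]; last by exists set0.
  have [eff ok] := Hmd i c i_n E.
  have [Y pY plY] := child_mode sg (rotated w l i0 i) i_n eff ok.
  by exists Y => c' _ [<-].
have HY i c (i_n : (i <= n)%N) (E : nth None (pieces l r) i = Some c) := (HYf i c i_n E).1.
exists Yf => // j jN; rewrite /cell_cost; case: ifP => ch.
  have [jE i_n i1] := child_index ch.
  have [c cE _] := nth_pieces_child i_n i1.
  have [_] := HYf _ _ i_n cE.
  by rewrite /piece_cover cE /band_cell ch -jE.
have nch : ~~ is_child l r j by rewrite ch.
have [jE|jE] := eqVneq j i0.*2.+1; last first.
  have [Ht [Hs Hc]] := flat_play w Yf i0n sg jN nch jE.
  case: (md j) => [d1 b d2|d1|d1 b|d1 b] /=; [exact: Ht| |exact: Hs|exact: Hc].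
  by apply: thru_pass; exact: Ht.
rewrite jE twist /= /band_cell -jE ch.
have pc : continuous (profile l r : R -> R) by rewrite /profile; cont.
have lt := @bp_lt R l r _ jN.
have r01 (x : R) : 0 <= ramp l r i0 x <= 1 by rewrite clamp_ge0 clamp_le1.
have r0 : ramp l r i0 (bp l r j) = 0 :> R by rewrite jE ramp_start.
have r1 : ramp l r i0 (bp l r j.+1) = 1 :> R by rewrite jE ramp_stop.
have := twist_play sg w lt pc ramp_lipschitz r01 r0 r1 d.
by case: d {twist}.
Qed.

End NodeCells.
End Upper.

Lemma sum_indicator (b : bool) k m :
  (\sum_(0 <= j < m) (b && (j == k) : nat) = (b && (k < m)))%N.
Proof.
elim: m => [|m IH]; first by rewrite big_geq// andbF.
rewrite big_nat_recr//= IH [in RHS]ltnS [in RHS]leq_eqVlt eq_sym.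
by case: b {IH} => //=; case: eqP => [->|_]; rewrite ?ltnn ?addn0.
Qed.

Lemma sum_double (F : nat -> nat) m :
  (\sum_(0 <= j < m.*2.+1) F j = F 0 + \sum_(0 <= i < m) (F i.*2.+1 + F i.*2.+2))%N.
Proof.
elim: m => [|m IH]; first by rewrite big_nat1 big_geq ?addn0.
by rewrite doubleS 2?big_nat_recr//= IH (big_nat_recr m)//= -!addnA.
Qed.

Lemma count_gt1 (A : Type) (a : pred A) (x : A) s : (1 < count a s)%N ->
  exists i j, [/\ (i < j)%N, (j < size s)%N, a (nth x s i) & a (nth x s j)].
Proof.
elim: s => //= y s IH; case: (boolP (a y)) => ay /=.
  rewrite ltnS -has_count => hs; exists 0%N, (find a s).+1.
  by split=> //=; [rewrite ltnS -has_find|exact: nth_find].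
rewrite add0n => /IH[i [j [ij js ai aj]]].
by exists i.+1, j.+1.
Qed.

(** * Counting the maxima along the band of a vertex *)

Section NodeCosts.
Variables (l r : seq (plane_tree int)).
Let n1 := size l.
Let n := (size l + size r)%N.
Let mn := n.+1.*2.+1.
Let N := mn.+2.
Let cover := [seq path_cover c | c <- l] ++ [seq path_cover c | c <- r].

Lemma piece_coverE : [seq piece_cover l r i | i <- iota 0 n.+1] =
  [seq path_cover c | c <- l] ++ (0%N, false) :: [seq path_cover c | c <- r].
Proof.
pose g (o : option (plane_tree int)) := if o is Some c then path_cover c else (0%N, false).
have -> : [seq piece_cover l r i | i <- iota 0 n.+1] = map g (pieces l r).
  rewrite -[in RHS](mkseq_nth None (pieces l r)) /mkseq -map_comp.
  by rewrite size_pieces.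
by rewrite /pieces map_cat /= -!map_comp.
Qed.

Lemma sum_pieces : (\sum_(0 <= i < n.+1) (piece_cover l r i).1 = sumn (unzip1 cover))%N.
Proof.
rewrite -(big_map (fun i => (piece_cover l r i).1) predT id) -sumnE /index_iota subn0.
have -> : [seq (piece_cover l r i).1 | i <- iota 0 n.+1] =
  unzip1 [seq piece_cover l r i | i <- iota 0 n.+1] by rewrite /unzip1 -map_comp.
by rewrite piece_coverE /cover /unzip1 !map_cat !sumn_cat.
Qed.

Lemma count_pieces : count snd cover = count (fun i => (piece_cover l r i).2) (iota 0 n.+1).
Proof. by rewrite -(count_map (piece_cover l r) snd) piece_coverE !count_cat. Qed.

Lemma sum_children (f : nat -> nat) : f n1 = 0%N ->
  (\sum_(0 <= j < N) (if is_child l r j then f j./2.-1 else 0) = \sum_(0 <= i < n.+1) f i)%N.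
Proof.
move=> f0; pose base j := if is_child l r j then f j./2.-1 else 0%N.
rewrite -[LHS]/(\sum_(0 <= j < N) base j)%N; have -> : N = n.+2.*2.+1 by [].
have base_odd i : base i.*2.+1 = 0%N.
  by rewrite /base; case: ifP => // /and4P[]; rewrite /= odd_double.
have base_last : base n.+1.*2.+2 = 0%N.
  by rewrite /base; case: ifP => // /and4P[_ _ + _]; rewrite /mn; clear; lia.
rewrite sum_double big_nat_recr//= base_odd base_last !addn0.
apply: eq_big_nat => i /andP[_ i_n]; rewrite base_odd /base.
have [i1|i1] := eqVneq i n1; last by rewrite is_child_index//= doubleK.
case: ifP => [/and4P[_ _ _]|_]; first by rewrite /= doubleK i1 eqxx.
by rewrite i1 f0.
Qed.

Let base j := if is_child l r j then (piece_cover l r j./2.-1).1 else 0%N.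

Let sum_base : (\sum_(0 <= j < N) base j = sumn (unzip1 cover))%N.
Proof.
rewrite -sum_pieces; apply: (sum_children (f := fun i => (piece_cover l r i).1)).
by rewrite /piece_cover nth_pieces.
Qed.

(** Relative to the sum over the children there are two corrections: a spreading hub on a flat cell
    costs one ([hs]), and a collecting open child saves one ([hc]). *)
Lemma layout_cost (md : nat -> mode) (hs hc : bool) js jc :
  (forall j, (j < N)%N -> ~~ is_child l r j -> (flat_cost (md j) <= (hs && (j == js)))%N) ->
  (hc -> [/\ (jc < N)%N, is_child l r jc, (0 < (piece_cover l r jc./2.-1).1)%N &
     exists d b, md jc = Collect d b]) ->
  (\sum_(0 <= j < N) cell_cost l r md j + hc <= sumn (unzip1 cover) + hs)%N.
Proof.
move=> Hs Hc.
have hcE : hc = hc && (jc < N)%N :> bool by case: hc Hc => // /(_ isT) [->].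
rewrite hcE -sum_base -sum_indicator -big_split /=.
apply: (@leq_trans (\sum_(0 <= j < N) base j + \sum_(0 <= j < N) (hs && (j == js) : nat))%N).
  rewrite -big_split /=; rewrite !big_mkord; apply: leq_sum => -[j jN] _ /=.
  rewrite /cell_cost /base; case: ifP => ch.
    have [E|ne] := boolP (hc && (j == jc)).
      move: E => /andP[h /eqP ->]; have [_ _ P0 [d [b ->]]] := Hc h.
      by rewrite /= addn1 prednK// leq_addr.
    by rewrite addn0; case: (md j) => *; rewrite /= ?leq_addr// (leq_trans (leq_pred _))// leq_addr.
  have := Hs j jN; rewrite ch => /(_ isT) h.
  case E : (hc && (j == jc)).
    by move: E ch => /andP[h' /eqP ->]; have [_ -> _ _] := Hc h'.
  by rewrite addn0.
by rewrite leq_add2l sum_indicator; case: (hs) => //=; case: (_ < _)%N.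
Qed.

End NodeCosts.

Lemma leq_sumn x s : x \in s -> (x <= sumn s)%N.
Proof.
elim: s => //= y s IH; rewrite inE => /orP[/eqP->|/IH h]; first exact: leq_addr.
exact: leq_trans h (leq_addl _ _).
Qed.

(** Makes the predecessors in [child_cost] and [flexible] true subtractions of one. A vertex with a
    single open child inherits positivity from it. *)
Lemma path_cover_gt0 (A : Type) (T : plane_tree A) :
  (path_cover T).2 -> (0 < (path_cover T).1)%N.
Proof.
elim/tree_induction: T => a l r IH /=; rewrite -map_cat.
set s := map _ _; case E : (count snd s) => [|[|m]] //= _.
have hs : has snd s by rewrite has_count E.
have fs := hs; rewrite has_find in fs.
have := nth_find (0%N, false) hs; set i := find snd s in fs *.
have il : (i < size (l ++ r))%N by rewrite -(size_map (@path_cover A)).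
rewrite (nth_map (Node a [::] [::]))// => /(IH _ (nth_inseq _ il)) h.
apply: leq_trans h (leq_sumn _); apply/mapP.
exists (nth (0%N, false) s i); first exact: mem_nth.
by rewrite (nth_map (Node a [::] [::])).
Qed.

Section NodeUpper.
Context {R : realType}.
Local Notation achieves := (@achieves R).
Variables (w : int) (l r : seq (plane_tree int)).
Let n1 := size l.
Let n := (size l + size r)%N.
Let mn := n.+1.*2.+1.
Let N := mn.+2.
Let S := sumn (unzip1 ([seq path_cover c | c <- l] ++ [seq path_cover c | c <- r])).
Hypothesis IH : forall c, inseq c (l ++ r) -> @efficient R c.

Let op i := (piece_cover l r i).2.

Let op_child i : (i <= n)%N -> op i -> i != n1.
Proof. by move=> _; apply: contraTneq => ->; rewrite /op /piece_cover nth_pieces. Qed.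

Lemma node_achieves sg i0 lo hi (A1 A2 A3 : bool) H d H' (B1 B2 B3 : bool)
    (hs hc : bool) (js jc k : nat) s :
  let md := layout lo hi (Thru A1 A2 A3) H d H' (Thru B1 B2 B3) in
  (i0 <= n.+1)%N -> (lo < hi)%N -> (hi <= N)%N -> (lo <= i0.*2.+1)%N -> (i0.*2.+1 < hi)%N ->
  (forall i, (i <= n)%N -> [/\ (i.*2.+3 < lo)%N -> ~~ op i, i.*2.+3 = lo -> allowed H (op i),
     i.*2.+2 = hi -> allowed H' (op i) & (hi < i.*2.+2)%N -> ~~ op i]) ->
  ((0 < lo)%N -> ~~ is_child l r lo.-1 -> (flat_cost H <= (hs && (lo.-1 == js)))%N) ->
  ((hi < N)%N -> ~~ is_child l r hi -> (flat_cost H' <= (hs && (hi == js)))%N) ->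
  (hc -> [/\ (jc < N)%N, is_child l r jc, op jc./2.-1 &
     exists d b, md jc = Collect d b]) ->
  (S + hs <= k + hc)%N ->
  (forall Yf : nat -> set (space3 R),
    (forall i c, (i <= n)%N -> nth None (pieces l r) i = Some c -> position c (Yf i)) ->
    (forall j, (j < N)%N -> play sg (band_cell w l r i0 Yf j) (cell_cost l r md j)
      (scheduled (cut_pt l r) (md j) j)) ->
    play sg (chain (band_cell w l r i0 Yf) 0 N) (\sum_(0 <= j < N) cell_cost l r md j)%N s) ->
  achieves (Node w l r) sg k s.
Proof.
move=> md i0n lohi hiN loi ihi Hop Hlo Hhi Hc Hk Hplay.
have mdi : md i0.*2.+1 = Pass d by rewrite /md layout_pass.
have child i c : (i <= n)%N -> nth None (pieces l r) i = Some c ->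
    @efficient R c /\ allowed (md i.*2.+2) (path_cover c).2.
  move=> i_n cE; have i1 : i != n1 by apply/eqP => E; move: cE; rewrite E nth_pieces.
  have [c' cE' ic] := nth_pieces_child i_n i1.
  move: cE'; rewrite cE => -[cc]; split; first by apply: IH; rewrite cc.
  have opE : op i = (path_cover c).2 by rewrite /op /piece_cover cE.
  have [h1 h2 h3 h4] := Hop i i_n; rewrite -opE /md.
  have [h|h|h] := ltngtP i.*2.+3 lo.
  - by rewrite layout_thru//; exact: h1.
  - have [g|g|g] := ltngtP i.*2.+2 hi.
    + by rewrite layout_pass.
    + by rewrite layout_thru'//; exact: h4.
    + by rewrite layout_hub'//; exact: h3.
  - by rewrite layout_hub//; exact: h2.
have [Yf HY pl] := node_cells w i0n sg child mdi.
exists (chain (band_cell w l r i0 Yf) 0 N); first exact: cell_position.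
apply: (play_leq _ (Hplay Yf HY pl)).
rewrite -(leq_add2r hc); apply: leq_trans Hk.
apply: (@layout_cost l r md hs hc js jc) => [j jN nch|/Hc[h1 h2 h3 h4]]; last first.
  split=> //; move: h3; rewrite /op /piece_cover.
  by case: nth => // c; exact: path_cover_gt0.
rewrite /md; have [h|h|h] := ltngtP j.+1 lo.
- by rewrite layout_thru.
- have [g|g|g] := ltngtP j hi.
  + by rewrite layout_pass.
  + by rewrite layout_thru'.
  + by rewrite layout_hub'// {1}g; apply: Hhi; rewrite -g.
- by rewrite layout_hub//; have := Hlo; rewrite -h; apply.
Qed.

(** Here [i0] is one more than the index of the open child used as hub; [i0 = 0] puts the hub on the
    thin cell at the left end. In both cases the hub is cell [i0.*2], and the half twists go into
    the cell just after it. *)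
Definition left_hub i0 := [/\ (i0 <= n.+1)%N, forall i, (i.+1 < i0)%N -> ~~ op i &
  (0 < i0)%N -> op i0.-1].

Definition right_hub i0 := [/\ (i0 <= n.+1)%N, forall i, (i0 < i)%N -> (i <= n)%N -> ~~ op i &
  (i0 <= n)%N -> op i0].

Let hub_left i0 : left_hub i0 -> (0 < i0)%N -> is_child l r i0.*2.
Proof.
case: i0 => // i [i_n _ /(_ isT) oi] _.
by rewrite doubleS is_child_index//; apply: op_child.
Qed.

Let hub_right i0 : right_hub i0 -> (i0 <= n)%N -> is_child l r i0.*2.+2.
Proof. by move=> [_ _ oi] i_n; rewrite is_child_index//; apply: op_child => //; exact: oi. Qed.

Let en_ends d b : en (@cut_pt R l r) 0 N d b = en corners 0 1 d b.
Proof. by rewrite /en; case: d; rewrite ?ptN ?pt0. Qed.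

Let left_cond i0 : left_hub i0 -> forall i, (i <= n)%N ->
  ((i.*2.+3 < i0.*2.+1)%N -> ~~ op i) /\ (i.*2.+3 = i0.*2.+1 -> op i).
Proof.
move=> [_ h1 h2] i _; split=> h; first by apply: h1; move: h; clear; lia.
have iE : i = i0.-1 by move: h; clear; lia.
by rewrite iE; apply: h2; move: h; clear; lia.
Qed.

Let right_cond i0 : right_hub i0 -> forall i, (i <= n)%N ->
  (i.*2.+2 = i0.*2.+2 -> op i) /\ ((i0.*2.+2 < i.*2.+2)%N -> ~~ op i).
Proof.
move=> [_ h1 h2] i i_n; split=> h; last by apply: h1 => //; move: h; clear; lia.
have iE : i0 = i by move: h; clear; lia.
by move: h2; rewrite iE; apply.
Qed.

Let no_child_end i hi : (i <= n)%N -> (mn < hi)%N ->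
  (i.*2.+2 = hi -> false) /\ (hi < i.*2.+2)%N = false.
Proof. by rewrite /mn => i_n h; split; move: i_n h; clear; lia. Qed.

Let cell_bounds i0 : (i0 <= n.+1)%N ->
  [/\ (i0.*2.+1 < mn.+1)%N, (i0.*2.+1 < N)%N, (i0.*2.+2 < N)%N & (i0.*2 < N)%N].
Proof. by rewrite /N /mn => i_n; split; move: i_n; clear; lia. Qed.

Lemma open_left_hub sg i0 b : left_hub i0 ->
  achieves (Node w l r) sg (S + (i0 == 0%N)) (openS corners 0 1 false b).
Proof.
move=> hub; have [i_n h1 h2] := hub; have [b1 b2 b3 b4] := cell_bounds i_n.
apply: (@node_achieves sg i0 i0.*2.+1 N false b true (Spread false b) false (Pass true)
  true true true (i0 == 0%N) false i0.*2 0); rewrite ?addn0 //.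
- move=> i i_n'; have [? ?] := left_cond hub i_n'.
  by have [? ->] := @no_child_end i N i_n' (leqnSn _); split.
- by rewrite /= eqxx andbT => _; case: (posnP i0) => [_ //|h]; rewrite (hub_left hub h).
- move=> Yf HY pl; rewrite /openS -!en_ends.
  by apply: (layout_open_left (cell_closed HY) (cell_range HY)
      (@bp_lt R l r) (cell_adj i_n HY) _ _ _ _ pl).
Qed.

Lemma shut_left_hub sg i0 b : left_hub i0 ->
  achieves (Node w l r) sg (S - (0 < i0)%N) (shutS corners 0 1 false b).
Proof.
move=> hub; have [i_n h1 h2] := hub; have [b1 b2 b3 b4] := cell_bounds i_n.
apply: (@node_achieves sg i0 i0.*2.+1 N false (~~ b) true (Collect false b) true (Pass true)
  true true true false (0 < i0)%N 0 i0.*2); rewrite ?addn0 //.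
- move=> i i_n'; have [? ?] := left_cond hub i_n'.
  by have [? ->] := @no_child_end i N i_n' (leqnSn _); split.
- move=> i0_gt0; split=> //; first exact: hub_left.
    by rewrite doubleK; exact: h2.
  by exists false, b; rewrite layout_hub.
- by rewrite addnC -leq_subLR.
- move=> Yf HY pl; rewrite /shutS -!en_ends.
  by apply: (layout_shut_left (cell_closed HY) (cell_range HY)
      (@bp_lt R l r) (cell_adj i_n HY) _ _ _ _ pl).
Qed.

(** Obtained from a closed schedule whose collecting hub is the flat cell at the right end, where
    collecting is free. *)
Lemma half_hub sg i0 b : left_hub i0 ->
  achieves (Node w l r) sg (S + (i0 == 0%N)) (halfS corners 0 1 false b).
Proof.
move=> hub; have [i_n h1 h2] := hub; have [b1 b2 b3 b4] := cell_bounds i_n.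
apply: (@node_achieves sg i0 i0.*2.+1 mn.+1 false b true (Spread false b) false
  (Collect true (~~ b)) true (~~ ~~ b) false (i0 == 0%N) false i0.*2 0); rewrite ?addn0 //.
- move=> i i_n'; have [? ?] := left_cond hub i_n'.
  by have [e ->] := @no_child_end i mn.+1 i_n' (leqnn _); split=> // /e.
- by rewrite /= eqxx andbT => _; case: (posnP i0) => [_ //|h]; rewrite (hub_left hub h).
- move=> Yf HY pl; apply: closed_half; rewrite /closedS -!en_ends.
  by apply: (layout_closed_left (cell_closed HY) (cell_range HY)
      (@bp_lt R l r) (cell_adj i_n HY) _ _ _ _ pl).
Qed.

Lemma open_right_hub sg i0 b : right_hub i0 ->
  achieves (Node w l r) sg (S + (i0 == n.+1)) (openS corners 0 1 true b).
Proof.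
move=> hub; have [i_n h1 h2] := hub; have [b1 b2 b3 b4] := cell_bounds i_n.
apply: (@node_achieves sg i0 0 i0.*2.+2 true true true (Pass true) true (Spread true b)
  true b false (i0 == n.+1) false i0.*2.+2 0); rewrite ?addn0 //.
- by move=> i i_n'; have [? ?] := right_cond hub i_n'; split.
- rewrite eqxx andbT => _; case: eqP => // /eqP ne; rewrite (hub_right hub)//.
  by move: i_n; rewrite leq_eqVlt (negbTE ne).
- move=> Yf HY pl; rewrite /openS -!en_ends.
  by apply: (layout_open_right (cell_closed HY) (cell_range HY)
      (@bp_lt R l r) (cell_adj i_n HY) _ _ _ _ pl).
Qed.

Lemma shut_right_hub sg i0 b : right_hub i0 ->
  achieves (Node w l r) sg (S - (i0 <= n)%N) (shutS corners 0 1 true b).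
Proof.
move=> hub; have [i_n h1 h2] := hub; have [b1 b2 b3 b4] := cell_bounds i_n.
apply: (@node_achieves sg i0 0 i0.*2.+2 true true true (Pass true) false (Collect true b)
  true (~~ b) false false (i0 <= n)%N 0 i0.*2.+2); rewrite ?addn0 //.
- by move=> i i_n'; have [? ?] := right_cond hub i_n'; split.
- move=> i0n; split=> //; first exact: hub_right.
    by rewrite /= doubleK; exact: h2.
  by exists true, b; rewrite layout_hub'.
- by rewrite addnC -leq_subLR.
- move=> Yf HY pl; rewrite /shutS -!en_ends.
  by apply: (layout_shut_right (cell_closed HY) (cell_range HY)
      (@bp_lt R l r) (cell_adj i_n HY) _ _ _ _ pl).
Qed.

(** Of two open children one spreads and the other collects, with a saving of one. As [i1] is the
    successor of the left index, [i1 <= i2] says that they are distinct. *)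
Lemma closed_hubs sg i1 i2 a b b' : left_hub i1 -> right_hub i2 ->
  (0 < i1)%N -> (i1 <= i2)%N -> (i2 <= n)%N ->
  achieves (Node w l r) sg S.-1 (closedS corners 0 1 a b b').
Proof.
move=> hub1 hub2 i1_gt0 i12 i2n.
have [i_n h1 h2] := hub1; have [b1 b2 b3 b4] := cell_bounds i_n.
have [i2_n h1' h2'] := hub2; have [c1 c2 c3 c4] := cell_bounds i2_n.
have op1 : op i1.*2./2.-1 by rewrite doubleK; exact: h2.
have op2 : op i2.*2.+2./2.-1 by rewrite /= doubleK; exact: h2'.
have ch1 := hub_left hub1 i1_gt0; have ch2 := hub_right hub2 i2n.
have lt12 : (i1.*2.+1 < i2.*2.+2)%N by rewrite !ltnS leq_double.
have S_le : (S + 0 <= S.-1 + 1)%N by rewrite addn0 addn1 leqSpred.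
have cond i : (i <= n)%N -> [/\ (i.*2.+3 < i1.*2.+1)%N -> ~~ op i, i.*2.+3 = i1.*2.+1 -> op i,
     i.*2.+2 = i2.*2.+2 -> op i & (i2.*2.+2 < i.*2.+2)%N -> ~~ op i].
  by move=> in'; have [? ?] := left_cond hub1 in'; have [? ?] := right_cond hub2 in'; split.
case: a.
  apply: (@node_achieves sg i1 i1.*2.+1 i2.*2.+2 false (~~ ~~ b') true (Collect false (~~ b')) true
    (Spread true b) true b false false true 0 i1.*2) => //=; try exact: ltnW.
  - by rewrite ch2.
  - by split=> //; exists false, (~~ b'); rewrite layout_hub.
  - move=> Yf HY pl; rewrite /closedS -!en_ends.
    by apply: (layout_closed_right (cell_closed HY) (cell_range HY)
      (@bp_lt R l r) (cell_adj i_n HY) _ _ _ _ pl) => //; exact: ltnW.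
apply: (@node_achieves sg i1 i1.*2.+1 i2.*2.+2 false b true (Spread false b) false
  (Collect true (~~ b')) true (~~ ~~ b') false false true 0 i2.*2.+2) => //=; try exact: ltnW.
- by rewrite ch1.
- by split=> //; exists true, (~~ b'); rewrite layout_hub'.
- move=> Yf HY pl; rewrite /closedS -!en_ends.
  by apply: (layout_closed_left (cell_closed HY) (cell_range HY)
      (@bp_lt R l r) (cell_adj i_n HY) _ _ _ _ pl) => //; exact: ltnW.
Qed.

Let leftmost i : (i <= n)%N -> op i -> exists2 i1, left_hub i1.+1 & (i1 <= i)%N.
Proof.
move=> i_n oi; have ex : exists i, op i by exists i.
case: (ex_minnP ex) => i1 o1 min1; have i1i := min1 i oi.
exists i1 => //; split=> //; first by rewrite ltnS (leq_trans i1i).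
by move=> j; rewrite ltnS; apply: contraL => /min1; rewrite -leqNgt.
Qed.

Let rightmost i : (i <= n)%N -> op i -> exists i2, [/\ right_hub i2, (i <= i2)%N & (i2 <= n)%N].
Proof.
move=> i_n oi; have ex : exists i, (i <= n)%N && op i by exists i; rewrite i_n.
have bnd j : (j <= n)%N && op j -> (j <= n)%N by case/andP.
case: (ex_maxnP ex bnd) => i2 /andP[i2n o2] max2; have ii2 := max2 i; rewrite i_n oi in ii2.
exists i2; split=> //; last exact: ii2.
split=> // [|j ij jn]; first exact: leqW.
by apply: contraL ij => oj; rewrite -leqNgt max2// jn.
Qed.

Lemma node_efficient : @efficient R (Node w l r).
Proof.
move=> sg P; rewrite {}/P /= count_pieces -/n -/op.
have nthi i : (i < n.+1)%N -> nth 0%N (iota 0 n.+1) i = i by move=> ?; rewrite nth_iota.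
have open i1 i2 P : left_hub i1 -> right_hub i2 -> P = (S + (i1 == 0%N))%N ->
    (i1 == 0%N) = (i2 == n.+1) -> forall a b : bool,
    [/\ achieves (Node w l r) sg P (openS corners 0 1 a b),
        achieves (Node w l r) sg P.-1 (shutS corners 0 1 a b) &
        achieves (Node w l r) sg P (halfS corners 0 1 a b)].
  move=> hub1 hub2 -> e a b.
  have PE : (S + (i1 == 0%N)).-1 = (S - (0 < i1)%N)%N.
    by rewrite lt0n; case: (i1 == 0%N); rewrite /= ?addn1 ?addn0 ?subn0 ?subn1.
  have [i2n _ _] := hub2.
  split.
  - case: a; last exact: open_left_hub.
    by rewrite e; exact: open_right_hub.
  - rewrite PE; case: a; last exact: shut_left_hub.
    suff -> : (0 < i1)%N = (i2 <= n)%N by exact: shut_right_hub.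
    by rewrite lt0n e; move: i2n; rewrite leq_eqVlt ltnS; case: eqP => //= ->; rewrite ltnn.
  - case: a; last exact: half_hub.
    have [Y pY plY] := half_hub sg b hub1.
    by exists Y => //; exact: half_flip plY.
case E : (count _ _) => [|[|m]].
- have none i : (i <= n)%N -> ~~ op i.
    move=> i_n; apply/negP => oi; have : has op (iota 0 n.+1).
      by apply/hasP; exists i => //; rewrite mem_iota.
    by rewrite has_count E.
  apply: (open 0%N n.+1); [by split| |by rewrite addn1|by rewrite !eqxx].
  split=> // [i h|]; first exact: none.
  by rewrite ltnn.
- have : has op (iota 0 n.+1) by rewrite has_count E.
  move=> /hasP[i]; rewrite mem_iota /= add0n ltnS => i_n oi.
  have [i1 hub1 _] := leftmost i_n oi; have [i2 [hub2 _ i2n]] := rightmost i_n oi.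
  apply: (open i1.+1 i2) => //; first by rewrite addn0.
  by rewrite [in RHS]ltn_eqF.
- have := @count_gt1 _ op 0%N (iota 0 n.+1); rewrite E => /(_ isT) [i [j [ij]]].
  rewrite size_iota => jn; rewrite !nthi// ?(ltn_trans ij)// => oi oj /=.
  have [i1 hub1 i1i] := leftmost (ltnW (leq_trans ij jn)) oi.
  have [i2 [hub2 ji2 i2n]] := rightmost (i := j) jn oj.
  move=> a b b'; apply: (@closed_hubs _ i1.+1 i2) => //.
  by apply: leq_trans ji2; exact: leq_ltn_trans ij.
Qed.

End NodeUpper.

Lemma all_efficient (R : realType) T : @efficient R T.
Proof. by elim/tree_induction: T => w l r IH; exact: node_efficient. Qed.

(** * Closing the band of the root *)

Section Root.
Context {R : realType}.

Let room (x : R) := Num.min x (1 - x) / 4.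

(* The flat strip that closes the band of the root, after its sides have been
   pushed away from the region above the square. *)
Definition root_side (b : bool) (x : R) : R * R :=
  (if b then 1 + room x else - room x, 0).

(** Only points with [|p.2| < room p.1.1] move, and [position] keeps the branch at or above that
    height. The last factor sends the two sides of the strip in opposite directions. *)
Definition push (p : space3 R) : space3 R :=
  (p.1.1, p.1.2 + Num.max 0 (room p.1.1 - `|p.2|) * (2 * clamp p.1.2 - 1), p.2).

Lemma push_homeomorphism : homeomorphism push.
Proof.
have [_ perm] := @homeomorphism_permute R.
pose g (p : space3 R) := (push (p.1.1, p.2, p.1.2)).1.2.
have hg : homeomorphism (fun p : space3 R => (p.1, g p)).
  apply: (@steep_homeomorphism _ 1) => //.
  split; first by rewrite /g /push /room /clamp /=; cont.
  move=> [x z] y y' yy' /=; rewrite /g /push /= mul1r.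
  have b0 : 0 <= Num.max 0 (room x - `|z|) by rewrite le_max lexx.
  have : clamp y <= clamp y'.
    by rewrite /clamp !minEle; do !case: ifP => ?; rewrite !maxEle; do !case: ifP => ?; lra.
  by move: (Num.max _ _) b0 (clamp y) (clamp y') => b b0 c c' cc; nra.
apply: (@homeomorphism_ext _ (_ \o _ \o _)); last exact:
  (homeomorphism_comp perm (homeomorphism_comp hg perm)).
by move=> [[x y] z].
Qed.

Lemma root_move T Y : position T Y -> exists f : space3 R -> space3 R,
  [/\ homeomorphism f,
      forall p, [/\ `|(f p).1.1 - p.1.1| <= 4, `|(f p).1.2 - p.1.2| <= 4
                  & `|(f p).2 - p.2| <= 4] &
      f @` arborescent_link R T =
        Y `|` strand (root_side false) 0 1 `|` strand (root_side true) 0 1].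
Proof.
move=> [[h [hh hb hY]] _ Yr _]; have [h' [ch ch' hK h'K]] := hh.
exists (push \o h); split.
- by apply: homeomorphism_comp; [|exact: push_homeomorphism].
- move=> p.
  have P q : [/\ (push q).1.1 = q.1.1, `|(push q).1.2 - q.1.2| <= 1 & (push q).2 = q.2].
    split=> //=; rewrite addrAC subrr add0r normrM.
    have m0 : 0 <= Num.max 0 (room q.1.1 - `|q.2|) by rewrite le_max lexx.
    have m1 : Num.max 0 (room q.1.1 - `|q.2|) <= 1.
      rewrite ge_max ler01 /= /room; have := normr_ge0 q.2.
      by rewrite minEle; case: ifP => ?; lra.
    have c0 := clamp_ge0 q.1.2; have c1 := clamp_le1 q.1.2.
    have : `|2 * clamp q.1.2 - 1| <= 1 by rewrite ler_norml; apply/andP; split; lra.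
    by rewrite (ger0_norm m0) => c2; apply: mulr_ile1.
  have [q1 q2 q3] := P (h p).
  (* Points of [box] stay in [box], whose edges are at most 3/2 long; [push] then adds at most 1. *)
  have [H1 H2 H3] : [/\ `|(h p).1.1 - p.1.1| <= 3, `|(h p).1.2 - p.1.2| <= 3
      & `|(h p).2 - p.2| <= 3].
    have [bp|bp] := pselect (box p); last by rewrite (hb p bp) !subrr normr0; split; lra.
    have bhp : box (h p).
      by apply: contrapT => nb; have := hb _ nb => /(can_inj hK) E; apply: nb; rewrite E.
    move: bp bhp => [/andP[? ?] /andP[? ?] /andP[? ?]] [/andP[? ?] /andP[? ?] /andP[? ?]].
    by split; rewrite ler_norml; apply/andP; split; lra.
  split; rewrite /comp ?q1 ?q3; try by [apply: le_trans H1 _; lra|apply: le_trans H3 _; lra].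
  have -> : (push (h p)).1.2 - p.1.2 = ((push (h p)).1.2 - (h p).1.2) + ((h p).1.2 - p.1.2) by lra.
  by apply: le_trans (ler_normD _ _) _; lra.
have hflat (x : R) y : h (x, y, 0) = (x, y, 0) by apply: hb => -[_ _]; rewrite /= ltxx.
have pushY p : Y p -> push p = p.
  move=> Yp; have [x01 y01 z1 xz] := Yr p Yp.
  have -> : push p = (p.1.1, p.1.2 + 0, p.2).
    rewrite /push; suff -> : Num.max 0 (room p.1.1 - `|p.2|) = 0 by rewrite mul0r.
    apply/max_idPl; rewrite subr_le0 /room; apply: le_trans (ler_norm _).
    by rewrite ler_pdivrMr// mulrC.
  by rewrite addr0; case: (p) => -[].
have pushflat (x : R) (b : bool) : 0 <= x <= 1 -> push (x, b%:R, 0) = (x, (root_side b x).1, 0).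
  move=> /andP[x0 x1]; rewrite /push /= normr0 subr0.
  have -> : Num.max 0 (room x) = room x.
    by apply/max_idPr; rewrite divr_ge0// le_min x0 subr_ge0.
  by case: b; [rewrite clamp1//|rewrite clamp0//]; congr (_, _, _); rewrite /=; lra.
rewrite /arborescent_link /plumbing setUC image_setU -image_comp hY -setUA; congr (_ `|` _).
  by apply/seteqP; split=> [_ [p Yp <-]|p Yp]; [rewrite pushY|exists p; rewrite ?pushY].
apply/seteqP; split.
  move=> _ [_ [x /= x01 [y yE <-]] <-]; rewrite in_itv/= in x01.
  move: yE => /bitsP[b ->]; rewrite /= hflat pushflat//.
  by case: b; [right|left].
have S b p : strand (root_side b) 0 1 p ->
    exists2 q, (flat bits : set (space3 R)) q & (push \o h) q = p.
  move=> [x01 pE]; exists (p.1.1, b%:R, 0).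
    by exists p.1.1; [rewrite /= in_itv|exists b%:R => //; apply/bitsP; exists b].
  rewrite /= hflat pushflat//; move: pE; case: (p) => [[x y] z] /= [-> ->].
  by [].
by move=> p [/S|/S].
Qed.

Lemma root_side_cont b : continuous (root_side b).
Proof. by rewrite /root_side /room; case: b; cont. Qed.

Lemma root_compact T Y : position T Y ->
  compact (Y `|` strand (root_side false) 0 1 `|` strand (root_side true) 0 1).
Proof.
move=> [_ cY Yr _].
have cK : compact ((`[0, 1] `*` `[-1, 2]) `*` `[-1, 1] : set (space3 R)).
  by apply: compact_setX; [apply: compact_setX|]; exact: segment_compact.
apply: (subclosed_compact _ cK).
  by apply: closedU; [apply: closedU => //|]; apply: strand_closed; exact: root_side_cont.
have rm (x : R) : 0 <= x <= 1 -> 0 <= room x <= 1.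
  by move=> /andP[? ?]; rewrite /room minEle; case: ifP => ?; apply/andP; split; lra.
move=> [[x y] z] [[/Yr[/= x01 /andP[y0 y1] z1 xz]|[/= x01 [-> ->]]]|[/= x01 [-> ->]]].
- have := rm x x01; rewrite /room => /andP[r0 _].
  by do 2?split; rewrite /= in_itv/= ?x01//; apply/andP; split; lra.
- have := rm x x01 => /andP[? ?].
  by do 2?split; rewrite /= in_itv/= ?x01//; apply/andP; split; lra.
- have := rm x x01 => /andP[? ?].
  by do 2?split; rewrite /= in_itv/= ?x01//; apply/andP; split; lra.
Qed.

Let side_en b d : let x := if d then 1 else 0 : R in
  (x, (root_side b x).1, (root_side b x).2) = corner d b.
Proof.
by rewrite /root_side /room; case: b; case: d => /=; rewrite minEle; case: ifP => ?;
  rewrite /corner /=; congr (_, _, _); lra.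
Qed.

Let room_eq0 (x : R) : 0 <= x <= 1 -> 0 <= room x /\ (room x = 0 -> x = 0 \/ x = 1).
Proof. by move=> /andP[? ?]; rewrite /room minEle; case: ifP => ?; split; lra. Qed.

Lemma root_meet T Y b p q : position T Y -> Y p -> strand (root_side b) 0 1 q ->
  p.1 = q.1 -> p = q /\ exists d, p = corner d b.
Proof.
move=> [_ _ Yr Yc] Yp [q01 qE] pq; have [x01 /andP[y0 y1] z1 xz] := Yr p Yp.
have [r0 r1] := room_eq0 q01.
have room0 : room q.1.1 = 0.
  by move: qE y0 y1; rewrite pq => -[-> _]; case: b => /=; lra.
have [|d [b' pE]] := Yc p Yp; first by rewrite pq; exact: r1.
have [qy qz] : q.1.2 = b%:R /\ q.2 = 0.
  by move: qE; rewrite /root_side room0 => -[-> ->]; case: (b); split; rewrite /=; lra.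
have bb : b' = b.
  have : (b'%:R : R) = b%:R by rewrite -qy -pq pE.
  by case: (b') (b) => -[] //= /eqP; rewrite ?oner_eq0// eq_sym oner_eq0.
split; last by exists d; rewrite pE bb.
by have -> : q = (q.1, q.2) by [case: (q)]; rewrite -pq qz pE.
Qed.

Lemma root_disjoint p q : strand (root_side false) 0 1 p -> strand (root_side true) 0 1 q ->
  p.1 <> q.1.
Proof.
move=> [p01 [py _]] [q01 [qy _]] pq; move: py; rewrite pq qy /=.
by have [? _] := room_eq0 q01; lra.
Qed.

(** Of the two sides of the closing strip one is a ridge, which starts the game by choosing a
    height, and the other is a valley between two heights chosen by the branch. Together they add
    one maximum. *)
Lemma bridge_path_cover T :
  (bridge_number (arborescent_link R T) <= (path_cover T).1.+1%:R%:E)%E.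
Proof.
have eff := @all_efficient R T false.
(* The open and the closed schedule of the whole branch agree except for the kind [k] of the third
   event, so both are closed up in the same way. *)
have [Y pY [k plY]] : exists2 Y : set (space3 R), position T Y & exists k,
    play false Y (path_cover T).1 ((corner false false, true) :: (corner false true, false)
     :: (corner true false, k) :: [:: (corner true true, false)]).
  move: eff => /=; case: (path_cover T).2 => eff.
    have [[Y pY plY] _ _] := eff false false; exists Y => //; exists false.
    by move: plY; rewrite /openS !en_corners.
  have [Y pY plY] := eff false false false; exists Y => //; exists true.
  by move: plY; rewrite /closedS !en_corners.
have [f [hf fb fL]] := root_move pY.
apply: (bridge_bound hf fb fL (root_compact pY)).
have [_ cY _ _] := pY.
have sc b := strand_closed (a := 0) (b := 1) (@root_side_cont b).
have meet := @root_meet _ _ _ _ _ pY; have sides := root_disjoint.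
have cY0 : closed (Y `|` strand (root_side false) 0 1) by exact: closedU.
rewrite -addn1 -[X in play _ _ X _]addn0.
apply: (@play_glue _ false _ _ _ 0 [:: (corner false true, false); (corner true true, false)]
  [:: (corner false true, true); (corner true true, true)] [::]
  [:: corner false true; corner true true]) => //.
- move=> p q [Yp|sp] sq pq; last by case: (sides p q).
  have [pqE [d pE]] := meet _ _ _ Yp sq pq; split=> //.
  by rewrite pE !inE; case: (d); rewrite eqxx ?orbT.
- by merge_tac.
- case: k plY => plY.
    apply: (@play_glue _ false _ _ _ _ _
      [:: (corner false false, false); (corner true false, false)]
      _ [:: corner false false; corner true false] cY (sc false) _ _ plY).
    + move=> p q Yp sq pq; have [pqE [d pE]] := meet _ _ _ Yp sq pq; split=> //.
      by rewrite pE !inE; case: (d); rewrite eqxx ?orbT.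
    + by merge_tac.
    + rewrite -(side_en false false) -(side_en false true).
      exact: strand_ridge (@root_side_cont false) ltr01 false.
  apply: (@play_glue _ false _ _ _ _ _ [:: (corner false false, false); (corner true false, true)]
    _ [:: corner false false; corner true false] cY (sc false) _ _ plY).
  + move=> p q Yp sq pq; have [pqE [d pE]] := meet _ _ _ Yp sq pq; split=> //.
    by rewrite pE !inE; case: (d); rewrite eqxx ?orbT.
  + by merge_tac.
  + rewrite -(side_en false false) -(side_en false true).
    exact: strand_ridge_in (@root_side_cont false) ltr01 false.
- rewrite -(side_en true false) -(side_en true true).
  exact: strand_valley (@root_side_cont true) ltr01 false.
Qed.

End Root.

(** * Lower bound *)

(* How two arcs join four ends: [Some false] joins each end to the end on the
   same side, [Some true] to the end on the other side, and [None] joins ends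
   at the same place. *)
Definition arc (tau : option bool) (d b : bool) : bool :=
  if tau is Some x then b (+) (d && x) else d.

Definition compose (tau tau' : option bool) : option bool :=
  if (tau, tau') is (Some x, Some y) then Some (x (+) y) else None.

(** The effect of plumbing, which exchanges direction and side: arcs that run along the child turn
    back in the parent and conversely, while crossed arcs stay crossed. *)
Definition transpose (tau : option bool) : option bool :=
  match tau with Some false => None | Some true => Some true | None => Some false end.

Lemma arc_transpose tau d b : arc (transpose tau) d b = arc tau b d.
Proof. by case: tau => [[]|] /=; case: d; case: b. Qed.

Section Labels.
Context {R : realType}.

(* [Z] contains two arcs joining the given ends as prescribed by [tau] and [k]
   closed curves: all can be labelled independently. *)
Definition labelled (Z : set (space3 R)) (ends : bool -> bool -> space3 R) tau k :=
  forall (e : bool -> nat) (s : nat -> nat), exists c : space3 R -> R,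
    [/\ {within Z, continuous c}, forall p, Z p -> exists n : nat, c p = n%:R,
        forall d b, c (ends d b) = (e (arc tau d b))%:R &
        forall i, (i < k)%N -> exists2 p, Z p & c p = (s i)%:R].

Lemma labelled_leq Z ends tau k k' : (k' <= k)%N -> labelled Z ends tau k -> labelled Z ends tau k'.
Proof.
move=> kk H e s; have [c [h1 h2 h3 h4]] := H e s; exists c; split=> // i ik.
by apply: h4; exact: leq_trans kk.
Qed.

Lemma labelled_image f Z ends tau k : homeomorphism f -> labelled Z ends tau k ->
  labelled (f @` Z) (fun d b => f (ends b d)) (transpose tau) k.
Proof.
move=> [g [cf cg fg gf]] H e s; have [c [h1 h2 h3 h4]] := H e s.
exists (c \o g); split.
- apply: within_nearP => _ eps [p Zp <-] e0.
  have W : nbhs (g (f p)) [set q | Z q -> `|c q - c p| < eps].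
    by rewrite fg; exact: within_near.
  have F : \forall q \near f p, Z (g q) -> `|c (g q) - c p| < eps by exact: (cg (f p) _ W).
  apply: filterS F => q /= H' [p' Zp' E]; rewrite fg; apply: H'.
  by rewrite -E fg.
- by move=> _ [p Zp <-] /=; rewrite fg; exact: h2.
- by move=> d b; rewrite /= fg h3 arc_transpose.
- by move=> i /h4[p Zp pE]; exists (f p); [exists p|rewrite /= fg].
Qed.

Lemma labelled_strands (st : bool -> set (space3 R)) (ends : bool -> bool -> space3 R) tau :
  (forall b, closed (st b)) -> st false `&` st true = set0 ->
  (forall d b, st (arc tau d b) (ends d b)) ->
  labelled (st false `|` st true) ends tau 0.
Proof.
move=> stc stI stE e s; pose c p : R := if `[< st false p >] then (e false)%:R else (e true)%:R.
have cE b p : st b p -> c p = (e b)%:R.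
  rewrite /c; case: asboolP; case: b => // h1 h2; exfalso.
  by have : set0 p by rewrite -stI.
have cst b : {within st b, continuous c}.
  apply: within_nearP => p eps stp e0; apply: filterS (near_coord p e0) => q _ stq.
  by rewrite !(cE b)// subrr normr0.
exists c; split=> //.
- exact: withinU_continuous.
- by move=> p [/cE ->|/cE ->]; [exists (e false)|exists (e true)].
- by move=> d b; rewrite (cE _ _ (stE d b)).
Qed.

(** * Labels along a chain of cells *)

Section Chain.
Variables (N : nat) (cell : nat -> set (space3 R)).
Variables (bp : nat -> R) (pt : nat -> bool -> space3 R).
Hypothesis cell_closed : forall k, (k < N)%N -> closed (cell k).
Hypothesis cell_range : forall k p, (k < N)%N -> cell k p -> bp k <= p.1.1 <= bp k.+1.
Hypothesis bp_lt : forall k, (k < N)%N -> bp k < bp k.+1.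
Hypothesis cell_adj : forall k p q, (k.+1 < N)%N -> cell k p -> cell k.+1 q ->
  p.1 = q.1 -> p = q /\ exists b, p = pt k.+1 b.
Hypothesis cell_pt : forall k d b, (k < N)%N -> cell k (en pt k k.+1 d b).
Local Notation chain := (chain cell).

Let both_cut (tau tau' : option bool) : nat := (tau == None) && (tau' == None).

(** Arcs are joined end to end at the cut; if the arcs of both pieces turn back, those that meet at
    the cut form a new closed curve, which accounts for [both_cut]. *)
Lemma labelled_glue j tau tau' k k' : (0 < j)%N -> (j < N)%N ->
  labelled (chain 0 j) (en pt 0 j) tau k -> labelled (cell j) (en pt j j.+1) tau' k' ->
  labelled (chain 0 j.+1) (en pt 0 j.+1) (compose tau tau') (k + k' + both_cut tau tau').
Proof.
move=> j0 jN H H' e s; rewrite (chain_cat cell (leq0n j) (leqnSn j)) chain1.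
(* Labels for the arcs of the two pieces that agree at the cut. If both turn back, the new closed
   curve gets the label [s (k + k')], the first one left over by the curves of the pieces. *)
pose e1 b := match tau, tau' with
  | Some _, Some _ => e b | Some _, None => e false | None, Some _ => e b
  | None, None => if b then s (k + k')%N else e b end.
pose e2 b := match tau, tau' with
  | Some x, Some _ => e (b (+) x) | Some _, None => e b | None, Some _ => e true
  | None, None => if b then e b else s (k + k')%N end.
have [c1 [h1 v1 E1 S1]] := H e1 s; have [c2 [h2 v2 E2 S2]] := H' e2 (fun i => s (k + i)%N).
have agree b : c1 (pt j b) = c2 (pt j b).
  have := E1 true b; have := E2 false b; rewrite /en => -> ->; congr (_%:R).
  rewrite /e1 /e2 /arc; case: (tau) => [x|]; case: (tau') => [y|] //=.
  by rewrite addbF.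
pose c p := if `[< chain 0 j p >] then c1 p else c2 p.
have cE1 p : chain 0 j p -> c p = c1 p by rewrite /c => /asboolT ->.
have cE2 p : cell j p -> c p = c2 p.
  rewrite /c; case: asboolP => // ch; rewrite -chain1 => cj.
  have [|_ [b ->]] := chain_meet cell_range bp_lt cell_adj _ ch cj erefl; first exact: jN.
  by rewrite agree.
have P0 b : chain 0 j (pt 0 b) by exists 0%N; split=> //;
  exact: (@cell_pt 0 false b (ltn_trans j0 jN)).
exists c; split.
- apply: withinU_continuous; [exact: (chain_closed cell_closed (ltnW jN))|exact: cell_closed| |].
    by apply: within_cont_eq h1 => q /cE1 ->.
  by apply: within_cont_eq h2 => q /cE2 ->.
- by move=> p [Zp|Zp]; [rewrite cE1//; exact: v1|rewrite cE2//; exact: v2].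
- move=> [] b; rewrite /en.
    rewrite cE2; last exact: (@cell_pt j true b jN).
    have := E2 true b; rewrite /en => ->; congr (_%:R).
    rewrite /e2 /arc; case: (tau) => [x|]; case: (tau') => [y|] //=.
    by rewrite -addbA (addbC y).
  rewrite cE1; last exact: P0.
  have := E1 false b; rewrite /en => ->; congr (_%:R).
  by rewrite /e1 /arc; case: (tau) => [x|]; case: (tau') => [y|].
- move=> i; have [ik _|ki] := ltnP i k.
    by have [p Zp pE] := S1 i ik; exists p; [left|rewrite cE1].
  have [ik' _|ki'] := ltnP i (k + k').
    have [|p Zp pE] := S2 (i - k)%N; first by rewrite ltn_subLR.
    by exists p; [right|rewrite cE2// pE subnKC].
  move=> ik; have iE : i = (k + k')%N /\ both_cut tau tau' = 1%N.
    by move: ik ki'; rewrite /both_cut; case: (_ && _); clear => *; split; lia.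
  exists (pt j false); first by right; exact: (@cell_pt j false false jN).
  rewrite cE2; last exact: (@cell_pt j false false jN).
  have := E2 false false; rewrite /en => ->; congr (_%:R); rewrite iE.1.
  by move: iE.2; rewrite /e2 /arc /both_cut; case: (tau) (tau') => [x|] [y|].
Qed.

Fixpoint compose_upto (ty : nat -> option bool) j :=
  if j is i.+1 then compose (compose_upto ty i) (ty i) else Some false.

(** The cells of type [None] cut the chain, and between two consecutive cuts there is one closed
    curve; hence the number of cuts less one. *)
Lemma labelled_chain (ty : nat -> option bool) (k : nat -> nat) j : (0 < j)%N -> (j <= N)%N ->
  (forall i, (i < j)%N -> labelled (cell i) (en pt i i.+1) (ty i) (k i)) ->
  labelled (chain 0 j) (en pt 0 j) (compose_upto ty j)
    (\sum_(0 <= i < j) k i + (\sum_(0 <= i < j) (ty i == None : nat)).-1).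
Proof.
have cuts i : (compose_upto ty i == None) = (0 < \sum_(0 <= i' < i) (ty i' == None : nat))%N.
  elim: i => [|i IH]; first by rewrite big_geq.
  rewrite big_nat_recr//= addn_gt0 -IH.
  by case: compose_upto => [x|]; case: (ty i).
case: j => // j _; elim: j => [|j IH] jN H.
  rewrite !big_nat1 /= chain1.
  have -> : (compose (Some false) (ty 0%N)) = ty 0%N by case: (ty 0%N).
  by rewrite (_ : (ty 0%N == None : nat).-1 = 0%N) ?addn0; [exact: H|case: (ty 0%N == None)].
have /IH /(_ (fun i ij => H i (ltnW ij))) L := ltnW jN.
have := labelled_glue (ltn0Sn j) jN L (H j.+1 (ltnSn _)).
apply: labelled_leq.
rewrite [\sum_(0 <= i < j.+2) k i]big_nat_recr//=
  [\sum_(0 <= i < j.+2) (ty i == None : nat)]big_nat_recr//=.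
rewrite /both_cut /= -[compose _ _]/(compose_upto ty j.+1) cuts.
have D (a b : nat) : (a + b)%R = (a + b)%N by [].
rewrite !D.
move: (\sum_(0 <= i < j.+1) (ty i == None))%N (\sum_(0 <= i < j.+1) k i)%N (k j.+1) => m x y.
by case: (ty j.+1 == None); case: m => [|m]; rewrite /= ?andbT ?andbF; clear; lia.
Qed.

End Chain.
End Labels.

(** * Labels on the band of a vertex, and the greedy choice of weights *)

Section NodeLabels.
Context {R : realType}.
Variables (w : int) (l r : seq (plane_tree int)).
Let n1 := size l.
Let n := (size l + size r)%N.
Let mn := n.+1.*2.+1.
Let N := mn.+2.
Let i0n : (n1 <= n.+1)%N := leqW (leq_addr _ _).
Variables (Yf : nat -> set (space3 R)) (tau : nat -> option bool) (k : nat -> nat).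
Hypothesis HY : forall i c, (i <= n)%N -> nth None (pieces l r) i = Some c -> position c (Yf i).
Hypothesis HL : forall i c, (i <= n)%N -> nth None (pieces l r) i = Some c ->
  labelled (Yf i) corner (tau i) (k i).
Local Notation pt := (@cut_pt R l r).
Local Notation cell := (band_cell w l r n1 Yf).

Lemma labelled_ends (Z : set (space3 R)) ends ends' t m : (forall d b, ends d b = ends' d b) ->
  labelled Z ends t m -> labelled Z ends' t m.
Proof.
move=> E H e s; have [c [h1 h2 h3 h4]] := H e s.
by exists c; split=> // d b; rewrite -E.
Qed.

(** For the lower bound the half twists stay at their original place [n1], so no child is turned
    over. *)
Let straight i : (i <= n)%N -> i != n1 -> rotated w l n1 i = false.
Proof.
move=> _ i1; rewrite /rotated -/n1 [(n1 < i)%N]ltn_neqAle eq_sym i1.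
by rewrite /= addbb andbF.
Qed.

Let child_labelled j : is_child l r j ->
  labelled (cell j) (en pt j j.+1) (transpose (tau j./2.-1)) (k j./2.-1).
Proof.
move=> ch; have [jE i_n i1] := child_index ch.
have [c cE _] := nth_pieces_child i_n i1.
have := labelled_image (slot_homeomorphism l r false j./2.-1) (HL i_n cE).
rewrite /band_cell ch straight//; apply: labelled_ends => d b.
by rewrite slot_corner// addbF -jE.
Qed.

Let band_neq (x : R) : band w (ramp l r n1) (profile l r) false x <>
  band w (ramp l r n1) (profile l r) true x.
Proof.
rewrite /band /= => -[cE sE].
have := cos2Dsin2 (pi * w%:~R * ramp l r n1 x); move: cE sE.
move: (cos _) (sin _) => c s cE sE.
have -> : c = 0 by lra.
by have -> : s = 0; [lra|rewrite expr0n /= addr0 => /eqP; rewrite eq_sym oner_eq0].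
Qed.

Let flat_strands j : (j < N)%N -> ~~ is_child l r j -> exists st : bool -> set (space3 R),
  [/\ cell j = st false `|` st true, forall b, closed (st b), st false `&` st true = set0 &
      forall d b, st (arc (Some (odd `|w|%N && (j == n1.*2.+1))) d b) (en pt j j.+1 d b)].
Proof.
move=> jN nch.
have lt := @bp_lt R l r _ jN.
have [b0 [b1 [r0 r1 bE]]] : exists b0 b1 : bool,
    [/\ ramp l r n1 (bp l r j) = b0%:R :> R, ramp l r n1 (bp l r j.+1) = b1%:R :> R &
        b0 (+) b1 = (j == n1.*2.+1)].
  have [->|jE] := eqVneq j n1.*2.+1.
    by exists false, true; split=> //; [exact: ramp_start|exact: ramp_stop].
  have [|b [_ H]] := @ramp_cell R l r n1 i0n j (bp l r j) jN jE; first by rewrite lexx ltW.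
  exists b, b; split; [apply: H|apply: H|by rewrite addbb]; by rewrite lexx ltW.
(* Strands are renamed so that [st b] starts on side [b] of this cell even past the half twists. *)
pose u := b0 && odd `|w|%N.
pose st (b : bool) : set (space3 R) :=
  strand (band w (ramp l r n1) (profile l r) (b (+) u)) (bp l r j) (bp l r j.+1).
have cE : cell j = st false `|` st true.
  rewrite /band_cell (negbTE nch) /twist_cell /st.
  by case: (u) => /=; rewrite // setUC.
have rc : continuous (ramp l r n1 : R -> R) by rewrite /ramp /clamp; cont.
have pc : continuous (profile l r : R -> R) by rewrite /profile; cont.
exists st; split=> [//|b||d b].
- by apply: strand_closed; rewrite /band; cont.
- apply/seteqP; split=> p // -[[_ p1] [_ p2]].
  by case: (@band_neq p.1.1); move: p1 p2; case: (u) => /= <- <-.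
- have bf (e v : bool) (x : R) : ramp l r n1 x = v%:R ->
      band w (ramp l r n1) (profile l r) e x = ((e (+) (v && odd `|w|%N))%:R, profile l r x).
    by move=> rb; have := band_flat w (profile l r) (e (+) (v && odd `|w|%N)) rb; rewrite addbK.
  rewrite /st /en; split; case: d => /=; try by rewrite lexx ltW.
    rewrite (bf _ _ _ r1) -bE /u; congr (_%:R, _).
    by case: (b) (b0) (b1) (odd _) => -[] [] [].
  by rewrite (bf _ _ _ r0) /u addbK addbF.
Qed.

Let flat_labelled j : (j < N)%N -> ~~ is_child l r j ->
  labelled (cell j) (en pt j j.+1) (Some (odd `|w|%N && (j == n1.*2.+1))) 0.
Proof.
by move=> jN nch; have [st [-> h1 h2 h3]] := flat_strands jN nch; exact: labelled_strands.
Qed.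

Let ty j := if is_child l r j then transpose (tau j./2.-1)
  else Some (odd `|w|%N && (j == n1.*2.+1)).
Let kk j := if is_child l r j then k j./2.-1 else 0%N.

Let cell_labelled j : (j < N)%N -> labelled (cell j) (en pt j j.+1) (ty j) (kk j).
Proof.
rewrite /ty /kk; case: ifP => ch jN; first exact: child_labelled.
by apply: flat_labelled; rewrite ?ch.
Qed.

Let cell_pt j d b : (j < N)%N -> cell j (en pt j j.+1 d b).
Proof.
move=> jN; have [ch|nch] := boolP (is_child l r j).
  have [jE i_n i1] := child_index ch; have [c cE _] := nth_pieces_child i_n i1.
  rewrite /band_cell ch straight//; exists (corner b d); first exact: position_corner (HY i_n cE).
  by rewrite slot_corner// addbF -jE.
have [st [-> _ _ /(_ d b)]] := flat_strands jN nch.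
by case: arc; [right|left].
Qed.

Lemma node_labelled : position (Node w l r) (chain cell 0 N) /\
  labelled (chain cell 0 N) corner (compose_upto ty N)
    (\sum_(0 <= i < N) kk i + (\sum_(0 <= i < N) (ty i == None : nat)).-1).
Proof.
split; first exact: cell_position.
have H := labelled_chain (cell_closed HY) (cell_range HY) (@bp_lt R l r) (cell_adj i0n HY) cell_pt
   (ltn0Sn _) (leqnn N) (fun i iN => cell_labelled iN).
by apply: labelled_ends H => d b; rewrite /en; case: d; rewrite ?ptN ?pt0.
Qed.

End NodeLabels.

(** Without a cut the crossings of the cells add up modulo 2, so the value at the single place [tw]
    controls the total. *)
Lemma compose_pass ty tw (o : bool) j :
  (forall i, (i < j)%N -> ty i != None) -> ty tw = Some false -> exists y,
  forall o, compose_upto (fun i => if i == tw then Some o else ty i) j =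
    Some (y (+) (o && (tw < j)%N)).
Proof.
move=> + twE; elim: j => [|j IH] H; first by exists false => o'; rewrite /= andbF.
have [y yE] := IH (fun i ij => H i (ltnW ij)).
case E : (ty j) (H j (ltnSn j)) => [x|] // _; exists (y (+) x) => o' /=; rewrite yE E ltnS.
have [jt|jt] := eqVneq j tw.
  move: E; rewrite jt twE => -[<-]; rewrite ltnn leqnn /= andbF andbT.
  by rewrite !addbF.
have -> : (tw <= j)%N = (tw < j)%N by rewrite [RHS]ltn_neqAle eq_sym jt.
by rewrite /= addbAC.
Qed.

Lemma compose_cut ty j i : (i < j)%N -> ty i = None -> compose_upto ty j = None.
Proof.
elim: j => // j IH; rewrite ltnS leq_eqVlt => /orP[/eqP-> /= ->|ij tyi] /=.
  by case: compose_upto.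
by rewrite IH.
Qed.

Section Lower.
Context {R : realType}.

(** Arranged so that closing up yields [P + 1] curves in both cases: two straight arcs become two
    curves, to be added to [P - 1], and arcs that turn back become one, to be added to [P]. *)
Definition flexible (T : plane_tree int) :=
  let P := (path_cover T).1 in
  let realizes tau k := exists T' (Y : set (space3 R)),
    [/\ underlying T' = underlying T, position T' Y & labelled Y corner tau k] in
  if (path_cover T).2 then forall x, realizes (Some x) P.-1 else realizes None P.

Section Node.
Variables (w : int) (l r : seq (plane_tree int)).
Let n1 := size l.
Let n := (size l + size r)%N.
Let mn := n.+1.*2.+1.
Let N := mn.+2.
Let T0 : plane_tree int := Node 0 [::] [::].
Hypothesis IH : forall c, inseq c (l ++ r) -> flexible c.

Let op i := (piece_cover l r i).2.
Let P i := (piece_cover l r i).1.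
Let m := count snd ([seq path_cover c | c <- l] ++ [seq path_cover c | c <- r]).
Let S := sumn (unzip1 ([seq path_cover c | c <- l] ++ [seq path_cover c | c <- r])).

(** A lone open child is given crossed arcs, which plumbing preserves, so that the band runs
    through. If there are several, straight arcs are chosen, which plumbing turns into cuts. *)
Let tau i := if op i then Some (m <= 1)%N else None.
Let k i := (P i - op i)%N.

Let pieceL i : (i < n1)%N -> nth None (pieces l r) i = Some (nth T0 l i).
Proof. by move=> il; rewrite nth_cat size_map il (nth_map T0). Qed.

Let pieceR i : (i < size r)%N -> nth None (pieces l r) (n1.+1 + i)%N = Some (nth T0 r i).
Proof.
move=> ir; rewrite nth_cat size_map -/n1 ltnNge (leq_trans (leqnSn _) (leq_addr _ _)) /=.
by rewrite addSn subSn ?leq_addr// addKn /= (nth_map T0).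
Qed.

Let op_n1 : op n1 = false.
Proof. by rewrite /op /piece_cover nth_pieces. Qed.

Let P_gt0 i : op i -> (0 < P i)%N.
Proof. by rewrite /op /P /piece_cover; case: nth => // c; exact: path_cover_gt0. Qed.

Let sum_op : (\sum_(0 <= i < n.+1) (op i : nat) = m)%N.
Proof.
rewrite /m count_pieces -sum1_count [RHS]big_mkcond /= /index_iota subn0.
by apply: eq_bigr => i _; rewrite -/(op i); case: (op i).
Qed.

Let sum_k : (\sum_(0 <= i < n.+1) k i + m = S)%N.
Proof.
rewrite -sum_op -big_split /= /S -sum_pieces; apply: eq_bigr => i _.
by rewrite /k subnK//; case E : (op i) => //; exact: P_gt0.
Qed.

(** The weights below the vertex are settled here; its own weight [w'] stays free, since its parity
    depends on the type to be realized. *)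
Lemma node_realizes : exists l' r',
  (forall w', underlying (Node w' l' r') = underlying (Node w l r)) /\
  forall w', let ty j := if is_child l r j then transpose (tau j./2.-1)
    else Some (odd `|w'|%N && (j == n1.*2.+1)) in
  exists Y : set (space3 R), position (Node w' l' r') Y /\
  labelled Y corner (compose_upto ty N)
    (\sum_(0 <= i < n.+1) k i + (\sum_(0 <= i < n.+1) (transpose (tau i) == None : nat)).-1).
Proof.
have /choice[cY HcY] (i : nat) : exists cY : plane_tree int * set (space3 R),
    forall c, (i <= n)%N -> nth None (pieces l r) i = Some c ->
    [/\ underlying cY.1 = underlying c, position cY.1 cY.2 & labelled cY.2 corner (tau i) (k i)].
  have [i_n|i_n] := leqP i n; last by exists (T0, set0) => c.
  case E : (nth None (pieces l r) i) => [c|]; last by exists (T0, set0).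
  have i1 : i != n1 by apply/eqP => E'; move: E; rewrite E' nth_pieces.
  have [c' cE' ic] := nth_pieces_child i_n i1; move: cE'; rewrite E => -[cc].
  have := IH ic; rewrite -cc /flexible /tau /k /op /P /piece_cover E.
  case: (path_cover c) => Pc [] /= H.
    have [T' [Y [h1 h2 h3]]] := H (m <= 1)%N; exists (T', Y) => _ _ [<-]; split=> //.
    by rewrite subn1.
  have [T' [Y [h1 h2 h3]]] := H; exists (T', Y) => _ _ [<-]; split=> //.
  by rewrite subn0.
pose l' := [seq (cY i).1 | i <- iota 0 n1].
pose r' := [seq (cY i).1 | i <- iota n1.+1 (size r)].
have sl : size l' = n1 by rewrite size_map size_iota.
have sr : size r' = size r by rewrite size_map size_iota.
have piece' i c : (i <= n)%N -> nth None (pieces l' r') i = Some c -> c = (cY i).1 /\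
    exists c0, nth None (pieces l r) i = Some c0.
  move=> i_n; have [E|E|E] := ltngtP i n1.
  - rewrite nth_cat size_map sl E -map_comp (nth_map 0%N) ?size_iota//= nth_iota// add0n => -[<-].
    by split=> //; exists (nth T0 l i); exact: pieceL.
  - have [j iE] : exists j, i = (n1.+1 + j)%N by exists (i - n1.+1)%N; rewrite subnKC.
    have jr : (j < size r)%N by move: i_n; rewrite iE /n /n1; clear; lia.
    rewrite iE nth_cat size_map sl ltnNge (leq_trans (leqnSn _) (leq_addr _ _)) /=.
    rewrite addSn subSn ?leq_addr// addKn /= -map_comp.
    rewrite (nth_map 0%N) ?size_iota//= nth_iota// => -[<-].
    by split=> //; exists (nth T0 r j); exact: pieceR.
  - by rewrite E -sl nth_pieces.
exists l', r'; split=> w'.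
  have eqm (s s' : seq (plane_tree int)) : size s = size s' ->
      (forall i, (i < size s)%N -> underlying (nth T0 s i) = underlying (nth T0 s' i)) ->
      [seq relabel (fun=> tt) c | c <- s] = [seq relabel (fun=> tt) c | c <- s'].
    move=> ss H; apply: (@eq_from_nth _ (Node tt [::] [::])); rewrite !size_map// => i is_.
    by rewrite !(nth_map T0) -?ss//; exact: H.
  rewrite /underlying /=; congr Node; apply: eqm; rewrite ?sl ?sr// => i il.
    rewrite (nth_map 0%N) ?size_iota// nth_iota// add0n.
    by have [] := HcY i _ (leq_trans (ltnW il) (leq_addr _ _)) (pieceL il).
  rewrite (nth_map 0%N) ?size_iota// nth_iota//.
  have i_n : (n1.+1 + i <= n)%N by rewrite addSnnS leq_add2l.
  by have [] := HcY _ _ i_n (pieceR il).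
move=> ty.
have nE : (size l' + size r')%N = n by rewrite sl sr.
have HYL i c : (i <= size l' + size r')%N -> nth None (pieces l' r') i = Some c ->
    position c (cY i).2 /\ labelled (cY i).2 corner (tau i) (k i).
  rewrite nE => i_n E; have [-> [c0 E0]] := piece' i c i_n E.
  by have [] := HcY i c0 i_n E0.
have [pY lY] := @node_labelled R w' l' r' (fun i => (cY i).2) tau k
  (fun i c i_n E => (HYL i c i_n E).1) (fun i c i_n E => (HYL i c i_n E).2).
eexists; split; first exact: pY.
have chE j : is_child l' r' j = is_child l r j by rewrite /is_child sl sr.
have tyE : ty = (fun j => if is_child l' r' j then transpose (tau j./2.-1)
    else Some (odd `|w'|%N && (j == (size l').*2.+1))).
  by apply: funext => j; rewrite chE sl.
move: lY; rewrite -tyE nE -/mn -/N.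
have -> : (\sum_(0 <= i < N) (if is_child l' r' i then k i./2.-1 else 0) =
    \sum_(0 <= i < n.+1) k i)%N.
  rewrite -(@sum_children l r k); first by apply: eq_bigr => i _; rewrite chE.
  by rewrite /k /P /piece_cover nth_pieces.
suff -> : (\sum_(0 <= i < N) ((if is_child l' r' i then transpose (tau i./2.-1)
      else Some (odd `|w'|%N && (i == (size l').*2.+1))) == None : nat) =
    \sum_(0 <= i < n.+1) (transpose (tau i) == None : nat))%N by [].
rewrite -(@sum_children l r (fun i => (transpose (tau i) == None : nat))).
  by apply: eq_bigr => i _; rewrite chE; case: ifP.
by rewrite /tau op_n1.
Qed.

Lemma node_flexible : flexible (Node w l r).
Proof.
have [l' [r' [un real]]] := node_realizes.
rewrite /flexible /= -/m -/S.
have cutE i : (transpose (tau i) == None) = op i && (1 < m)%N.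
  by rewrite /tau leqNgt; case: (op i) => //=; case: (1 < m)%N.
have le1 : (m <= 1)%N -> forall x, exists T' (Y : set (space3 R)),
    [/\ underlying T' = underlying (Node w l r), position T' Y &
        labelled Y corner (Some x) (S - m)].
  move=> m1 x.
  have uncut i : transpose (tau i) != None by rewrite cutE ltnNge m1 andbF.
  pose ty j := if is_child l r j then transpose (tau j./2.-1) else Some false.
  have twl : is_child l r n1.*2.+1 = false by rewrite /is_child /= odd_double.
  have [||y yE] := @compose_pass ty n1.*2.+1 false N.
  - by move=> i _; rewrite /ty; case: ifP.
  - by rewrite /ty twl.
  (* The parity of the weight corrects the total crossing [y] of the other cells to the desired
     [x]. *)
  pose o := x (+) y.
  have [Y [pY lY]] := real (o : nat)%:Z.
  exists (Node (o : nat)%:Z l' r'), Y; split=> //.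
  move: lY; rewrite -sum_k addnK.
  have -> : (fun j => if is_child l r j then transpose (tau j./2.-1)
      else Some (odd `|(o : nat)%:Z|%N && (j == n1.*2.+1))) =
      (fun i => if i == n1.*2.+1 then Some o else ty i).
    apply: funext => j; rewrite /ty; have [->|jn] := eqVneq j n1.*2.+1.
      by rewrite twl andbT /=; case: (o).
    by rewrite andbF.
  have tN : (n1.*2.+1 < N)%N by rewrite /N /mn /n /n1; clear; lia.
  rewrite yE tN andbT /o addbC addbK.
  have -> : (\sum_(0 <= i < n.+1) (transpose (tau i) == None : nat) = 0)%N.
    by apply: big1 => i _; rewrite (negbTE (uncut i)).
  by rewrite addn0.
(* The path number is [S + 1] for [m = 0] and [S] for [m = 1], so [S - m] is one less than it. For
   larger [m] the cuts add [m - 1] curves to the [S - m] inside the children. *)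
case mE : m le1 sum_k => [|[|m']] //= le1 sk.
- by move=> x; have := le1 isT x; rewrite subn0.
- by move=> x; have := le1 isT x; rewrite subn1.
have : has op (iota 0 n.+1) by rewrite has_count -count_pieces -/m mE.
move=> /hasP[i]; rewrite mem_iota /= add0n ltnS => i_n oi.
have i1 : i != n1 by apply: contraTneq oi => ->; rewrite op_n1.
have [Y [pY lY]] := real 0.
exists (Node 0 l' r'), Y; split=> //.
move: lY; have -> : (\sum_(0 <= i < n.+1) (transpose (tau i) == None : nat) = m'.+2)%N.
  by rewrite -mE -sum_op; apply: eq_bigr => j _; rewrite cutE mE andbT.
have -> : S.-1 = (\sum_(0 <= i < n.+1) k i + m'.+2.-1)%N by rewrite -sk !addnS.
rewrite (@compose_cut _ N i.*2.+2)//; last first.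
  by rewrite is_child_index//= doubleK; apply/eqP; rewrite cutE oi mE.
by rewrite /N /mn; move: i_n; clear; lia.
Qed.

End Node.

Lemma all_flexible T : flexible T.
Proof. by elim/tree_induction: T => w l r IH; exact: node_flexible. Qed.

Lemma component_path_cover T : exists T', underlying T' = underlying T /\
  ((path_cover T).1.+1%:R%:E <= component_number (arborescent_link R T'))%E.
Proof.
have [T' [Y [un pY H]]] : exists T' (Y : set (space3 R)), [/\ underlying T' = underlying T,
    position T' Y & exists tau, labelled Y corner tau ((path_cover T).1 - (tau != None : nat))
      /\ (tau = None \/ tau = Some false /\ (0 < (path_cover T).1)%N)].
  have := all_flexible T; rewrite /flexible; have := @path_cover_gt0 _ T.
  case: (path_cover T) => P [] /= P0 fl.
    have [T' [Y [h1 h2 h3]]] := fl false; exists T', Y; split=> //.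
    by exists (Some false); rewrite subn1; split=> //; right; split=> //; exact: P0.
  have [T' [Y [h1 h2 h3]]] := fl; exists T', Y; split=> //.
  by exists None; rewrite subn0; split=> //; left.
exists T'; split=> //; move: H => [tau [lY tauE]].
(* The curves through the root strip number [kept.+1]: two if the arcs run straight, one if they
   turn back. They get the first labels, and the closed curves inside the branch those from
   [kept.+1] on. *)
pose kept := tau != None.
pose g (b : bool) : nat := (kept && b : bool).
have [c [c1 c2 c3 c4]] := lY g (fun i => (i + kept.+1)%N).
have cg d b : c (corner d b) = (g b)%:R.
  by rewrite c3 /g /kept; case: tauE => [->//|[-> _]] /=; rewrite andbF addbF.
have [f [hf _ fL]] := root_move pY.
pose st b : set (space3 R) := strand (root_side b) 0 1.
have stc b : closed (st b) by apply: strand_closed; exact: root_side_cont.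
pose C p : R := if `[< Y p >] then c p else if `[< st false p >] then (g false)%:R else (g true)%:R.
have CY p : Y p -> C p = c p by rewrite /C => /asboolT ->.
have Cst b p : st b p -> C p = (g b)%:R.
  rewrite /C; case: asboolP => [Yp sp|_]; first by have [_ [d ->]] := root_meet pY Yp sp erefl.
  by case: asboolP; case: b => // sf st'; case: (root_disjoint sf st').
have [cY Cc] : closed Y /\ forall b, {within st b, continuous C}.
  split; first by have [_ ? _ _] := pY.
  move=> b; apply: within_nearP => p eps stp e0; apply: filterS (near_coord p e0) => q _ stq.
  by rewrite !(Cst b)// subrr normr0.
pose L1 := Y `|` st false `|` st true.
have CL1 : {within L1, continuous C}.
  apply: withinU_continuous => //; first exact: closedU.
  by apply: withinU_continuous => //; apply: within_cont_eq c1 => q /CY ->.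
have fL1 p : arborescent_link R T' p -> L1 (f p) by move=> Lp; rewrite /L1 /st -fL; exists p.
have LC q x : L1 q -> C q = x -> exists2 p, arborescent_link R T' p & (C \o f) p = x.
  by rewrite /L1 /st -fL => -[p Lp <-] E; exists p.
apply: (component_bound (c := C \o f)).
- apply: within_nearP => p eps Lp e0.
  have W : nbhs (f p) [set q | L1 q -> `|C q - C (f p)| < eps].
    by apply: within_near => //; exact: fL1.
  have F : \forall q \near p, L1 (f q) -> `|C (f q) - C (f p)| < eps.
    exact: (homeomorphism_cont hf W).
  by apply: filterS F => q /= H' Lq; apply: H'; exact: fL1.
- move=> p /fL1 /=; case=> [[/[dup] Yp /CY -> | /Cst ->]|/Cst ->]; last 2 first.
  + by exists (g false).
  + by exists (g true).
  + exact: c2.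
- move=> i iP; have [ik|ki] := ltnP i kept.+1.
    have L1c b : L1 (corner false b) by left; left; exact: position_corner pY.
    case: i iP ik => [|i] _ ik.
      apply: (LC (corner false false)) => //.
      by rewrite CY ?cg; [rewrite /g andbF|exact: position_corner pY].
    apply: (LC (corner false true)) => //; rewrite CY ?cg; last exact: position_corner pY.
    by move: ik; rewrite /g; case: (kept) => //; case: i.
  have [|q Yq qE] := c4 (i - kept.+1)%N.
    move: tauE iP ki; rewrite /kept; case=> [->|[-> P0]] /=.
      by rewrite subn0 subn1; case: i.
    by move: P0; clear; lia.
  by apply: (LC q); [left; left|rewrite CY// qE subnK].
Qed.

End Lower.

Theorem theorem1 (R : realType) (T : plane_tree int) :
  (bridge_number (arborescent_link R T)
     <= max_component_number R (underlying T))%E.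
Proof.
apply: le_trans (bridge_path_cover T) _.
have [T' [un H]] := @component_path_cover R T.
apply: le_trans H _; apply: ereal_sup_ubound.
by exists T'.
Qed.
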